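(* There is an absolute constant $c>0$ such that the following holds. Let $D$ be a distribution over $X\times Y$, let $S=\{(x_i,y_i)\}_{i=1}^n\sim D^n$, let $\{h_w:w\in\mathbb R^m\}$ be a parameterized class of functions $h_w:X\to\mathbb R^C$, and let $\Theta:=\{\overline w\in\mathbb R^m:\|\overline w\|_2\le R\}$. Fix $\sigma>0$ and, for $\overline w\in\Theta$, let $Q:=\mathcal N(\overline w,\sigma^2I_m)$. Let $L$ be a loss function such that for each $y$ the map $z\mapsto L(z,y)$ is differentiable, $\ell$-Lipschitz and $\beta$-smooth, and assume that the regularity hypotheses $\mathrm{Reg}(\sigma)$ stated in the context hold. Assume moreover that there exists $B>0$ such that for all $(x,y)$ and all $\overline w\in\Theta$, $$\big|\operatorname{Jen}_Q[L(h_w(x),y)]\big|\le\sigma^2B.$$ Then, for any $\delta\in(0,1)$, with probability at least $1-\delta$ over $S\sim D^n$, we have uniformly for all $\overline w\in\Theta$, $$\begin{aligned}\mathbb E_{(x,y)\sim D}\big[\operatorname{Jen}_Q(L(h_w(x),y))\big]\le{}&\frac1n\sum_{i=1}^n\operatorname{Jen}_Q(L(h_w(x_i),y_i))+2c\,\frac{R\sigma}{\sqrt n}\sqrt{\beta^2J_{S,\sigma}+\ell^2H_{S,\sigma}}\\&+8\sigma^2B\sqrt{\frac{2\ln(4/\delta)}{n}},\end{aligned}$$ where $J_{S,\sigma}$ and $H_{S,\sigma}$ are the sample-dependent quantities defined in the context.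
   Context: A map is $\beta$-smooth if it is differentiable with $\beta$-Lipschitz gradient (Euclidean norm). The Jensen gap of $f$ with respect to a distribution $Q$ on $\mathbb R^m$ is $\operatorname{Jen}_Q[f(w)]:=f(\mathbb E_{w\sim Q}[w])-\mathbb E_{w\sim Q}[f(w)]$. Hypotheses $\mathrm{Reg}(\sigma)$, with $u\sim\mathcal N(0,I_m)$, for the (arbitrary) sample $S$ and each $i\in\{1,\dots,n\}$: the map $w\mapsto h_w(x_i)$ is twice continuously differentiable on $\mathbb R^m$; the Gaussian expectations below and $\mathbb E_u[L(h_{w+\sigma u}(x_i),y_i)]$ are finite, and the latter may be differentiated in $w$ under the expectation sign. Write $J_i(w):=\nabla_wh_w(x_i)\in\mathbb R^{C\times m}$ and $H_{i,k}(w):=\nabla_w^2(h_w(x_i))_k\in\mathbb R^{m\times m}$. There exist sample-dependent matrices $G_i\succeq0$ with $J_i(w)^\top J_i(w)\preceq G_i$ for all $w\in\Theta$. The quantity $$A_{i,\sigma}:=\sup_{w\in\Theta}\int_0^1\mathbb E_u\big[u^\top J_i(w+t\sigma u)^\top J_i(w+t\sigma u)u\big]dt$$ is finite. There exist sample-dependent matrices $B_{i,\sigma}\succeq0$ such that for all $w\in\Theta$, $$\int_0^1\mathbb E_u\Big[\sum_{k=1}^CH_{i,k}(w+t\sigma u)^\top uu^\top H_{i,k}(w+t\sigma u)\Big]dt\preceq B_{i,\sigma}.$$ Define $J_{S,\sigma}:=\frac1n\sum_{i=1}^nA_{i,\sigma}\operatorname{Trace}(G_i)$ and $H_{S,\sigma}:=\frac1n\sum_{i=1}^n\operatorname{Trace}(B_{i,\sigma})$.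 *)

(* Defs.v *)
From HB Require Import structures.
From mathcomp Require Import all_boot all_order all_algebra.
From mathcomp Require Import all_classical all_reals all_analysis.

Set Implicit Arguments.
Unset Strict Implicit.
Unset Printing Implicit Defensive.

Import Order.TTheory GRing.Theory Num.Theory.
Import numFieldNormedType.Exports.

Local Open Scope classical_set_scope.
Local Open Scope ring_scope.

Section finite_product.
Context {d : measure_display} {T : measurableType d} {R : realType}.

Definition cons_pair n (p : T * n.-tuple T) : n.+1.-tuple T :=
  [tuple of p.1 :: p.2].

Lemma measurable_cons_pair n : measurable_fun setT (@cons_pair n).
Proof. exact: measurable_cons. Qed.

HB.instance Definition _ n :=
  isMeasurableFun.Build _ _ _ _ (@cons_pair n) (@measurable_cons_pair n).

(* The product measure P_0 \x ... \x P_(n-1) on n-tuples, by recursion on n. *)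
Fixpoint prod_prob n :
    ('I_n -> probability T R) -> probability (n.-tuple T) R :=
  match n with
  | 0%N => fun=> \d_[tuple]
  | k.+1 => fun P => distribution
      (P ord0 \x prod_prob (fun i => P (lift ord0 i)))%E (@cons_pair k)
  end.

Lemma prod_prob_box n (P : 'I_n -> probability T R) (A : 'I_n -> set T) :
  (forall i, measurable (A i)) ->
  prod_prob P [set t | forall i, A i (tnth t i)] = (\prod_(i < n) P i (A i))%E.
Proof.
elim: n P A => [|n IH] P A mA /=.
  rewrite big_ord0 diracE mem_set//= => -[]//.
rewrite big_ord_recl -IH//.
rewrite /distribution /pushforward/=.
set B := [set t : n.-tuple T | forall i, A (lift ord0 i) (tnth t i)].
have mB : measurable B.
  rewrite (_ : B = \bigcap_(i in [set: 'I_n])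
      ((@tnth n T)^~ i @^-1` A (lift ord0 i))).
    apply: fin_bigcap_measurable => // i _.
    by rewrite -[X in measurable X]setTI; exact: measurable_tnth.
  by apply/seteqP; split=> t /= Bt i; [move=> _|]; exact: Bt.
rewrite (_ : _ @^-1` _ = A ord0 `*` B); first exact: product_measure1E.
apply/seteqP; split=> -[x t] /=.
  move=> At; split; first exact: (At ord0).
  by move=> i; have := At (lift ord0 i); rewrite tnthS.
move=> [Ax Bt] i; case: (unliftP ord0 i) => [j ->|->//].
by rewrite tnthS; exact: Bt.
Qed.

End finite_product.

Section euclidean_space.
Context {R : realType}.

(* The norm of the normed module 'rV[R]_n is the sup norm; l2norm is the
   Euclidean one. *)
Definition l2norm n (v : 'rV[R]_n) : R := Num.sqrt (\sum_(i < n) v 0 i ^+ 2).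

Definition grad n (f : 'rV[R]_n -> R) (w : 'rV[R]_n) : 'rV[R]_n :=
  \row_(i < n) 'D_(delta_mx 0 i) f w.

Definition hess n (f : 'rV[R]_n -> R) (w : 'rV[R]_n) : 'M[R]_n :=
  \matrix_(i < n, j < n)
    'D_(delta_mx 0 j) (fun w' => 'D_(delta_mx 0 i) f w') w.

(* The library's 'J f w acts on row vectors by right multiplication; its
   transpose is the usual p x n Jacobian matrix. *)
Definition jac n p (f : 'rV[R]_n -> 'rV[R]_p) (w : 'rV[R]_n) : 'M[R]_(p, n) :=
  ('J f w)^T.

Definition twice_continuously_differentiable n p
    (f : 'rV[R]_n -> 'rV[R]_p) : Prop :=
  [/\ forall w, differentiable f w,
      forall w, differentiable (jac f) w &
      forall k : 'I_p, continuous (hess (fun w => f w 0 k))].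

Definition l2_lipschitz n (l : R) (f : 'rV[R]_n -> R) : Prop :=
  forall z z', `|f z - f z'| <= l * l2norm (z - z').

Definition l2_smooth n (beta : R) (f : 'rV[R]_n -> R) : Prop :=
  (forall z, differentiable f z) /\
  (forall z z', l2norm (grad f z - grad f z') <= beta * l2norm (z - z')).

Definition psd n (M : 'M[R]_n) : Prop :=
  M^T = M /\ forall v : 'rV[R]_n, 0 <= (v *m M *m v^T) 0 0.

Definition loewner_le n (M N : 'M[R]_n) : Prop := psd (N - M).

End euclidean_space.

Section gaussian.
Context {R : realType}.

(* Measures on R^m live on m-tuples, which carry the product Borel
   sigma-algebra; rv turns a sample point into a row vector. *)
Definition rv m (t : m.-tuple (measurableTypeR R)) : 'rV[R]_m :=
  \row_(i < m) tnth t i.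

(* N(w, sigma^2 I_m); normal_prob takes the standard deviation. *)
Definition gaussian m (w : 'rV[R]_m) (sigma : R) :
    probability (m.-tuple (measurableTypeR R)) R :=
  prod_prob (fun i : 'I_m => normal_prob (w 0 i) sigma).

Definition std_gaussian m := gaussian (0 : 'rV[R]_m) 1.

Definition jensen_gap m (Q : probability (m.-tuple (measurableTypeR R)) R)
    (f : 'rV[R]_m -> R) : R :=
  f (\row_(i < m) \int[Q]_u (rv u 0 i)) - \int[Q]_u f (rv u).

End gaussian.

Section regularity.
Context {dX dY : measure_display} {X : measurableType dX}
  {Y : measurableType dY} {R : realType} {m C n : nat}.
Variables (h : 'rV[R]_m -> X -> 'rV[R]_C) (L : 'rV[R]_C -> Y -> R).
Variables (r sigma : R).

Local Notation mu := (@lebesgue_measure R).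
Local Notation gamma := (@std_gaussian R m).

Definition l2_ball : set 'rV[R]_m := [set w | l2norm w <= r].

Definition jac_energy (x : X) (w u : 'rV[R]_m) (t : R) : R :=
  let J := jac (h ^~ x) (w + (t * sigma) *: u) in
  (u *m J^T *m J *m u^T) 0 0.

Definition hess_energy (x : X) (w u : 'rV[R]_m) (t : R) : 'M[R]_m :=
  \sum_(k < C)
    let H := hess (fun w' => h w' x 0 k) (w + (t * sigma) *: u) in
    H^T *m u^T *m u *m H.

Definition A_sup (x : X) : \bar R :=
  ereal_sup [set (\int[mu]_(t in `[0%R, 1%R])
    \int[gamma]_u (jac_energy x w (rv u) t)%:E)%E | w in l2_ball].

(* Rintegral is a total function; Reg below requires the integrability of the
   entries of these two matrix-valued integrals. *)
Definition mean_hess_energy (x : X) (w : 'rV[R]_m) (t : R) : 'M[R]_m :=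
  \matrix_(a < m, b < m) \int[gamma]_u (hess_energy x w (rv u) t a b).

Definition int_hess_energy (x : X) (w : 'rV[R]_m) : 'M[R]_m :=
  \matrix_(a < m, b < m) \int[mu]_(t in `[0, 1]) mean_hess_energy x w t a b.

Definition smoothed_loss (x : X) (y : Y) (w : 'rV[R]_m) : R :=
  \int[gamma]_u L (h (w + sigma *: rv u) x) y.

Definition differentiable_under_expectation (x : X) (y : Y) (w : 'rV[R]_m) :
    Prop :=
  let g u := grad (fun w' => L (h (w' + sigma *: u) x) y) w in
  [/\ differentiable (smoothed_loss x y) w,
      forall j, gamma.-integrable setT (fun u => (g (rv u) 0 j)%:E) &
      grad (smoothed_loss x y) w =
        \row_(j < m) \int[gamma]_u (g (rv u) 0 j)].

(* G and B are functions of the whole sample. The conditions on the loss are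
   required only at the centres w in the ball; A_sup is +oo when the supremum
   is infinite. *)
Record Reg (G B : n.-tuple (X * Y) -> 'I_n -> 'M[R]_m) : Prop := {
  Reg_C2 : forall (S : n.-tuple (X * Y)) i,
    twice_continuously_differentiable (h ^~ (tnth S i).1);
  Reg_loss_integrable : forall (S : n.-tuple (X * Y)) i w, l2_ball w ->
    gamma.-integrable setT
      (fun u => (L (h (w + sigma *: rv u) (tnth S i).1) (tnth S i).2)%:E);
  Reg_jac_integrable : forall (S : n.-tuple (X * Y)) i w t,
    l2_ball w -> 0 <= t <= 1 ->
    gamma.-integrable setT (fun u => (jac_energy (tnth S i).1 w (rv u) t)%:E);
  Reg_hess_integrable : forall (S : n.-tuple (X * Y)) i w t a b,
    l2_ball w -> 0 <= t <= 1 ->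
    gamma.-integrable setT
      (fun u => (hess_energy (tnth S i).1 w (rv u) t a b)%:E);
  Reg_hess_integrable_time : forall (S : n.-tuple (X * Y)) i w a b, l2_ball w ->
    mu.-integrable `[0, 1]
      (fun t => (mean_hess_energy (tnth S i).1 w t a b)%:E);
  Reg_diff : forall (S : n.-tuple (X * Y)) i w, l2_ball w ->
    differentiable_under_expectation (tnth S i).1 (tnth S i).2 w;
  Reg_G_psd : forall (S : n.-tuple (X * Y)) i, psd (G S i);
  Reg_G : forall (S : n.-tuple (X * Y)) i w, l2_ball w ->
    let J := jac (h ^~ (tnth S i).1) w in loewner_le (J^T *m J) (G S i);
  Reg_A : forall (S : n.-tuple (X * Y)) i, A_sup (tnth S i).1 \is a fin_num;
  Reg_B_psd : forall (S : n.-tuple (X * Y)) i, psd (B S i);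
  Reg_B : forall (S : n.-tuple (X * Y)) i w, l2_ball w ->
    loewner_le (int_hess_energy (tnth S i).1 w) (B S i)
}.

Definition J_S (G : n.-tuple (X * Y) -> 'I_n -> 'M[R]_m)
    (S : n.-tuple (X * Y)) : R :=
  n%:R^-1 * \sum_(i < n) fine (A_sup (tnth S i).1) * \tr (G S i).

Definition H_S (B : n.-tuple (X * Y) -> 'I_n -> 'M[R]_m)
    (S : n.-tuple (X * Y)) : R :=
  n%:R^-1 * \sum_(i < n) \tr (B S i).

End regularity.

(* Main.v *)
(* By symmetrization and McDiarmid's inequality, the deviation of the means of
   the Jensen gaps over finitely many points w of the ball is at most twice an
   empirical Rademacher average plus 8 M sqrt(2 ln(4/delta)/n), where
   M = sigma^2 B.  The constants do not depend on the number of points, so a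
   dense sequence and dominated convergence give the bound on the whole ball.
   The Rademacher average is bounded by vector contraction (Khintchine): the gap
   Jen_w(x_i, y_i) satisfies
     |Jen_w - Jen_w'|^2 <= (w - w') M_i (w - w')^T,
     M_i = 2 sigma^2 (beta^2 A_i G_i + l^2 B_i),
   so it may be replaced by the linear functionals w |-> <w, q> for the vectors
   q of a decomposition of the M_i into squares, whose Rademacher average is at
   most r sqrt(sum_i tr M_i).  The Lipschitz estimate holds because the
   derivative of the gap along v is the expectation of
   D_v(L o h)(w) - D_v(L o h)(w + sigma u), which the chain rule, the mean value
   formula along t |-> w + t sigma u and Cauchy-Schwarz bound by the energies
   defining A_i and B_i. *)
From HB Require Import structures.
Require Import Defs.
From mathcomp Require Import all_boot all_order all_algebra.
From mathcomp Require Import all_classical all_reals all_analysis.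
From mathcomp Require Import measurable_realfun ring lra zify.

Set Implicit Arguments.
Unset Strict Implicit.
Unset Printing Implicit Defensive.

Import Order.TTheory GRing.Theory Num.Theory.
Import numFieldNormedType.Exports.

Local Open Scope classical_set_scope.
Local Open Scope ring_scope.

(** Suprema are taken over N+1 parameters only, as maxima of the coordinates of a row vector, so
    that everything to be integrated is visibly bounded and measurable. Random signs are not
    modelled by a probability space but by a finite average defined by recursion on a list;
    symmetrization and contraction then become inductions that replace one vector at a time.

    The Lipschitz estimate for the gap is kept as a quadratic form rather than a scalar constant,
    because the bound is to involve traces: splitting M_i into squares replaces the gap by linear
    functionals whose squared norms add up to tr M_i.

    The constant c = 2 sqrt 2 is half of 4 sqrt 2, the product of 2 from symmetrization, 2 from the
    factor 1/2 in Khintchine's inequality, and sqrt 2 from (p + q)^2 <= 2 p^2 + 2 q^2, applied to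
    the two parts of the derivative of the gap. *)

(** * Averages over random signs and Khintchine's inequality *)

Section rademacher_average.
Context {R : realType}.

(* The average of F over all the points a +- v_1 +- ... +- v_k. *)
Fixpoint sign_avg (V : zmodType) (F : V -> R) (s : seq V) (a : V) : R :=
  if s is v :: s' then
    (sign_avg F s' (a + v) + sign_avg F s' (a - v)) / 2
  else F a.

Lemma sign_avg_le (V : zmodType) (F G : V -> R) s a :
  (forall x, F x <= G x) -> sign_avg F s a <= sign_avg G s a.
Proof.
move=> FG; elim: s a => [|v s IH] a //=.
by rewrite ler_pM2r ?invr_gt0// lerD.
Qed.

Lemma eq_sign_avg (V : zmodType) (F G : V -> R) s a :
  (forall x, F x = G x) -> sign_avg F s a = sign_avg G s a.
Proof. by move=> FG; elim: s a => [|v s IH] a //=; rewrite !IH. Qed.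

Lemma sign_avg_cst (V : zmodType) (c : R) (s : seq V) a :
  sign_avg (fun=> c) s a = c.
Proof. by elim: s a => [|v s IH] a //=; rewrite !IH; field. Qed.

Lemma sign_avgD (V : zmodType) (F G : V -> R) s a :
  sign_avg (fun x => F x + G x) s a = sign_avg F s a + sign_avg G s a.
Proof. by elim: s a => [|v s IH] a //=; rewrite !IH; field. Qed.

Lemma sign_avgZ (V : zmodType) (c : R) (F : V -> R) s a :
  sign_avg (fun x => c * F x) s a = c * sign_avg F s a.
Proof. by elim: s a => [|v s IH] a //=; rewrite !IH; field. Qed.

Lemma sign_avg_comp (V W : zmodType) (f : {additive V -> W}) (F : W -> R) s a :
  sign_avg (F \o f) s a = sign_avg F (map f s) (f a).
Proof. by elim: s a => [|v s IH] a //=; rewrite !IH raddfB raddfD. Qed.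

Lemma sign_avg_cat (V : zmodType) (F : V -> R) s t a :
  sign_avg F (s ++ t) a = sign_avg (sign_avg F t) s a.
Proof. by elim: s a => [|v s IH] a //=; rewrite !IH. Qed.

Lemma sign_avg_shift (V : zmodType) (F : V -> R) s a b :
  sign_avg F s (a + b) = sign_avg (fun x => F (x + b)) s a.
Proof. by elim: s a => [|v s IH] a //=; rewrite -!IH ![_ + b + _]addrAC. Qed.

(** Independent signs may be averaged in any order. The contraction argument uses this to bring the
    signs under treatment innermost, next to the maximum. *)
Lemma sign_avgC (V : zmodType) (F : V -> R) s t a :
  sign_avg (sign_avg F t) s a = sign_avg (sign_avg F s) t a.
Proof.
elim: t s a => [|v t IH] s a; first exact: eq_sign_avg.
rewrite [RHS]/= -!IH !sign_avg_shift -sign_avgD mulrC -sign_avgZ.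
by apply: eq_sign_avg => x /=; rewrite mulrC.
Qed.

Lemma sign_avgN (V : zmodType) (F : V -> R) s a :
  sign_avg F s (- a) = sign_avg (fun x => F (- x)) s a.
Proof.
elim: s a => [|v s IH] a //=; rewrite -!IH opprB opprD addrC [v - a]addrC //.
Qed.

Lemma sign_avg_sqr (s : seq R) a :
  sign_avg (fun x => x ^+ 2) s a = a ^+ 2 + \sum_(v <- s) v ^+ 2.
Proof.
elim: s a => [|v s IH] a /=; first by rewrite big_nil addr0.
by rewrite !IH big_cons; field.
Qed.

(** The right-hand side is the fourth moment of a Gaussian of mean [a] whose variance is the sum of
    squares. A further sign [v] contributes v^4 where the Gaussian has 3 v^4; all other terms
    agree. *)
Lemma sign_avg_exp4 (s : seq R) a :
  sign_avg (fun x => x ^+ 4) s a <=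
  a ^+ 4 + 6 * a ^+ 2 * (\sum_(v <- s) v ^+ 2)
  + 3 * (\sum_(v <- s) v ^+ 2) ^+ 2.
Proof.
elim: s a => [|v s IH] a /=; first by rewrite big_nil; lra.
rewrite big_cons; set S := \sum_(_ <- _) _ in IH *.
have := IH (a + v); have := IH (a - v).
have : 0 <= v ^+ 4 by rewrite (_ : 4 = 2 * 2)%N // exprM sqr_ge0.
set x := sign_avg _ _ _; set y := sign_avg _ _ _ => v4 h1 h2.
rewrite ler_pdivrMr//.
apply: (le_trans (lerD h2 h1)).
rewrite -subr_ge0.
by rewrite (_ : _ - _ = 4 * v ^+ 4); [rewrite mulr_ge0|ring].
Qed.

(* Khintchine's inequality, from the second and fourth moments and
   [(t - 2)^2 (t + 4) >= 0] for [t = |x| / s]. *)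
Lemma khintchine (s : seq R) :
  Num.sqrt (\sum_(v <- s) v ^+ 2) / 2 <= sign_avg Num.norm s 0.
Proof.
set S := \sum_(_ <- _) _.
have S0 : 0 <= S by apply: sumr_ge0 => i _; exact: sqr_ge0.
have [->|Sneq0] := eqVneq S 0.
  rewrite sqrtr0 mul0r -[leLHS](sign_avg_cst 0 s 0).
  by apply: sign_avg_le.
have Spos : 0 < S by rewrite lt_def Sneq0.
set q := Num.sqrt S; have q0 : 0 < q by rewrite sqrtr_gt0.
have qS : q ^+ 2 = S by rewrite sqr_sqrtr.
have key (x : R) : 3 / (4 * q) * x ^+ 2 + (- (16 * q ^+ 3)^-1) * x ^+ 4 <= `|x|.
  rewrite -(real_normK (num_real x)) (_ : x ^+ 4 = `|x| ^+ 4); last first.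
    by rewrite -normrX ger0_norm// (_ : 4 = 2 * 2)%N // exprM sqr_ge0.
  move: (normr_ge0 x); move: `|x| => y y0.
  rewrite -subr_ge0 (_ : _ - _ = y * (y - 2 * q) ^+ 2 * (y + 4 * q) / (16 * q ^+ 3)).
    apply: divr_ge0; last by rewrite mulr_ge0// exprn_ge0// ltW.
    by apply: mulr_ge0; [rewrite mulr_ge0// sqr_ge0|lra].
  by field; lra.
(* Averaging [key] with second moment q^2 and fourth moment at most 3 q^4 gives at least 3q/4 -
   3q/16 = 9q/16, more than q/2. *)
apply: le_trans (sign_avg_le _ _ key).
rewrite sign_avgD !sign_avgZ sign_avg_sqr -/S expr0n/= add0r.
have := sign_avg_exp4 s 0; rewrite -/S !expr0n/= mulr0 mul0r !add0r -qS => h.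
rewrite mulNr lerBrDr.
have -> : 3 / (4 * q) * q ^+ 2 = q / 2 + q / 4 by field; lra.
rewrite lerD2l mulrC ler_pdivrMr ?mulr_gt0 ?exprn_gt0//.
apply: (le_trans h); rewrite -subr_ge0 (_ : _ - _ = q ^+ 4); last by field.
by rewrite exprn_ge0// ltW.
Qed.

End rademacher_average.

(** * Inner product and Euclidean norm on row vectors *)

Section euclidean_geometry.
Context {R : realType}.

Definition dot n (u v : 'rV[R]_n) : R := \sum_(i < n) u 0 i * v 0 i.

Lemma dotC n (u v : 'rV[R]_n) : dot u v = dot v u.
Proof. by apply: eq_bigr => i _; rewrite mulrC. Qed.

Lemma dotDl n (u u' v : 'rV[R]_n) : dot (u + u') v = dot u v + dot u' v.
Proof. by rewrite -big_split; apply: eq_bigr => i _; rewrite mxE mulrDl. Qed.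

Lemma dotZl n c (u v : 'rV[R]_n) : dot (c *: u) v = c * dot u v.
Proof. by rewrite big_distrr; apply: eq_bigr => i _; rewrite mxE -mulrA. Qed.

Lemma dot0l n (v : 'rV[R]_n) : dot 0 v = 0.
Proof. by rewrite -(scale0r 0) dotZl mul0r. Qed.

Lemma dotNl n (u v : 'rV[R]_n) : dot (- u) v = - dot u v.
Proof. by rewrite -scaleN1r dotZl mulN1r. Qed.

Lemma dotBl n (u u' v : 'rV[R]_n) : dot (u - u') v = dot u v - dot u' v.
Proof. by rewrite dotDl dotNl. Qed.

Lemma dotDr n (u v v' : 'rV[R]_n) : dot u (v + v') = dot u v + dot u v'.
Proof. by rewrite dotC dotDl !(dotC u). Qed.

Lemma dotBr n (u v v' : 'rV[R]_n) : dot u (v - v') = dot u v - dot u v'.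
Proof. by rewrite dotC dotBl !(dotC u). Qed.

Lemma dotZr n c (u v : 'rV[R]_n) : dot u (c *: v) = c * dot u v.
Proof. by rewrite dotC dotZl dotC. Qed.

Lemma dotE n (u v : 'rV[R]_n) : dot u v = (u *m v^T) 0 0.
Proof. by rewrite mxE; apply: eq_bigr => i _; rewrite mxE. Qed.

Lemma dotvv_ge0 n (u : 'rV[R]_n) : 0 <= dot u u.
Proof. by apply: sumr_ge0 => i _; rewrite -expr2 sqr_ge0. Qed.

Lemma dotvv_eq0 n (u : 'rV[R]_n) : dot u u = 0 -> u = 0.
Proof.
move=> /eqP; rewrite psumr_eq0; last by move=> i _; rewrite -expr2 sqr_ge0.
move=> /allP u0; apply/rowP => i; rewrite mxE.
by have := u0 i (mem_index_enum _); rewrite -expr2 sqrf_eq0 => /eqP.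
Qed.

Lemma l2normE n (u : 'rV[R]_n) : l2norm u = Num.sqrt (dot u u).
Proof. by congr Num.sqrt; apply: eq_bigr => i _; rewrite expr2. Qed.

Lemma l2norm_ge0 n (u : 'rV[R]_n) : 0 <= l2norm u.
Proof. exact: sqrtr_ge0. Qed.

Lemma l2norm_sqr n (u : 'rV[R]_n) : l2norm u ^+ 2 = dot u u.
Proof. by rewrite l2normE sqr_sqrtr// dotvv_ge0. Qed.

Lemma cauchy_schwarz n (u v : 'rV[R]_n) : `|dot u v| <= l2norm u * l2norm v.
Proof.
have [v0|v0] := eqVneq (dot v v) 0.
  move/dotvv_eq0 : (v0) => ->.
  by rewrite dotC dot0l normr0 mulr_ge0 ?l2norm_ge0.
have vpos : 0 < dot v v by rewrite lt_def v0 dotvv_ge0.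
rewrite -(ler_pXn2r (ltn0Sn 1)) ?nnegrE ?mulr_ge0 ?l2norm_ge0//.
rewrite exprMn !l2norm_sqr real_normK ?num_real//.
(* The squared norm of this vector is [dot v v] times the difference of the two sides. *)
have := dotvv_ge0 (dot v v *: u - dot u v *: v).
rewrite dotBl !dotBr !dotZl !dotZr (dotC v u) => h.
rewrite -(ler_pM2l vpos) -subr_ge0; apply: le_trans h _.
by rewrite le_eqVlt; apply/orP; left; apply/eqP; ring.
Qed.

Lemma dot_le n (u v : 'rV[R]_n) : dot u v <= l2norm u * l2norm v.
Proof. exact: le_trans (ler_norm _) (cauchy_schwarz _ _). Qed.

Lemma l2normZ n c (u : 'rV[R]_n) : l2norm (c *: u) = `|c| * l2norm u.
Proof.
by rewrite !l2normE dotZl dotZr mulrA -expr2 sqrtrM ?sqr_ge0// sqrtr_sqr.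
Qed.

Lemma l2norm_triangle n (u v : 'rV[R]_n) : l2norm (u + v) <= l2norm u + l2norm v.
Proof.
rewrite -(ler_pXn2r (ltn0Sn 1)) ?nnegrE ?addr_ge0 ?l2norm_ge0//.
rewrite sqrrD !l2norm_sqr dotDl !dotDr (dotC v u).
have := dot_le u v; rewrite mulr2n; lra.
Qed.

Lemma normr_coord_le_l2norm n (u : 'rV[R]_n) i : `|u 0 i| <= l2norm u.
Proof.
rewrite -sqrtr_sqr l2normE ler_wsqrtr// [leRHS](bigD1 i)//= -expr2 lerDl.
by apply: sumr_ge0 => j _; rewrite -expr2 sqr_ge0.
Qed.

Lemma sign_avg_dot n (s : seq 'rV[R]_n) a :
  sign_avg (fun x => dot x x) s a = dot a a + \sum_(v <- s) dot v v.
Proof.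
elim: s a => [|v s IH] a /=; first by rewrite big_nil addr0.
by rewrite !IH big_cons !(dotBl, dotBr, dotDl, dotDr) (dotC v a); field.
Qed.

(** A mean is at most the root of the mean square, by ((x + y) / 2)^2 <= (x^2 + y^2) / 2 at each
    sign, and in the mean square the cross terms cancel. *)
Lemma sign_avg_l2norm n (s : seq 'rV[R]_n) :
  sign_avg (@l2norm R n) s 0 <= Num.sqrt (\sum_(v <- s) dot v v).
Proof.
suff sq a : sign_avg (@l2norm R n) s a ^+ 2 <= sign_avg (fun x => dot x x) s a.
  have := sq 0; rewrite sign_avg_dot dot0l add0r => h.
  by apply: le_trans (ler_norm _) _; rewrite -sqrtr_sqr ler_wsqrtr.
elim: s a => [|v s IH] a /=; first by rewrite l2norm_sqr.
have := lerD (IH (a + v)) (IH (a - v)).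
move: (sign_avg _ s (a + v)) (sign_avg _ s (a - v)) => x y h.
apply: (@le_trans _ _ ((x ^+ 2 + y ^+ 2) / 2)); last by rewrite ler_pM2r ?invr_gt0.
rewrite -subr_ge0 (_ : _ - _ = ((x - y) / 2) ^+ 2) ?sqr_ge0//.
by field.
Qed.

End euclidean_geometry.

(** * Vector contraction for maxima over a finite class *)

Section vector_contraction.
Context {R : realType}.

(** A vector of size N+1 lists the values at N+1 parameters, so this is a supremum over a finite
    class. The nonempty index set supplies the starting value of the iterated maximum. *)
Definition vmax N (a : 'rV[R]_N.+1) : R := \big[Num.max/a 0 ord0]_(k < N.+1) a 0 k.

Lemma vmax_ge N (a : 'rV[R]_N.+1) k : a 0 k <= vmax a.
Proof. exact: le_bigmax. Qed.

Lemma vmax_le N (a : 'rV[R]_N.+1) c : (forall k, a 0 k <= c) -> vmax a <= c.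
Proof. by move=> ac; apply: bigmax_le. Qed.

Lemma vmax_attained N (a : 'rV[R]_N.+1) : exists k, vmax a = a 0 k.
Proof.
rewrite /vmax; elim/big_ind : _ => [|x y [k ->] [l ->]|k _]; first by exists ord0.
- by case: (leP (a 0 k) (a 0 l)) => _; [exists l|exists k].
- by exists k.
Qed.

(** If k and l attain the two maxima, twice the left side is a_k + a_l + psi_k - psi_l. Khintchine
    bounds psi_k - psi_l by the mean of |b_k - b_l| over the signed sums b of the doubled vectors;
    the doubling cancels its factor 1/2. The absolute value is then distributed over two maxima,
    which have equal means by the symmetry b -> -b. *)
Lemma vmax_contraction_step N (a psi : 'rV[R]_N.+1) (Q : seq 'rV[R]_N.+1) :
  (forall k l, (psi 0 k - psi 0 l) ^+ 2 <= \sum_(q <- Q) (q 0 k - q 0 l) ^+ 2) ->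
  (vmax (a + psi) + vmax (a - psi)) / 2 <=
  sign_avg (@vmax N) [seq 2 *: q | q <- Q] a.
Proof.
move=> psiQ.
have [k ->] := vmax_attained (a + psi).
have [l ->] := vmax_attained (a - psi).
set s := map _ _.
pose d (b : 'rV[R]_N.+1) := b 0 k - b 0 l.
have dD : zmod_morphism d by move=> x y; rewrite /d !mxE; ring.
pose dA : {additive _ -> _} := HB.pack d (GRing.isZmodMorphism.Build _ _ d dD).
have h : Num.sqrt (\sum_(q <- s) (d q) ^+ 2) / 2 <= sign_avg (fun b => `|d b|) s 0.
  have d0 : d 0 = 0 by rewrite /d !mxE subrr.
  have := sign_avg_comp dA Num.norm s 0; rewrite /= d0 /comp => ->.
  by have := khintchine (map d s); rewrite big_map.
have ds : Num.sqrt (\sum_(q <- s) (d q) ^+ 2) / 2 =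
    Num.sqrt (\sum_(q <- Q) (q 0 k - q 0 l) ^+ 2).
  rewrite big_map (eq_bigr (fun q : 'rV[R]_N.+1 => 2 ^+ 2 * (q 0 k - q 0 l) ^+ 2)); last first.
    by move=> q _; rewrite /d !mxE; ring.
  by rewrite -big_distrr/= sqrtrM ?sqr_ge0// sqrtr_sqr ger0_norm//; field.
rewrite ds in h.
have h1 : psi 0 k - psi 0 l <= sign_avg (fun b => `|d b|) s 0.
  apply: le_trans h; apply: le_trans (ler_norm _) _.
  by rewrite -sqrtr_sqr ler_wsqrtr.
(* The larger of b_k and b_l goes to the maximum of b + a, the other one to that of -b + a. *)
have h2 : sign_avg (fun b => (a 0 k + a 0 l) + `|d b|) s 0 <=
          sign_avg (fun b => vmax (b + a) + vmax (- b + a)) s 0.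
  apply: sign_avg_le => b; rewrite /d.
  have := vmax_ge (b + a) k; have := vmax_ge (b + a) l.
  have := vmax_ge (- b + a) k; have := vmax_ge (- b + a) l.
  rewrite !mxE; case: (ger0P (b 0 k - b 0 l)); lra.
rewrite !sign_avgD !sign_avg_cst in h2.
rewrite -(sign_avgN (fun b => vmax (b + a))) oppr0 -sign_avg_shift add0r in h2.
rewrite !mxE ler_pdivrMr//; move: h1 h2; set e := sign_avg _ _ _ => h1 h2.
set z := sign_avg _ _ _ in h2 *.
by lra.
Qed.

(** One [psi i] is exchanged at a time: the signs of [Q i] are commuted inside all the others, where
    the one-step bound holds pointwise. *)
Lemma vmax_contraction N (I : Type) (t : seq I) (psi : I -> 'rV[R]_N.+1)
    (Q : I -> seq 'rV[R]_N.+1) a :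
  (forall i k l, (psi i 0 k - psi i 0 l) ^+ 2 <=
     \sum_(q <- Q i) (q 0 k - q 0 l) ^+ 2) ->
  sign_avg (@vmax N) [seq psi i | i <- t] a <=
  sign_avg (@vmax N) [seq 2 *: q | q <- flatten [seq Q i | i <- t]] a.
Proof.
move=> psiQ; elim: t a => [|i t IH] a //.
rewrite [map psi _]/= [flatten _]/= map_cat sign_avg_cat sign_avgC.
apply: le_trans (sign_avg_le _ _ (fun b => vmax_contraction_step b (psiQ i))).
set S := map _ (flatten _).
have -> : sign_avg (fun b => (vmax (b + psi i) + vmax (b - psi i)) / 2) S a =
    (sign_avg (@vmax N) S (a + psi i) + sign_avg (@vmax N) S (a - psi i)) / 2.
  rewrite !sign_avg_shift -sign_avgD mulrC -sign_avgZ.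
  by apply: eq_sign_avg => b; rewrite mulrC.
by rewrite /= ler_pM2r ?invr_gt0// lerD.
Qed.

(** Each coordinate of [x *m W^T] is an inner product with a row of [W], so by Cauchy-Schwarz the
    maximum is at most r times the norm of the signed sum. *)
Lemma sign_avg_vmax_linear N m (W : 'M[R]_(N.+1, m)) (r : R) (Q : seq 'rV[R]_m) :
  (forall k, l2norm (row k W) <= r) ->
  sign_avg (@vmax N) [seq q *m W^T | q <- Q] 0 <=
  r * Num.sqrt (\sum_(q <- Q) dot q q).
Proof.
move=> Wr; have r0 : 0 <= r := le_trans (l2norm_ge0 _) (Wr ord0).
rewrite -(mul0mx _ W^T) -(sign_avg_comp (mulmxr W^T)).
apply: le_trans (ler_wpM2l r0 (sign_avg_l2norm Q)).
rewrite -sign_avgZ; apply: sign_avg_le => x /=; apply: vmax_le => k.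
have -> : (x *m W^T) 0 k = dot x (row k W).
  by rewrite mxE; apply: eq_bigr => i _; rewrite !mxE.
by apply: le_trans (dot_le _ _) _; rewrite mulrC ler_wpM2r ?l2norm_ge0.
Qed.

End vector_contraction.

(** * Positive semidefinite matrices as sums of squares *)

Section psd_decomposition.
Context {R : realType}.

Lemma quad_formE n (M : 'M[R]_n) (u v : 'rV[R]_n) :
  (u *m M *m v^T) 0 0 = dot (u *m M) v.
Proof. by rewrite dotE. Qed.

Lemma dot_sym_mulmx n (M : 'M[R]_n) (u v : 'rV[R]_n) :
  M^T = M -> dot (u *m M) v = dot (v *m M) u.
Proof.
move=> sM; rewrite !dotE.
have -> : u *m M *m v^T = (v *m M *m u^T)^T by rewrite !trmx_mul trmxK sM mulmxA.
by rewrite mxE.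
Qed.

Lemma psdD n (M N : 'M[R]_n) : psd M -> psd N -> psd (M + N).
Proof.
move=> [sM M0] [sN N0]; split; first by rewrite linearD/= sM sN.
by move=> v; rewrite mulmxDr mulmxDl mxE addr_ge0.
Qed.

Lemma psdZ n c (M : 'M[R]_n) : 0 <= c -> psd M -> psd (c *: M).
Proof.
move=> c0 [sM M0]; split; first by rewrite linearZ/= sM.
by move=> v; rewrite -scalemxAr -scalemxAl mxE mulr_ge0.
Qed.

(* The Cholesky step: subtracting the square of the pivot row divided by the
   pivot keeps the matrix positive semidefinite and clears that row. *)
Lemma psd_pivot n (M : 'M[R]_n) i : psd M -> M i i != 0 ->
  psd (M - (M i i)^-1 *: ((row i M)^T *m row i M)).
Proof.
move=> [sM M0] d0; set d := M i i in d0 *; set q := row i M.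
split; first by rewrite linearB linearZ/= trmx_mul trmxK sM.
move=> v; rewrite quad_formE mulmxBr dotBl -scalemxAr dotZl.
have -> : dot (v *m (q^T *m q)) v = dot q v ^+ 2.
  by rewrite mulmxA [v *m q^T]mx11_scalar -dotE mul_scalar_mx dotZl dotC expr2.
(* This vector minimizes the form of [M] on the line through [v] along the pivot direction; the
   minimum is the value of the reduced form at [v]. *)
have := M0 (v - (dot q v / d) *: delta_mx 0 i).
rewrite quad_formE mulmxBl dotBl !dotBr -scalemxAl !dotZl !dotZr -rowE -/q.
rewrite (dot_sym_mulmx v (delta_mx 0 i) sM) -rowE -/q.
have -> : dot q (delta_mx 0 i) = d.
  rewrite /dot (bigD1 i)//= big1 ?addr0; first by rewrite !mxE !eqxx mulr1.
  by move=> j /negbTE ji; rewrite !mxE ji mulr0.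
by rewrite (_ : dot q v / d * d = dot q v) ?divfK//; move=> h; lra.
Qed.

(** With a zero diagonal entry the form is affine along the i-th basis vector, so a nonzero slope
    would make it negative somewhere. *)
Lemma psd_diag_eq0 n (M : 'M[R]_n) i : psd M -> M i i = 0 -> row i M = 0.
Proof.
move=> [sM M0] d0; set q := row i M.
apply: dotvv_eq0; apply/eqP; apply: contraT => q0.
(* The multiple is chosen so that the form takes the value -1. *)
have := M0 (q - ((dot (q *m M) q + 1) / (2 * dot q q)) *: delta_mx 0 i).
rewrite quad_formE mulmxBl dotBl !dotBr -scalemxAl !dotZl !dotZr -rowE -/q.
rewrite (dot_sym_mulmx q (delta_mx 0 i) sM) -rowE -/q.
have -> : dot q (delta_mx 0 i) = 0.
  rewrite /dot (bigD1 i)//= big1 ?addr0; first by rewrite !mxE !eqxx mulr1.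
  by move=> j /negbTE ji; rewrite !mxE ji mulr0.
set z := dot (q *m M) q; rewrite !mulr0 subr0.
by rewrite (_ : _ - _ = -1) ?ler0N1//; field.
Qed.

(** Each elimination step splits off one square, the pivot row divided by the root of the pivot. The
    trace formula follows from the first identity, evaluated at the basis vectors. *)
Lemma psd_sum_sqr n (M : 'M[R]_n) : psd M ->
  exists Q : seq 'rV[R]_n,
    (forall v, (v *m M *m v^T) 0 0 = \sum_(q <- Q) dot q v ^+ 2) /\
    \tr M = \sum_(q <- Q) dot q q.
Proof.
move=> pM.
suff [Q QM] : exists Q : seq 'rV[R]_n,
    forall v, (v *m M *m v^T) 0 0 = \sum_(q <- Q) dot q v ^+ 2.
  exists Q; split=> //.
  rewrite /mxtrace (eq_bigr (fun i => \sum_(q <- Q) q 0 i * q 0 i)).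
    by rewrite exchange_big.
  move=> i _; have := QM (delta_mx 0 i).
  rewrite quad_formE -rowE /dot (bigD1 i)//= big1 ?addr0; last first.
    by move=> j /negbTE ji; rewrite !mxE ji mulr0.
  rewrite !mxE !eqxx mulr1 => ->; apply: eq_bigr => q _.
  rewrite (bigD1 i)//= big1 ?addr0; first by rewrite mxE !eqxx mulr1 expr2.
  by move=> j /negbTE ji; rewrite !mxE ji mulr0.
(* Elimination runs from the last row upwards: the rows from k on are zero, and going from k + 1 to
   k uses row k as pivot. *)
have [k M0] : exists k, forall i : 'I_n, (k <= i)%N -> row i M = 0.
  by exists n => i; rewrite leqNgt ltn_ord.
elim: k M pM M0 => [|k IH] M pM M0.
  exists [::] => v; rewrite big_nil (_ : M = 0) ?mulmx0 ?mul0mx ?mxE//.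
  by apply/row_matrixP => i; rewrite M0// row0.
have [nk|kn] := leqP n k.
  apply: IH => // i ki.
  by have := leq_trans nk ki; rewrite leqNgt ltn_ord.
pose i0 := Ordinal kn; set q := row i0 M.
have [d0|d0] := eqVneq (M i0 i0) 0.
  apply: IH => // i; rewrite leq_eqVlt => /predU1P[ki|]; last exact: M0.
  by rewrite (_ : i = i0); [exact: psd_diag_eq0|exact: val_inj].
have dpos : 0 < M i0 i0.
  rewrite lt_def d0; have := pM.2 (delta_mx 0 i0).
  rewrite quad_formE -rowE /dot (bigD1 i0)//= big1 ?addr0; last first.
    by move=> j /negbTE ji; rewrite !mxE ji mulr0.
  by rewrite !mxE !eqxx mulr1.
have [|Q QM] := IH _ (psd_pivot pM d0).
  move=> i ki; apply/rowP => j; rewrite !mxE big_ord1 !mxE.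
  have [->|ii0] := eqVneq i i0; first by rewrite mulrA mulVf// mul1r subrr.
  have /rowP Mi : row i M = 0.
    by apply: M0; rewrite ltn_neqAle ki andbT; apply: contra ii0 => /eqP ki';
      apply/eqP/val_inj.
  have -> : M i0 i = 0.
    by have := Mi i0; rewrite -[in M i0 i]pM.1 !mxE.
  by have := Mi j; rewrite !mxE => ->; rewrite mul0r mulr0 subrr.
exists ((Num.sqrt (M i0 i0))^-1 *: q :: Q) => v.
rewrite big_cons -QM dotZl exprMn exprVn sqr_sqrtr ?ltW//.
rewrite !quad_formE mulmxBr dotBl -scalemxAr dotZl.
rewrite mulmxA [v *m q^T]mx11_scalar -dotE mul_scalar_mx dotZl (dotC v) -expr2.
by rewrite addrC subrK.
Qed.

End psd_decomposition.

(** * Expectations of bounded measurable functions *)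

Section bounded_measurable.
Context {R : realType}.

(** The integrands of symmetrization and concentration all lie in this class. It is stable under the
    operations met there, and its members are integrable for every probability, so linearity and
    Fubini apply without side conditions. *)
Definition bounded_mfun d (T : measurableType d) (f : T -> R) : Prop :=
  measurable_fun setT f /\ exists M, forall x, `|f x| <= M.

Context {d : measure_display} {T : measurableType d}.
Implicit Types f g : T -> R.

Lemma bounded_mfun_cst c : bounded_mfun (fun _ : T => c).
Proof. by split => //; exists `|c|. Qed.

Lemma bounded_mfunD f g :
  bounded_mfun f -> bounded_mfun g -> bounded_mfun (fun x => f x + g x).
Proof.
move=> [mf [M fM]] [mg [M' gM]]; split; first exact: measurable_funD.
by exists (M + M') => x; apply: le_trans (ler_normD _ _) _; rewrite lerD.
Qed.

Lemma bounded_mfunM f g :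
  bounded_mfun f -> bounded_mfun g -> bounded_mfun (fun x => f x * g x).
Proof.
move=> [mf [M fM]] [mg [M' gM]]; split; first exact: measurable_funM.
by exists (M * M') => x; rewrite normrM ler_pM.
Qed.

Lemma bounded_mfunZ c f : bounded_mfun f -> bounded_mfun (fun x => c * f x).
Proof. by move=> bf; apply: bounded_mfunM => //; exact: bounded_mfun_cst. Qed.

Lemma bounded_mfunN f : bounded_mfun f -> bounded_mfun (fun x => - f x).
Proof.
move=> bf; rewrite (_ : (fun x => _) = fun x => -1 * f x).
  exact: bounded_mfunZ.
by apply/funext => x; rewrite mulN1r.
Qed.

Lemma bounded_mfunB f g :
  bounded_mfun f -> bounded_mfun g -> bounded_mfun (fun x => f x - g x).
Proof. by move=> bf bg; apply: bounded_mfunD => //; exact: bounded_mfunN. Qed.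

Lemma bounded_mfun_sum I (s : seq I) (g : I -> T -> R) :
  (forall i, bounded_mfun (g i)) -> bounded_mfun (fun x => \sum_(i <- s) g i x).
Proof.
move=> bg; elim: s => [|i s IH].
  by under eq_fun do rewrite big_nil; exact: bounded_mfun_cst.
by under eq_fun do rewrite big_cons; exact: bounded_mfunD.
Qed.

Lemma bounded_mfun_max f g : bounded_mfun f -> bounded_mfun g ->
  bounded_mfun (fun x => Num.max (f x) (g x)).
Proof.
move=> [mf [M fM]] [mg [M' gM]]; split; first exact: measurable_maxr.
exists (Num.max M M') => x; rewrite le_max.
by case: (leP (f x) (g x)) => _; rewrite ?fM ?gM ?orbT.
Qed.

Lemma bounded_mfun_expR f : bounded_mfun f -> bounded_mfun (fun x => expR (f x)).
Proof.
move=> [mf [M fM]]; split; first exact: measurableT_comp.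
exists (expR M) => x; rewrite ger0_norm ?expR_ge0// ler_expR.
exact: le_trans (ler_norm _) (fM x).
Qed.

Lemma bounded_mfun_comp d' (U : measurableType d') (h : T -> U) (f : U -> R) :
  measurable_fun setT h -> bounded_mfun f -> bounded_mfun (fun x => f (h x)).
Proof.
move=> mh [mf [M fM]]; split; first exact: measurableT_comp.
by exists M => x.
Qed.

Variable P : probability T R.

Lemma bounded_mfun_integrable f : bounded_mfun f ->
  P.-integrable setT (EFin \o f).
Proof.
move=> [mf [M fM]]; apply: measurable_bounded_integrable => //.
  by rewrite (le_lt_trans (probability_le1 _ _))// ltry.
by exists M; split; [exact: num_real|move=> x Mx y _ /=; apply: le_trans (fM y) (ltW Mx)].
Qed.

Lemma EFin_Rintegral f : bounded_mfun f ->
  ((\int[P]_x f x)%:E = \int[P]_x (f x)%:E)%E.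
Proof.
by move=> bf; rewrite fineK//; apply: integrable_fin_num => //;
  exact: bounded_mfun_integrable.
Qed.

Lemma probability_indic (A : set T) : measurable A ->
  P A = (\int[P]_x \1_A x)%:E.
Proof.
move=> mA; rewrite EFin_Rintegral ?integral_indic ?setIT//.
split; first exact: measurable_indic.
by exists 1 => x; rewrite indicE; case: (_ \in _); rewrite ?normr1 ?normr0.
Qed.

Lemma expectation_cst (c : R) : \int[P]_x c = c.
Proof. by rewrite Rintegral_cst//; have /= -> := probability_setT P; rewrite mulr1. Qed.

Lemma expectationD f g : bounded_mfun f -> bounded_mfun g ->
  \int[P]_x (f x + g x) = \int[P]_x f x + \int[P]_x g x.
Proof. by move=> bf bg; rewrite RintegralD//; exact: bounded_mfun_integrable. Qed.

Lemma expectationB f g : bounded_mfun f -> bounded_mfun g ->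
  \int[P]_x (f x - g x) = \int[P]_x f x - \int[P]_x g x.
Proof. by move=> bf bg; rewrite RintegralB//; exact: bounded_mfun_integrable. Qed.

Lemma expectationZ c f : bounded_mfun f ->
  \int[P]_x (c * f x) = c * \int[P]_x f x.
Proof. by move=> bf; rewrite RintegralZl//; exact: bounded_mfun_integrable. Qed.

Lemma le_expectation f g : bounded_mfun f -> bounded_mfun g ->
  (forall x, f x <= g x) -> \int[P]_x f x <= \int[P]_x g x.
Proof.
by move=> bf bg fg; apply: le_Rintegral => //; exact: bounded_mfun_integrable.
Qed.

Lemma normr_expectation_le f M : bounded_mfun f -> (forall x, `|f x| <= M) ->
  `|\int[P]_x f x| <= M.
Proof.
move=> bf fM; rewrite ler_norml; apply/andP; split.
  rewrite -[leLHS]expectation_cst; apply: le_expectation => //.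
    exact: bounded_mfun_cst.
  by move=> x; have := fM x; rewrite ler_norml => /andP[].
rewrite -[leRHS]expectation_cst; apply: le_expectation => //.
  exact: bounded_mfun_cst.
by move=> x; have := fM x; rewrite ler_norml => /andP[].
Qed.

End bounded_measurable.

(** * Iterated expectations of bounded functions *)

Section bounded_fubini.
Context {R : realType} {d d' : measure_display}.
Context {T : measurableType d} {U : measurableType d'}.
Variables (P : probability T R) (Q : probability U R).

Lemma bounded_mfun_sectionl (f : T * U -> R) x :
  bounded_mfun f -> bounded_mfun (fun y => f (x, y)).
Proof. exact: bounded_mfun_comp. Qed.

Lemma bounded_mfun_sectionr (f : T * U -> R) y :
  bounded_mfun f -> bounded_mfun (fun x => f (x, y)).
Proof. exact: bounded_mfun_comp. Qed.

Lemma bounded_mfun_integral (f : T * U -> R) :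
  bounded_mfun f -> bounded_mfun (fun x => \int[Q]_y f (x, y)).
Proof.
move=> bf; split; last first.
  have [_ [M fM]] := bf; exists M => x.
  by apply: normr_expectation_le => //; exact: bounded_mfun_sectionl.
apply/measurable_EFinP.
rewrite (_ : _ \o _ = fubini_F Q (EFin \o f)).
  apply: (measurable_fubini_F (m1 := P)).
  exact: (bounded_mfun_integrable (P \x Q)%E bf).
apply/funext => x /=; rewrite EFin_Rintegral//; exact: bounded_mfun_sectionl.
Qed.

Lemma expectation_prod (f : T * U -> R) : bounded_mfun f ->
  \int[(P \x Q)%E]_z f z = \int[P]_x \int[Q]_y f (x, y).
Proof.
move=> bf; congr fine.
rewrite -(integral12_prod_meas1 (f := EFin \o f)); last first.
  exact: (bounded_mfun_integrable (P \x Q)%E bf).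
apply: eq_integral => x _; rewrite EFin_Rintegral//.
exact: bounded_mfun_sectionl.
Qed.

End bounded_fubini.

Lemma expectation_swap {R : realType} d d' (T : measurableType d)
    (U : measurableType d') (P : probability T R) (Q : probability U R)
    (f : T * U -> R) : bounded_mfun f ->
  \int[P]_x \int[Q]_y f (x, y) = \int[Q]_y \int[P]_x f (x, y).
Proof.
move=> bf; rewrite -expectation_prod//; congr fine.
rewrite -(integral21_prod_meas1 (f := EFin \o f)); last first.
  exact: (bounded_mfun_integrable (P \x Q)%E bf).
apply: eq_integral => x _; rewrite EFin_Rintegral//.
exact: bounded_mfun_sectionr.
Qed.

(** The recursive product is unfolded by one factor; the inductions on the sample size rest on this
    identity. *)
Lemma expectation_prod_probS {R : realType} d (T : measurableType d) n
    (P : 'I_n.+1 -> probability T R) (g : n.+1.-tuple T -> R) :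
  bounded_mfun g ->
  \int[prod_prob P]_t g t =
  \int[P ord0]_x \int[prod_prob (fun i => P (lift ord0 i))]_t g (cons_pair (x, t)).
Proof.
move=> bg.
have bgc : bounded_mfun (g \o @cons_pair _ T n).
  by apply: bounded_mfun_comp => //; exact: measurable_cons_pair.
rewrite -(expectation_prod _ _ bgc); congr fine.
apply: (integral_pushforward (@measurable_cons_pair _ T n) (f := EFin \o g)) => //.
  by apply/measurable_EFinP; exact: bg.1.
exact: (bounded_mfun_integrable (_ \x _)%E bgc).
Qed.

(** * Exponential moments under bounded differences *)

Section bounded_differences.
Context {R : realType}.

Lemma fact_exp2_le_fact_double N : (N`! * 2 ^ N <= (2 * N)`!)%N.
Proof.
elim: N => [|N IH]; first by rewrite muln0.
rewrite mulnS addSn add1n !factS expnS mulnACA (mulnA _.+2).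
by rewrite leq_mul// mulnC; lia.
Qed.

(** The two power series are compared term by term: x^(2N) has coefficients 1/(2N)! and 1/(2^N N!).
    Partial sums of even length are taken so that odd powers cancel in pairs. *)
Lemma cosh_le_expR_sqr (x : R) : expR x + expR (- x) <= 2 * expR (x ^+ 2 / 2).
Proof.
pose u N := series (exp_coeff x) (2 * N)%N + series (exp_coeff (- x)) (2 * N)%N.
pose v N := 2 * series (exp_coeff (x ^+ 2 / 2)) N.
have c2 : (fun N => 2 * N)%N @ \oo --> \oo.
  by move=> A [N _ NA]; exists N => // k /= Nk; apply: NA => /=; lia.
have uE : u @ \oo --> expR x + expR (- x).
  apply: cvgD.
    by apply: (cvg_comp _ _ c2); exact: is_cvg_series_exp_coeff.
  by apply: (cvg_comp _ _ c2); exact: is_cvg_series_exp_coeff.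
have vE : v @ \oo --> 2 * expR (x ^+ 2 / 2).
  by apply: cvgMl_tmp; exact: is_cvg_series_exp_coeff.
apply: (ler_cvg_to uE vE); apply: nearW; rewrite /u /v.
elim => [|N IH]; first by rewrite muln0 !seriesEnat/= !big_geq// mulr0 addr0.
rewrite mulnS !addSn add0n !seriesSr mulrDr.
have -> (a b a1 b1 a2 b2 : R) :
    a + a1 + a2 + (b + b1 + b2) = a + b + (a1 + b1 + (a2 + b2)) by ring.
rewrite lerD// /exp_coeff/=.
have -> : (- x) ^+ (2 * N).+1 = - x ^+ (2 * N).+1.
  by rewrite exprNn -signr_odd/= oddM/= expr1 mulN1r.
have -> : (- x) ^+ (2 * N) = x ^+ (2 * N) by rewrite !exprM sqrrN.
rewrite mulNr subrr addr0 -mulr2n -[leLHS]mulr_natl ler_pM2l//.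
have -> : (x ^+ 2 / 2) ^+ N / N`!%:R = x ^+ (2 * N) / (2 ^+ N * N`!%:R).
  by rewrite expr_div_n -exprM invfM mulrA.
rewrite ler_wpM2l//; first by rewrite exprM exprn_ge0// sqr_ge0.
rewrite lef_pV2 ?posrE ?mulr_gt0 ?exprn_gt0 ?ltr0n ?fact_gt0//.
by rewrite -natrX -natrM ler_nat mulnC fact_exp2_le_fact_double.
Qed.

(** For an independent copy y, the mean of exp(lam (g x - g y)) is the product [a * b], which the
    cosh estimate bounds, and b >= exp(- lam mu) by Jensen. The resulting constant 1/2, instead of
    Hoeffding's 1/8, suffices for the factor 8 in the final bound. *)
Lemma mgf_le_of_oscillation d (T : measurableType d) (P : probability T R)
    (g : T -> R) c lam : bounded_mfun g -> (forall x y, `|g x - g y| <= c) ->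
  \int[P]_x expR (lam * g x) <=
  expR (lam * \int[P]_x g x + lam ^+ 2 * c ^+ 2 / 2).
Proof.
move=> bg gc; set mu := \int[P]_x g x.
set a := \int[P]_x expR (lam * g x).
set b := \int[P]_x expR (- lam * g x).
have bE s : bounded_mfun (fun x => expR (s * g x)).
  by apply: bounded_mfun_expR; exact: bounded_mfunZ.
have a0 : 0 <= a by apply: Rintegral_ge0 => x _; exact: expR_ge0.
(* Jensen's inequality, by integrating the tangent line of the exponential at - lam mu. *)
have Jb : expR (- lam * mu) <= b.
  have -> : expR (- lam * mu) =
      \int[P]_x (expR (- lam * mu) * (1 - lam * (g x - mu))).
    have bl : bounded_mfun (fun x => lam * (g x - mu)).
      by apply: bounded_mfunZ; apply: bounded_mfunB => //; exact: bounded_mfun_cst.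
    rewrite expectationZ; last first.
      by apply: bounded_mfunB => //; exact: bounded_mfun_cst.
    rewrite expectationB//; last exact: bounded_mfun_cst.
    rewrite expectationZ; last first.
      by apply: bounded_mfunB => //; exact: bounded_mfun_cst.
    rewrite expectationB//; last exact: bounded_mfun_cst.
    by rewrite !expectation_cst subrr mulr0 subr0 mulr1.
  apply: le_expectation => //.
    apply: bounded_mfunZ; apply: bounded_mfunB; first exact: bounded_mfun_cst.
    by apply: bounded_mfunZ; apply: bounded_mfunB => //; exact: bounded_mfun_cst.
  move=> x; rewrite -[leRHS](_ : expR (- lam * mu) * expR (- lam * (g x - mu)) = _).
    by rewrite ler_pM2l ?expR_gt0// -mulNr expR_ge1Dx.
  by rewrite -expRD; congr expR; ring.
set K := expR (lam ^+ 2 * c ^+ 2 / 2).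
(* Symmetrizing in x and y produces the hyperbolic cosine; y is integrated out here and x in
   [ab]. *)
have abx x : expR (lam * g x) * b + expR (- lam * g x) * a <= 2 * K.
  rewrite -!expectationZ// -expectationD; [|exact: bounded_mfunZ..].
  rewrite -[leRHS](expectation_cst P); apply: le_expectation.
  - by apply: bounded_mfunD; exact: bounded_mfunZ.
  - exact: bounded_mfun_cst.
  move=> y; rewrite -!expRD.
  have -> : lam * g x + - lam * g y = lam * (g x - g y) by ring.
  have -> : - lam * g x + lam * g y = - (lam * (g x - g y)) by ring.
  apply: le_trans (cosh_le_expR_sqr _) _; rewrite ler_pM2l// ler_expR ler_pM2r//.
  rewrite exprMn ler_wpM2l ?sqr_ge0// -(real_normK (num_real (_ - _))).
  by rewrite ler_pXn2r ?nnegrE// (le_trans _ (gc x y)).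
have ab : a * b <= K.
  rewrite -(ler_pM2l (ltr0Sn R 1)) -[leRHS](expectation_cst P).
  have -> : 2 * (a * b) =
      \int[P]_x (expR (lam * g x) * b + expR (- lam * g x) * a).
    rewrite expectationD; [|by apply: bounded_mfunM => //; exact: bounded_mfun_cst..].
    under eq_Rintegral do rewrite mulrC.
    under [X in _ = _ + X]eq_Rintegral do rewrite mulrC.
    by rewrite !expectationZ// -/a -/b; ring.
  apply: le_expectation => //; last exact: bounded_mfun_cst.
  by apply: bounded_mfunD; apply: bounded_mfunM => //; exact: bounded_mfun_cst.
have -> : expR (lam * mu + lam ^+ 2 * c ^+ 2 / 2) = K / expR (- lam * mu).
  by rewrite -expRN -expRD; congr expR; ring.
by rewrite ler_pdivlMr ?expR_gt0//; apply: le_trans ab; rewrite ler_wpM2l.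
Qed.

Context {d : measure_display} {T : measurableType d} (D : probability T R).

Local Notation sample n := (prod_prob (fun _ : 'I_n => D)).

Lemma expectation_sampleS n (g : n.+1.-tuple T -> R) : bounded_mfun g ->
  \int[sample n.+1]_t g t = \int[D]_x \int[sample n]_t g (cons_pair (x, t)).
Proof. exact: expectation_prod_probS. Qed.

Lemma bounded_mfun_cons_pair n (g : n.+1.-tuple T -> R) : bounded_mfun g ->
  bounded_mfun (fun p => g (cons_pair p)).
Proof. by apply: bounded_mfun_comp; exact: measurable_cons_pair. Qed.

(** The first point is integrated last. With it fixed, the induction hypothesis treats the others;
    the conditional mean [G] inherits the oscillation bound [c] and contributes one more factor. *)
Lemma mcdiarmid_mgf n (g : n.-tuple T -> R) c lam : bounded_mfun g ->
  (forall i t t', (forall j, j != i -> tnth t j = tnth t' j) ->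
     `|g t - g t'| <= c) ->
  \int[sample n]_t expR (lam * g t) <=
  expR (lam * \int[sample n]_t g t + n%:R * (lam ^+ 2 * c ^+ 2 / 2)).
Proof.
elim: n g => [|n IH] g bg gc.
  have E (f : 0.-tuple T -> R) : bounded_mfun f -> \int[sample 0]_t f t = f [tuple].
    move=> [mf _]; rewrite /Rintegral integral_dirac// ?diracT ?mul1e//.
    exact/measurable_EFinP.
  by rewrite !E ?mul0r ?addr0//; apply: bounded_mfun_expR; exact: bounded_mfunZ.
have bgc := bounded_mfun_cons_pair bg.
have be : bounded_mfun (fun t => expR (lam * g t)).
  by apply: bounded_mfun_expR; exact: bounded_mfunZ.
have bec := bounded_mfun_cons_pair be.
rewrite !expectation_sampleS//.
pose G x := \int[sample n]_t g (cons_pair (x, t)).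
have bG : bounded_mfun G by exact: (bounded_mfun_integral D _ bgc).
have step x : \int[sample n]_t expR (lam * g (cons_pair (x, t))) <=
    expR (n%:R * (lam ^+ 2 * c ^+ 2 / 2)) * expR (lam * G x).
  rewrite -expRD addrC; apply: (IH (fun t => g (cons_pair (x, t)))).
    exact: bounded_mfun_sectionl bgc.
  move=> i t t' tt'; apply: (gc (lift ord0 i)) => j.
  case: (unliftP ord0 j) => [k ->|-> _]; last by rewrite !tnth0.
  by rewrite (inj_eq lift_inj) !tnthS; exact: tt'.
apply: (le_trans (le_expectation _ _ _ step)).
- exact: (bounded_mfun_integral D _ bec).
- by apply: bounded_mfunZ; apply: bounded_mfun_expR; exact: bounded_mfunZ.
rewrite expectationZ; last by apply: bounded_mfun_expR; exact: bounded_mfunZ.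
have Gc x y : `|G x - G y| <= c.
  rewrite -expectationB; [|exact: (bounded_mfun_sectionl _ bgc)..].
  apply: normr_expectation_le.
    by apply: bounded_mfunB; exact: (bounded_mfun_sectionl _ bgc).
  move=> t; apply: (gc ord0) => j.
  by case: (unliftP ord0 j) => [k ->|->]; rewrite ?eqxx// !tnthS.
apply: le_trans (ler_wpM2l (expR_ge0 _) (mgf_le_of_oscillation _ lam bG Gc)) _.
by rewrite -expRD ler_expR -/G -(natr1 n) le_eqVlt; apply/orP; left; apply/eqP; ring.
Qed.

End bounded_differences.

(** * Symmetrization by an independent copy *)

Section symmetrization.
Context {R : realType} {d : measure_display} {T : measurableType d}.
Variables (D : probability T R) (N : nat) (f : T -> 'rV[R]_N.+1).
Hypothesis bf : forall k, bounded_mfun (fun x => f x 0 k).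

Local Notation sample n := (prod_prob (fun _ : 'I_n => D)).

Let mu : 'rV[R]_N.+1 := \row_k \int[D]_x f x 0 k.

Lemma bounded_mfun_vmax d' (Z : measurableType d') (b : Z -> 'rV[R]_N.+1) :
  (forall k, bounded_mfun (fun z => b z 0 k)) -> bounded_mfun (fun z => vmax (b z)).
Proof.
move=> bb; rewrite /vmax; elim: (index_enum _) => [|k s IH].
  by under eq_fun do rewrite big_nil; exact: bb.
by under eq_fun do rewrite big_cons; apply: bounded_mfun_max.
Qed.

Lemma bounded_mfun_sign_avg d' (Z : measurableType d') n (tau : Z -> n.-tuple T)
    (b : Z -> 'rV[R]_N.+1) : measurable_fun setT tau ->
  (forall k, bounded_mfun (fun z => b z 0 k)) ->
  bounded_mfun (fun z => sign_avg (@vmax R N) [seq 2 *: f x | x <- tau z] (b z)).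
Proof.
elim: n tau b => [|n IH] tau b mtau bb.
  under eq_fun do rewrite tuple0/=; exact: bounded_mfun_vmax.
have mh : measurable_fun setT (fun z => thead (tau z)).
  by apply: (measurableT_comp (measurable_tnth ord0)).
have mt : measurable_fun setT (fun z => [tuple of behead (tau z)]).
  exact: (measurableT_comp (f := fun x : n.+1.-tuple T => [tuple of behead x])
    (@measurable_behead _ T n) mtau).
have bfh k : bounded_mfun (fun z => (2 *: f (thead (tau z))) 0 k).
  under eq_fun do rewrite mxE; apply: bounded_mfunZ.
  exact: (bounded_mfun_comp mh (bf k)).
rewrite (_ : (fun z => _) = fun z => 2^-1 *
  (sign_avg (@vmax R N) [seq 2 *: f x | x <- [tuple of behead (tau z)]]
     (b z + 2 *: f (thead (tau z))) +
   sign_avg (@vmax R N) [seq 2 *: f x | x <- [tuple of behead (tau z)]]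
     (b z - 2 *: f (thead (tau z))))); last first.
  by apply/funext => z; rewrite [in LHS](tuple_eta (tau z))/= mulrC.
apply: bounded_mfunZ; apply: bounded_mfunD; apply: IH => // k.
  by under eq_fun do rewrite mxE; apply: bounded_mfunD.
under eq_fun do rewrite mxE [X in _ + X]mxE.
exact: bounded_mfunB.
Qed.

(** The vector a + b - c is the midpoint of a + 2b and a - 2c; this is the origin of the doubled
    vectors. *)
Lemma vmax_sublinear (a b c : 'rV[R]_N.+1) :
  vmax (a + (b - c)) <= (vmax (a + 2 *: b) + vmax (a - 2 *: c)) / 2.
Proof.
apply: vmax_le => k; have := vmax_ge (a + 2 *: b) k.
have := vmax_ge (a - 2 *: c) k; rewrite !mxE; lra.
Qed.

(** By Jensen, [mu] may be replaced by [f y] for an independent copy y. The midpoint bound then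
    separates x from y, and the two halves together read as a random sign in front of 2 f. The signs
    in [s] are carried along unchanged. *)
Lemma sign_avg_symmetrization s (a : 'rV[R]_N.+1) :
  \int[D]_x sign_avg (@vmax R N) s (a + (mu - f x)) <=
  (\int[D]_x sign_avg (@vmax R N) s (a + 2 *: f x) +
   \int[D]_x sign_avg (@vmax R N) s (a - 2 *: f x)) / 2.
Proof.
have bv (b : T -> 'rV[R]_N.+1) s' : (forall k, bounded_mfun (fun z => b z 0 k)) ->
    bounded_mfun (fun x => sign_avg (@vmax R N) s' (b x)).
  elim: s' b => [|v s' IH] b bb /=; first exact: bounded_mfun_vmax.
  rewrite (_ : (fun x => _) = fun x => 2^-1 * (sign_avg (@vmax R N) s' (b x + v) +
      sign_avg (@vmax R N) s' (b x - v))); last by apply/funext => x; rewrite mulrC.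
  apply: bounded_mfunZ; apply: bounded_mfunD; apply: IH => k.
    under eq_fun do rewrite mxE; apply: bounded_mfunD => //.
    exact: bounded_mfun_cst.
  under eq_fun do rewrite mxE; apply: bounded_mfunD => //.
  exact: bounded_mfun_cst.
have b1 b k : bounded_mfun (fun x => (b + (mu - f x)) 0 k).
  under eq_fun do rewrite mxE [X in _ + X]mxE [X in _ + (_ + X)]mxE.
  apply: bounded_mfunD; first exact: bounded_mfun_cst.
  by apply: bounded_mfunB => //; exact: bounded_mfun_cst.
have b2 b k : bounded_mfun (fun x => (b + 2 *: f x) 0 k).
  under eq_fun do rewrite mxE [X in _ + X]mxE.
  apply: bounded_mfunD; first exact: bounded_mfun_cst.
  exact: bounded_mfunZ.
have b3 b k : bounded_mfun (fun x => (b - 2 *: f x) 0 k).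
  under eq_fun do rewrite mxE [X in _ + X]mxE [X in _ - X]mxE.
  apply: bounded_mfunB; first exact: bounded_mfun_cst.
  exact: bounded_mfunZ.
elim: s a => [|v s IH] a /=; last first.
  have E (b : T -> 'rV[R]_N.+1) : (forall c k, bounded_mfun (fun x => (c + b x) 0 k)) ->
      \int[D]_x ((sign_avg (@vmax R N) s (a + b x + v) +
                 sign_avg (@vmax R N) s (a + b x - v)) / 2) =
      (\int[D]_x sign_avg (@vmax R N) s (a + v + b x) +
       \int[D]_x sign_avg (@vmax R N) s (a - v + b x)) / 2.
    move=> bb.
    under eq_Rintegral do rewrite mulrC ![_ + b _ + _]addrAC.
    rewrite expectationZ ?expectationD ?(mulrC 2^-1)//; try exact: bv.
    by apply: bounded_mfunD; exact: bv.
  rewrite !E//; have := IH (a + v); have := IH (a - v); lra.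
have bx x : bounded_mfun (fun y => vmax (a + (f y - f x))).
  apply: bounded_mfun_vmax => k; under eq_fun do rewrite mxE [X in _ + X]mxE.
  apply: bounded_mfunD; first exact: bounded_mfun_cst.
  by apply: bounded_mfunD => //; exact: bounded_mfun_cst.
(* Here [mu] is exchanged for an independent copy, with x still fixed. *)
have J x : vmax (a + (mu - f x)) <=
    2^-1 * (\int[D]_y vmax (a + 2 *: f y) + vmax (a - 2 *: f x)).
  apply: (@le_trans _ _ (\int[D]_y vmax (a + (f y - f x)))).
    apply: vmax_le => k; rewrite !mxE.
    rewrite -(expectation_cst D (a 0 k)) -(expectation_cst D (f x 0 k)).
    rewrite -expectationB//; last exact: bounded_mfun_cst.
    rewrite -expectationD; [|exact: bounded_mfun_cst|]; last first.
      by apply: bounded_mfunB => //; exact: bounded_mfun_cst.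
    apply: le_expectation => //.
      apply: bounded_mfunD; first exact: bounded_mfun_cst.
      by apply: bounded_mfunB => //; exact: bounded_mfun_cst.
    by move=> y; apply: le_trans (vmax_ge _ k); rewrite !mxE.
  rewrite -(expectation_cst D (vmax (a - 2 *: f x))) -expectationD; last 2 first.
  - exact: bounded_mfun_vmax.
  - exact: bounded_mfun_cst.
  rewrite -expectationZ; last first.
    by apply: bounded_mfunD; [exact: bounded_mfun_vmax|exact: bounded_mfun_cst].
  apply: le_expectation => //.
    apply: bounded_mfunZ.
    by apply: bounded_mfunD; [exact: bounded_mfun_vmax|exact: bounded_mfun_cst].
  by move=> y; apply: le_trans (vmax_sublinear _ _ _) _; rewrite mulrC.
apply: (le_trans (le_expectation _ _ _ J)).
- exact: bounded_mfun_vmax.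
- apply: bounded_mfunZ.
  by apply: bounded_mfunD; [exact: bounded_mfun_cst|exact: bounded_mfun_vmax].
rewrite expectationZ; last first.
  by apply: bounded_mfunD; [exact: bounded_mfun_cst|exact: bounded_mfun_vmax].
rewrite expectationD; [|exact: bounded_mfun_cst|exact: bounded_mfun_vmax].
by rewrite expectation_cst mulrC.
Qed.

Lemma bounded_mfun_centered_sum n d' (Z : measurableType d')
    (tau : Z -> n.-tuple T) k : measurable_fun setT tau ->
  bounded_mfun (fun z => (\sum_(i < n) (mu - f (tnth (tau z) i))) 0 k).
Proof.
move=> mtau; under eq_fun do rewrite summxE.
apply: bounded_mfun_sum => i.
under eq_fun do rewrite mxE [X in _ + X]mxE.
apply: bounded_mfunB; first exact: bounded_mfun_cst.
exact: (bounded_mfun_comp (measurableT_comp (measurable_tnth i) mtau) (bf k)).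
Qed.

(** The offset [a] is arbitrary so that the centred term of the first point can be absorbed into it
    when the induction hypothesis is applied to the remaining points. *)
Lemma expectation_symmetrization n (a : 'rV[R]_N.+1) :
  \int[sample n]_t vmax (a + \sum_(i < n) (mu - f (tnth t i))) <=
  \int[sample n]_t sign_avg (@vmax R N) [seq 2 *: f x | x <- t] a.
Proof.
elim: n a => [|n IH] a.
  rewrite le_eqVlt; apply/orP; left; apply/eqP; apply: eq_Rintegral => t _.
  by rewrite big_ord0 addr0 tuple0.
have bD m d' (Z : measurableType d') (tau : Z -> m.-tuple T) (b : Z -> 'rV[R]_N.+1) :
    measurable_fun setT tau -> (forall k, bounded_mfun (fun z => b z 0 k)) ->
    bounded_mfun (fun z => vmax (b z + \sum_(i < m) (mu - f (tnth (tau z) i)))).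
  move=> mtau bb; apply: bounded_mfun_vmax => k; under eq_fun do rewrite mxE.
  by apply: bounded_mfunD => //; exact: bounded_mfun_centered_sum.
have bcst (b : 'rV[R]_N.+1) d' (Z : measurableType d') k :
  bounded_mfun (fun _ : Z => b 0 k) by exact: bounded_mfun_cst.
have bb k : bounded_mfun (fun x => (a + (mu - f x)) 0 k).
  under eq_fun do rewrite mxE [X in _ + X]mxE [X in _ + (_ + X)]mxE.
  apply: bounded_mfunD; first exact: bounded_mfun_cst.
  by apply: bounded_mfunB => //; exact: bounded_mfun_cst.
have b2 k : bounded_mfun (fun x => (a + 2 *: f x) 0 k).
  under eq_fun do rewrite mxE [X in _ + X]mxE.
  by apply: bounded_mfunD; [exact: bounded_mfun_cst|exact: bounded_mfunZ].
have b3 k : bounded_mfun (fun x => (a - 2 *: f x) 0 k).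
  under eq_fun do rewrite mxE [X in _ + X]mxE [X in _ - X]mxE.
  by apply: bounded_mfunB; [exact: bounded_mfun_cst|exact: bounded_mfunZ].
have m1 : measurable_fun setT (fst : T * n.-tuple T -> T) by exact: measurable_fst.
have m2 : measurable_fun setT (snd : T * n.-tuple T -> n.-tuple T).
  exact: measurable_snd.
have bc (g : T -> R) : bounded_mfun g -> bounded_mfun (fun p : T * n.-tuple T => g p.1).
  by move=> bg; exact: (bounded_mfun_comp m1 bg).
have mid : measurable_fun setT (idfun : n.+1.-tuple T -> n.+1.-tuple T).
  exact: measurable_id.
have bl := bD _ _ _ _ (fun=> a) mid (bcst a _ _).
have br := bounded_mfun_sign_avg (b := fun=> a) mid (bcst a _ _).
rewrite (expectation_sampleS D bl) (expectation_sampleS D br).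
pose SA (b : T -> 'rV[R]_N.+1) (p : T * n.-tuple T) :=
  sign_avg (@vmax R N) [seq 2 *: f x | x <- p.2] (b p.1).
have bSA (b : T -> 'rV[R]_N.+1) :
    (forall k, bounded_mfun (fun x => b x 0 k)) -> bounded_mfun (SA b).
  move=> bb'; apply: (bounded_mfun_sign_avg (b := fun p => b p.1) m2) => k.
  exact: bc (bb' k).
have bSAx (b : T -> 'rV[R]_N.+1) : (forall k, bounded_mfun (fun x => b x 0 k)) ->
    forall t, bounded_mfun (fun x => SA b (x, t)).
  by move=> bb' t; exact: bounded_mfun_sectionr (bSA _ bb').
have bSAt (b : T -> 'rV[R]_N.+1) : (forall k, bounded_mfun (fun x => b x 0 k)) ->
    forall x, bounded_mfun (fun t => SA b (x, t)).
  by move=> bb' x; exact: bounded_mfun_sectionl (bSA _ bb').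
apply: (@le_trans _ _ (\int[D]_x \int[sample n]_t SA (fun x => a + (mu - f x)) (x, t))).
  apply: le_expectation.
  - apply: (bounded_mfun_integral D (sample n)
      (f := fun p => vmax (a + \sum_(i < n.+1) (mu - f (tnth (cons_pair p) i))))).
    apply: (bD n.+1 _ _ (@cons_pair _ T n) (fun=> a)).
      exact: measurable_cons_pair.
    by move=> k; exact: bcst.
  - exact: (bounded_mfun_integral D (sample n) (bSA _ bb)).
  move=> x; apply: le_trans (IH (a + (mu - f x))).
  rewrite le_eqVlt; apply/orP; left; apply/eqP.
  apply: eq_Rintegral => t _; rewrite big_ord_recl tnth0 addrA.
  by congr (vmax (_ + _)); apply: eq_bigr => i _; rewrite tnthS.
(* The first point becomes the inner variable, so that the one-point symmetrization applies for each
   fixed rest of the sample; the order is restored afterwards. *)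
rewrite (expectation_swap _ _ (bSA _ bb)).
have bE (b : T -> 'rV[R]_N.+1) : (forall k, bounded_mfun (fun x => b x 0 k)) ->
    bounded_mfun (fun t => \int[D]_x SA b (x, t)).
  move=> bb'; apply: (bounded_mfun_integral (sample n) D (f := fun p => SA b (p.2, p.1))).
  by apply: (bounded_mfun_comp _ (bSA _ bb')); exact: measurable_swap.
apply: (@le_trans _ _ (\int[sample n]_t (2^-1 *
    (\int[D]_x SA (fun x => a + 2 *: f x) (x, t) +
     \int[D]_x SA (fun x => a - 2 *: f x) (x, t))))).
  apply: le_expectation.
  - exact: bE.
  - by apply: bounded_mfunZ; apply: bounded_mfunD; exact: bE.
  by move=> t; rewrite mulrC; exact: sign_avg_symmetrization.
rewrite expectationZ; last by apply: bounded_mfunD; exact: bE.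
rewrite expectationD; [|exact: bE..].
rewrite -(expectation_swap D (sample n) (bSA _ b2)).
rewrite -(expectation_swap D (sample n) (bSA _ b3)).
have bI (b : T -> 'rV[R]_N.+1) : (forall k, bounded_mfun (fun x => b x 0 k)) ->
    bounded_mfun (fun x => \int[sample n]_t SA b (x, t)).
  by move=> bb'; exact: (bounded_mfun_integral D _ (bSA _ bb')).
rewrite -expectationD; [|exact: bI..].
rewrite -expectationZ; last by apply: bounded_mfunD; exact: bI.
rewrite le_eqVlt; apply/orP; left; apply/eqP; apply: eq_Rintegral => x _.
rewrite -expectationD; [|exact: bSAt..].
rewrite -expectationZ; last by apply: bounded_mfunD; exact: bSAt.
by apply: eq_Rintegral => t _; rewrite mulrC.
Qed.

End symmetrization.

(** * Deviation bound for a finite class *)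

Section uniform_deviation.
Context {R : realType} {d : measure_display} {T : measurableType d}.
Variable D : probability T R.

Local Notation sample n := (prod_prob (fun _ : 'I_n => D)).

Lemma vmax_lipschitz N (a b : 'rV[R]_N.+1) e :
  (forall k, `|a 0 k - b 0 k| <= e) -> `|vmax a - vmax b| <= e.
Proof.
move=> ab; rewrite ler_distl; apply/andP; split.
  rewrite lerBlDr; apply: vmax_le => k; have := ab k.
  by rewrite distrC => /ler_distlDr/le_trans; apply; rewrite lerD2r vmax_ge.
apply: vmax_le => k; have := ab k.
by move=> /ler_distlDr/le_trans; apply; rewrite lerD2r vmax_ge.
Qed.

(** Later [dist] is a multiple of the discrete metric, so that the sum only sees points where the
    samples differ. The term [e] collects the difference of the offsets during the induction. *)
Lemma sign_avg_lipschitz N (f : T -> 'rV[R]_N.+1) (dist : T -> T -> R) n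
    (t t' : n.-tuple T) (a a' : 'rV[R]_N.+1) e :
  (forall k, `|a 0 k - a' 0 k| <= e) ->
  (forall x y k, `|f x 0 k - f y 0 k| <= dist x y) ->
  `|sign_avg (@vmax R N) (map f t) a - sign_avg (@vmax R N) (map f t') a'| <=
  e + \sum_(i < n) dist (tnth t i) (tnth t' i).
Proof.
move=> + fd; elim: n t t' a a' e => [|n IH] t t' a a' e aa'.
  by rewrite (tuple0 t) (tuple0 t') big_ord0 addr0; exact: vmax_lipschitz.
rewrite (tuple_eta t) (tuple_eta t') big_ord_recl /=.
set s := [tuple of behead t]; set s' := [tuple of behead t'].
set x := thead t; set y := thead t'.
have -> : \sum_(i < n) dist (tnth [tuple of x :: s] (lift ord0 i))
    (tnth [tuple of y :: s'] (lift ord0 i)) =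
    \sum_(i < n) dist (tnth s i) (tnth s' i).
  by apply: eq_bigr => i _; rewrite !tnthS.
rewrite addrA.
have h1 : `|sign_avg (@vmax R N) (map f s) (a + f x) -
            sign_avg (@vmax R N) (map f s') (a' + f y)| <=
          e + dist x y + \sum_(i < n) dist (tnth s i) (tnth s' i).
  apply: IH => k; rewrite !mxE opprD addrACA.
  by apply: le_trans (ler_normD _ _) _; rewrite lerD.
have h2 : `|sign_avg (@vmax R N) (map f s) (a - f x) -
            sign_avg (@vmax R N) (map f s') (a' - f y)| <=
          e + dist x y + \sum_(i < n) dist (tnth s i) (tnth s' i).
  apply: IH => k; rewrite !mxE.
  have -> (p q p' q' : R) : p - q - (p' - q') = (p - p') + (q' - q) by ring.
  by apply: le_trans (ler_normD _ _) _; rewrite lerD// distrC.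
rewrite -mulrBl normrM [`|_^-1|]ger0_norm// ler_pdivrMr// mulr_natr mulr2n.
rewrite opprD addrACA.
by apply: le_trans (ler_normD _ _) _; rewrite lerD.
Qed.

Lemma centered_sum_lipschitz N (f : T -> 'rV[R]_N.+1) (dist : T -> T -> R) n
    (t t' : n.-tuple T) (mu : 'rV[R]_N.+1) :
  (forall x y k, `|f x 0 k - f y 0 k| <= dist x y) ->
  `|vmax (\sum_(i < n) (mu - f (tnth t i))) -
    vmax (\sum_(i < n) (mu - f (tnth t' i)))| <=
  \sum_(i < n) dist (tnth t i) (tnth t' i).
Proof.
move=> fd; apply: vmax_lipschitz => k; rewrite !summxE -sumrB.
apply: le_trans (ler_norm_sum _ _ _) _; apply: ler_sum => i _.
rewrite !mxE; have -> (p q q' : R) : p - q - (p - q') = q' - q by ring.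
by rewrite distrC.
Qed.

Lemma markov_expR n (g : n.-tuple T -> R) lam tau : bounded_mfun g -> 0 <= lam ->
  (sample n [set t | (tau < g t)%R] <=
   (expR (- lam * tau) * \int[sample n]_t expR (lam * g t))%:E)%E.
Proof.
move=> bg lam0; set A := [set t | _].
have mA : measurable A.
  rewrite (_ : A = setT `&` g @^-1` `]tau, +oo[).
    by apply: bg.1 => //; exact: measurable_itv.
  by rewrite setTI; apply/seteqP; split => t; rewrite /A/= in_itv/= andbT.
have be : bounded_mfun (fun t => expR (lam * g t)).
  by apply: bounded_mfun_expR; exact: bounded_mfunZ.
rewrite -expectationZ// EFin_Rintegral; last exact: bounded_mfunZ.
rewrite -(setIT A) -integral_indic//; apply: ge0_le_integral => //.
- by apply/measurable_EFinP; exact: measurable_indic.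
- by apply/measurable_EFinP; exact: (bounded_mfunZ _ be).1.
move=> t _; rewrite lee_fin indicE; case: (boolP (t \in A)) => [|_].
  rewrite inE /A/= => gt; rewrite -expRD -[leLHS]expR0 ler_expR.
  by rewrite mulNr addrC -mulrBr mulr_ge0// subr_ge0 ltW.
by rewrite mulr_ge0// expR_ge0.
Qed.

(** Concentration is applied once, to [Phi], the deviation minus the empirical Rademacher average.
    Its mean is nonpositive by symmetrization, so the bound comes out directly with the empirical
    average. *)
Lemma rademacher_deviation N (f : T -> 'rV[R]_N.+1) n M delta : (0 < n)%N ->
  0 < M -> 0 < delta < 1 -> (forall k, measurable_fun setT (fun x => f x 0 k)) ->
  (forall x k, `|f x 0 k| <= M) ->
  exists E, [/\ measurable E, ((1 - delta)%:E <= sample n E)%E &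
    forall t, E t -> forall k,
      n%:R * \int[D]_x f x 0 k - \sum_(i < n) f (tnth t i) 0 k <=
      sign_avg (@vmax R N) [seq 2 *: f x | x <- t] 0 +
      8 * M * Num.sqrt (2 * n%:R * ln (4 / delta))].
Proof.
move=> n0 M0 /andP[delta0 delta1] mf fM.
have bf k : bounded_mfun (fun x => f x 0 k) by split => //; exists M => x.
pose mu : 'rV[R]_N.+1 := \row_k \int[D]_x f x 0 k.
pose dev (t : n.-tuple T) := vmax (0 + \sum_(i < n) (mu - f (tnth t i))).
pose rad (t : n.-tuple T) := sign_avg (@vmax R N) [seq 2 *: f x | x <- t] 0.
pose Phi t := dev t - rad t.
have bcst k : bounded_mfun (fun _ : n.-tuple T => (0 : 'rV[R]_N.+1) 0 k).
  exact: bounded_mfun_cst.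
have mid : measurable_fun setT (idfun : n.-tuple T -> n.-tuple T).
  exact: measurable_id.
have bdev : bounded_mfun dev.
  apply: bounded_mfun_vmax => k; under eq_fun do rewrite mxE.
  apply: bounded_mfunD => //.
  exact: (bounded_mfun_centered_sum D bf (tau := idfun)).
have brad : bounded_mfun rad.
  exact: (bounded_mfun_sign_avg bf (b := fun=> 0) mid bcst).
have bPhi : bounded_mfun Phi by exact: bounded_mfunB.
have EPhi : \int[sample n]_t Phi t <= 0.
  by rewrite expectationB// subr_le0; exact: expectation_symmetrization.
pose dist c (x y : T) : R := if `[< x = y >] then 0 else c.
have dist_sum c i (t t' : n.-tuple T) : 0 <= c ->
    (forall j, j != i -> tnth t j = tnth t' j) ->
    \sum_(j < n) dist c (tnth t j) (tnth t' j) <= c.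
  move=> c0 tt'; rewrite (bigD1 i)//= big1 ?addr0; last first.
    by move=> j /tt' ->; rewrite /dist asboolT.
  by rewrite /dist; case: ifP.
have fdist x y k : `|f x 0 k - f y 0 k| <= dist (2 * M) x y.
  rewrite /dist; case: asboolP => [->|_]; first by rewrite subrr normr0.
  apply: le_trans (ler_normB _ _) _.
  by rewrite mulr_natl mulr2n lerD.
have fdist2 x y k : `|(2 *: f x) 0 k - (2 *: f y) 0 k| <= dist (4 * M) x y.
  rewrite !mxE -mulrBr normrM ger0_norm//.
  apply: le_trans (ler_wpM2l (ler0n _ 2) (fdist x y k)) _.
  by rewrite /dist; case: ifP => _; [rewrite mulr0|rewrite mulrA -natrM].
(* One changed point moves the deviation by at most 2M and the average over doubled vectors by at
   most 4M. *)
have Phid i t t' : (forall j, j != i -> tnth t j = tnth t' j) ->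
    `|Phi t - Phi t'| <= 6 * M.
  move=> tt'; rewrite /Phi.
  have -> (p q p' q' : R) : p - q - (p' - q') = (p - p') + (q' - q) by ring.
  apply: (le_trans (ler_normD _ _)).
  rewrite (_ : 6 * M = 2 * M + 4 * M); last by ring.
  apply: lerD.
    rewrite /dev !add0r.
    apply: le_trans (centered_sum_lipschitz (dist := dist (2 * M)) t t' mu fdist) _.
    by apply: (dist_sum _ i) => //; rewrite mulr_ge0// ltW.
  rewrite distrC -[leRHS]add0r.
  apply: le_trans (sign_avg_lipschitz (dist := dist (4 * M)) (e := 0) _ _ _ fdist2) _.
    by move=> k; rewrite subrr normr0.
  by rewrite lerD2l; apply: (dist_sum _ i) => //; rewrite mulr_ge0// ltW.
set Lg := ln (4 / delta).
have L0 : 0 < Lg by rewrite ln_gt0// ltr_pdivlMr// mul1r (lt_trans delta1)// ltr1n.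
set tau := 8 * M * Num.sqrt (2 * n%:R * Lg).
have nR : 0 < n%:R :> R by rewrite ltr0n.
have tau2 : tau ^+ 2 = 128 * M ^+ 2 * n%:R * Lg.
  rewrite exprMn sqr_sqrtr; first by ring.
  by rewrite !mulr_ge0// ltW.
have tau0 : 0 < tau by rewrite !mulr_gt0// sqrtr_gt0 !mulr_gt0.
have mE : measurable [set t | Phi t <= tau].
  rewrite (_ : [set _ | _] = setT `&` Phi @^-1` `]-oo, tau]).
    by apply: bPhi.1 => //; exact: measurable_itv.
  by rewrite setTI; apply/seteqP; split => t; rewrite /= in_itv.
exists [set t | Phi t <= tau]; split=> //; last first.
  move=> t /= Pt k; rewrite -/tau -/(rad t).
  rewrite /Phi lerBlDl in Pt; apply: le_trans Pt; rewrite /dev add0r.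
  apply: le_trans (vmax_ge _ k); rewrite summxE.
  rewrite [leRHS](eq_bigr (fun i => mu 0 k - f (tnth t i) 0 k)); last first.
    by move=> i _; rewrite mxE [X in _ + X]mxE.
  by rewrite sumrB sumr_const card_ord mxE mulr_natl.
(* This minimizes the exponent - lam tau + 18 n M^2 lam^2; the minimum is - tau^2 / (72 M^2 n) = -
   (128/72) ln(4/delta). *)
pose lam := tau / (36 * M ^+ 2 * n%:R).
have lam0 : 0 <= lam by rewrite divr_ge0 ?mulr_ge0 ?exprn_ge0// ltW.
have := markov_expR tau bPhi lam0; set A := [set t | _] => PA.
have mA : measurable A.
  rewrite (_ : A = ~` [set t | Phi t <= tau]); first exact: measurableC.
  by apply/seteqP; split => t; rewrite /A/= ltNge => /negP.
have -> : [set t | Phi t <= tau] = ~` A.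
  by apply/seteqP; split => t; rewrite /A/= ltNge => h;
    [apply/negP; rewrite negbK|apply/negPn/negP].
have -> : sample n (~` A) = (1 - sample n A)%E by exact: probability_setC.
rewrite EFinB leeB//; apply: (le_trans PA); rewrite lee_fin.
apply: le_trans (ler_wpM2l (expR_ge0 _) (mcdiarmid_mgf D lam bPhi Phid)) _.
(* The intermediate value is delta / 4. *)
rewrite -expRD; apply: (@le_trans _ _ (expR (- Lg))); last first.
  rewrite expRN lnK ?posrE ?divr_gt0// invf_div ler_pdivrMr// ler_peMr ?ltW//.
  by lra.
rewrite ler_expR.
have lE : lam * \int[sample n]_t Phi t <= 0 by rewrite mulr_ge0_le0.
have -> : n%:R * (lam ^+ 2 * (6 * M) ^+ 2 / 2) = tau ^+ 2 / (72 * M ^+ 2 * n%:R).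
  by rewrite /lam; field; rewrite !gt_eqF.
have -> : - lam * tau = - (tau ^+ 2 / (36 * M ^+ 2 * n%:R)).
  by rewrite /lam; field; rewrite !gt_eqF.
have -> : tau ^+ 2 / (36 * M ^+ 2 * n%:R) = 128 / 36 * Lg.
  by rewrite tau2; field; rewrite !gt_eqF.
have -> : tau ^+ 2 / (72 * M ^+ 2 * n%:R) = 128 / 72 * Lg.
  by rewrite tau2; field; rewrite !gt_eqF.
lra.
Qed.

End uniform_deviation.

(** * Measurability of functions continuous in one variable *)

Section caratheodory.
Context {R : realType}.

Lemma cvg_mx (T : Type) (F : set_system T) (FF : Filter F) m n
    (f : T -> 'M[R]_(m, n)) (l : 'M[R]_(m, n)) :
  (forall i j, (fun x => f x i j) @ F --> l i j) -> f @ F --> l.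
Proof.
move=> fl; apply/cvg_ballP => e e0.
have : \forall x \near F, forall i j, ball (l i j) e (f x i j).
  apply: filter_forall => i; apply: filter_forall => j.
  by have /cvg_ballP := fl i j; apply.
by apply: filterS.
Qed.

Lemma continuous_mx (T : topologicalType) m n (f : T -> 'M[R]_(m, n)) :
  (forall i j, continuous (fun x => f x i j)) -> continuous f.
Proof. by move=> fc x; apply: cvg_mx => i j; exact: fc. Qed.

(** The lattice of mesh 1/(k+1), indexed by integer vectors because these are countable. It serves
    both for measurability and for a dense sequence in the ball. *)
Definition grid m (k : nat) (c : 'rV[int]_m) : 'rV[R]_m :=
  \row_i ((c 0 i)%:~R / k.+1%:R).

Definition to_grid m (k : nat) (v : 'rV[R]_m) : 'rV[int]_m :=
  \row_i Num.floor (v 0 i * k.+1%:R).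

Lemma grid_to_grid_cvg m (v : 'rV[R]_m) :
  (fun k => grid k (to_grid k v)) @ \oo --> v.
Proof.
apply: cvg_mx => i j; rewrite ord1 {i}.
apply/cvgrPdist_le => e e0.
near=> k; rewrite !mxE.
set x := v 0 j; have k0 : (0 : R) < k.+1%:R by rewrite ltr0n.
have ke : k.+1%:R^-1 < e by near: k; exact: (near_infty_natSinv_lt (PosNum e0)).
apply: le_trans (ltW ke).
have /andP[h1 h2] := floor_itv (x * k.+1%:R).
rewrite intrD1 in h2.
have -> : x - (Num.floor (x * k.+1%:R))%:~R / k.+1%:R =
    (x * k.+1%:R - (Num.floor (x * k.+1%:R))%:~R) / k.+1%:R.
  by rewrite mulrBl mulfK// gt_eqF.
rewrite normrM [`|_^-1|]gtr0_norm ?invr_gt0// -[leRHS]mul1r ler_pM2r ?invr_gt0//.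
by rewrite ger0_norm ?subr_ge0// lerBlDl ltW.
Unshelve. all: by end_near. Qed.

Lemma measurable_to_grid m k (c : 'rV[int]_m) :
  measurable [set t : m.-tuple (measurableTypeR R) | to_grid k (rv t) = c].
Proof.
rewrite (_ : [set _ | _] = \bigcap_(i in [set: 'I_m]) (setT `&` (fun t => tnth t i) @^-1`
    `[(c 0 i)%:~R / k.+1%:R : R, (c 0 i + 1)%:~R / k.+1%:R[)).
  apply: fin_bigcap_measurable => // i _.
  by apply: measurable_tnth => //; exact: measurable_itv.
have k0 : (0 : R) < k.+1%:R by rewrite ltr0n.
apply/seteqP; split => t /= tc.
  move=> i _; split => //=; rewrite -tc in_itv/= !mxE ler_pdivrMr// ltr_pdivlMr//.
  exact: floor_itv.
apply/rowP => i; rewrite !mxE; apply/eqP; rewrite floor_eq.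
by have [_ /=] := tc i I; rewrite in_itv/= ler_pdivrMr// ltr_pdivlMr.
Qed.

(** Rounding the vector argument down to the grid gives functions whose preimages are countable
    unions of measurable rectangles; by continuity they converge pointwise as the mesh shrinks. *)
Lemma measurable_caratheodory m d (Z : measurableType d) (phi : 'rV[R]_m -> Z -> R) :
  (forall z, continuous (phi ^~ z)) -> (forall u, measurable_fun setT (phi u)) ->
  measurable_fun setT (fun p : m.-tuple (measurableTypeR R) * Z => phi (rv p.1) p.2).
Proof.
move=> phic phim.
apply: (measurable_fun_cvg (h := fun k p => phi (grid k (to_grid k (rv p.1))) p.2)).
  move=> k _ Y mY; rewrite setTI.
  rewrite (_ : _ @^-1` _ = \bigcup_(c : 'rV[int]_m)
      ([set t | to_grid k (rv t) = c] `*` (setT `&` phi (grid k c) @^-1` Y))).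
    apply: countable_bigcupT_measurable => [|c]; first exact: countableP.
    by apply: measurableX; [exact: measurable_to_grid|exact: phim].
  apply/seteqP; split => [p /= pY|p [c _ [/= <- [_ //]]]].
  by exists (to_grid k (rv p.1)).
move=> p _; have gp := @grid_to_grid_cvg m (rv p.1).
exact: (cvg_comp _ (phi ^~ p.2) gp (phic p.2 (rv p.1))).
Qed.

(** Links the topology of row vectors to the product sigma-algebra of tuples; it is the previous
    lemma with a dummy second variable. *)
Lemma measurable_continuous_rv m (phi : 'rV[R]_m -> R) : continuous phi ->
  measurable_fun setT (fun t : m.-tuple (measurableTypeR R) => phi (rv t)).
Proof.
move=> phic.
have mphi : measurable_fun setT
    (fun p : m.-tuple (measurableTypeR R) * measurableTypeR R => phi (rv p.1)).
  by apply: (measurable_caratheodory (phi := fun u _ => phi u)).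
have mp : measurable_fun setT
    (fun t : m.-tuple (measurableTypeR R) => (t, 0 : measurableTypeR R)).
  by apply: measurable_fun_pair.
exact: (measurableT_comp mphi mp).
Qed.

End caratheodory.

(** * Affine images of the normal distribution *)

Section normal_distribution.
Context {R : realType}.
Local Notation mu := (@lebesgue_measure R).

(** The closed right rays are stable under intersection, generate the Borel sets and exhaust the
    line. *)
Lemma eq_probability_rays (P Q : probability (measurableTypeR R) R) :
  (forall x : R, P `[x, +oo[%classic = Q `[x, +oo[%classic) -> forall A, measurable A -> P A = Q A.
Proof.
move=> PQ A mA.
refine (@measure_unique _ R (measurableTypeR R) (@RGenCInfty.G R)
  (fun k => `[- k%:R, +oo[%classic) _ _ _ _ P Q _ _ A mA).
- exact: RGenCInfty.measurableE.
- move=> _ _ [x ->] [y ->]; exists (Num.max x y).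
  apply/seteqP; split => z /=; rewrite !in_itv/= !andbT ge_max.
    by move=> [-> ->].
  by move=> /andP[].
- by move=> k; exists (- k%:R).
- apply/seteqP; split => // x _; exists (Num.truncn `|x|).+1 => //=.
  rewrite in_itv/= andbT lerNl; apply: le_trans (ltW (truncnS_gt _)).
  by rewrite -normrN ler_norm.
- by move=> _ [x ->]; exact: PQ.
- by move=> k; rewrite (le_lt_trans (probability_le1 _ _))// ?ltry.
Qed.

Lemma normal_pdf_affine (a s y : R) : 0 < s ->
  normal_pdf a s (a + s * y) * s = normal_pdf 0 1 y.
Proof.
move=> s0; rewrite !normal_pdfE ?gt_eqF// /normal_fun /normal_peak subr0.
rewrite expr1n mul1r -mulrnAr sqrtrM ?sqr_ge0// sqrtr_sqr gtr0_norm//.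
rewrite invfM mulrAC -[X in X * _]mulrAC mulVf ?gt_eqF// mul1r; congr (_ * expR _).
have -> : a + s * y - a = s * y by ring.
by rewrite -(mulr_natr (s ^+ 2)); field; rewrite gt_eqF.
Qed.

(** The substitution y -> a + s y on a half-line; rays are enough to identify the two laws. *)
Lemma normal_prob_ray (a s x : R) : 0 < s ->
  normal_prob a s `[a + s * x, +oo[ = normal_prob 0 1 `[x, +oo[.
Proof.
move=> s0; rewrite /normal_prob.
pose F y : R := a + s * y.
have F' : F^`()%classic = cst s.
  apply/funext => y; rewrite derive1E /F.
  by rewrite deriveD// derive_cst add0r deriveMl// derive_id mulr1.
have dF y : derivable F y 1 by apply: derivableD => //; exact: derivableM.
rewrite -/(F x) (@increasing_ge0_integration_by_substitutiony _ F (normal_pdf a s)).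
- apply: eq_integral => y _; congr EFin.
  by rewrite -(normal_pdf_affine a y s0) F'.
- by move=> y z _ _ yz; rewrite ltrD2l ltr_pM2l.
- by rewrite F' => y _; exact: cst_continuous.
- by rewrite F'; exact: is_cvg_cst.
- by rewrite F'; exact: is_cvg_cst.
- split => //.
  apply: cvg_at_right_filter; apply: differentiable_continuous.
  exact/derivable1_diffP.
- apply/cvgryPge => A; exists ((A - a) / s); split; first exact: num_real.
  by move=> y Ay; rewrite /F -lerBlDl mulrC -ler_pdivrMr// ltW.
- apply: continuous_subspaceT => y; apply: continuous_normal_pdf.
  by rewrite gt_eqF.
- by move=> y _; exact: normal_pdf_ge0.
Qed.

Lemma normal_prob_affine (a s : R) (A : set (measurableTypeR R)) : 0 < s ->
  measurable A -> normal_prob a s A = normal_prob 0 1 ((fun x => a + s * x) @^-1` A).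
Proof.
move=> s0 mA.
have mf : measurable_fun setT (fun x : measurableTypeR R => a + s * x : measurableTypeR R).
  by apply: measurable_funD => //; exact: measurable_funM.
pose f : {mfun measurableTypeR R >-> measurableTypeR R} :=
  HB.pack (fun x : measurableTypeR R => a + s * x : measurableTypeR R)
    (isMeasurableFun.Build _ _ _ _ _ mf).
pose P : probability (measurableTypeR R) R := normal_prob a s.
pose P01 : probability (measurableTypeR R) R := normal_prob 0 1.
pose nu : probability (measurableTypeR R) R := distribution P01 f.
have nuE (B : set (measurableTypeR R)) :
  nu B = normal_prob 0 1 ((fun x => a + s * x) @^-1` B) by [].
rewrite -nuE -/(P A).
refine (@eq_probability_rays P nu _ A mA) => x.
rewrite -[RHS]/(normal_prob 0 1 ((fun y => a + s * y) @^-1` `[x, +oo[)).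
rewrite -[LHS]/(normal_prob a s `[x, +oo[) (_ : x = a + s * ((x - a) / s)); last first.
  by rewrite mulrC divfK ?gt_eqF// addrC subrK.
rewrite normal_prob_ray//; congr normal_prob; apply/seteqP; split => y /=.
  by rewrite !in_itv/= !andbT lerD2l ler_pM2l.
by rewrite !in_itv/= !andbT lerD2l ler_pM2l.
Qed.

End normal_distribution.

(** * Mean of the standard normal distribution *)

Section normal_mean.
Context {R : realType}.
Local Notation mu := (@lebesgue_measure R).

Lemma normal_prob_opp (A : set (measurableTypeR R)) : measurable A ->
  normal_prob 0 1 (-%R @^-1` A) = normal_prob 0 1 A :> \bar R.
Proof.
move=> mA.
have mf : measurable_fun setT (fun x : measurableTypeR R => - x : measurableTypeR R).
  exact: oppr_measurable.
pose f : {mfun measurableTypeR R >-> measurableTypeR R} :=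
  HB.pack (fun x : measurableTypeR R => - x : measurableTypeR R)
    (isMeasurableFun.Build _ _ _ _ _ mf).
pose P01 : probability (measurableTypeR R) R := normal_prob 0 1.
pose nu : probability (measurableTypeR R) R := distribution P01 f.
refine (@eq_probability_rays _ nu P01 _ A mA) => x.
rewrite -[LHS]/(normal_prob 0 1 (-%R @^-1` `[x, +oo[)).
rewrite -[RHS]/(normal_prob 0 1 `[x, +oo[) opp_preimage_itvbndy /normal_prob.
rewrite ge0_integration_by_substitutionNy.
- apply: eq_integral => y _ /=; congr EFin.
  by rewrite !normal_pdfE ?oner_eq0// /normal_fun !subr0 sqrrN.
- apply: continuous_subspaceT => y; apply: continuous_normal_pdf.
  exact: oner_neq0.
- by move=> y _; exact: normal_pdf_ge0.
Qed.

Lemma ge0_integral_normal_prob (a s : R) (f : R -> \bar R) :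
  measurable_fun setT f -> (forall x, 0 <= f x)%E ->
  (\int[normal_prob a s]_x f x = \int[mu]_x (f x * (normal_pdf a s x)%:E))%E.
Proof.
move=> mf f0.
have numu := @normal_prob_dominates R a s.
rewrite -(Radon_Nikodym_SigmaFinite.change_of_variables numu)//.
apply: ae_eq_integral => //.
- apply: emeasurable_funM => //; apply: (measurable_int mu).
  exact: Radon_Nikodym_SigmaFinite.f_integrable.
- apply: emeasurable_funM => //; apply/measurable_EFinP.
  exact: measurable_normal_pdf.
- apply: ae_eqe_mul2l; apply: integral_ae_eq => //=.
  + exact: Radon_Nikodym_SigmaFinite.f_integrable.
  + by apply/measurable_EFinP; exact: measurable_normal_pdf.
  + by move=> E _ mE; rewrite -Radon_Nikodym_SigmaFinite.f_integral.
Qed.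

(** Since |x| <= 1 + 3x^2/8 <= exp(3x^2/8) and 1/2 - 3/8 = 1/8, the density times |x| is at most a
    multiple of the density with standard deviation 2. *)
Lemma integrable_normal_prob_id :
  (normal_prob (0 : R) 1).-integrable setT (EFin : measurableTypeR R -> \bar R).
Proof.
apply/integrableP; split; first exact/measurable_EFinP.
rewrite ge0_integral_normal_prob//; last first.
  by apply: measurableT_comp => //; exact/measurable_EFinP.
pose c : R := normal_peak 1 / normal_peak 2.
apply: (@le_lt_trans _ _ (\int[mu]_x (c * normal_pdf 0 2 x)%:E)%E).
  apply: ge0_le_integral => //=.
  - by move=> x _; rewrite mule_ge0// lee_fin normal_pdf_ge0.
  - apply: emeasurable_funM; last first.
      by apply/measurable_EFinP; exact: measurable_normal_pdf.
    by apply: measurableT_comp => //; exact/measurable_EFinP.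
  - apply/measurable_EFinP; apply: measurable_funM => //.
    exact: measurable_normal_pdf.
  - move=> x _; rewrite -EFinM lee_fin !normal_pdfE ?oner_eq0//.
    have -> : c * (normal_peak 2 * normal_fun 0 2 x) = normal_peak 1 * normal_fun 0 2 x.
      by rewrite /c mulrA divfK// gt_eqF// normal_peak_gt0.
    rewrite mulrCA ler_wpM2l ?normal_peak_ge0// /normal_fun !subr0.
    have -> : - x ^+ 2 / (2 ^+ 2 *+ 2) = 3 / 8 * x ^+ 2 + - x ^+ 2 / (1 ^+ 2 *+ 2).
      by rewrite -!(mulr_natr (_ ^+ 2) 2); field.
    rewrite expRD ler_pM2r ?expR_gt0//; apply: le_trans (expR_ge1Dx _).
    rewrite -(real_normK (num_real x)) -subr_ge0.
    rewrite (_ : _ - _ = 3 / 8 * (`|x| - 4 / 3) ^+ 2 + 1 / 3); last by field.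
    by rewrite addr_ge0// mulr_ge0// sqr_ge0.
under eq_integral do rewrite EFinM.
rewrite integralZl//; last exact: integrable_normal_pdf.
by rewrite integral_normal_pdf mule1 ltry.
Qed.

(** The law is invariant under x -> -x, so the finite mean equals its own opposite. *)
Lemma std_normal_mean : \int[normal_prob (0 : R) 1]_x x = 0.
Proof.
have mf : measurable_fun setT (fun x : measurableTypeR R => - x : measurableTypeR R).
  exact: oppr_measurable.
pose f : {mfun measurableTypeR R >-> measurableTypeR R} :=
  HB.pack (fun x : measurableTypeR R => - x : measurableTypeR R)
    (isMeasurableFun.Build _ _ _ _ _ mf).
pose P01 : probability (measurableTypeR R) R := normal_prob 0 1.
have iN : P01.-integrable setT ((EFin : measurableTypeR R -> \bar R) \o f).
  have := integrableN integrable_normal_prob_id.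
  by apply: eq_integrable => // x _ /=; rewrite EFinN.
have eqN : (\int[P01]_x x%:E = \int[P01]_x (- x)%:E)%E.
  transitivity (\int[distribution P01 f]_x x%:E)%E.
    by apply: eq_measure_integral => A mA _; rewrite -[LHS]normal_prob_opp.
  rewrite (@integral_distribution _ _ _ _ _ P01 f EFin)//.
have fin := integrable_fin_num measurableT integrable_normal_prob_id.
have : \int[P01]_x x = - \int[P01]_x x.
  rewrite {1}/Rintegral eqN; under eq_integral do rewrite EFinN.
  rewrite integralN/= ?fineN//; exact: integrable_add_def integrable_normal_prob_id.
rewrite -/P01; lra.
Qed.

End normal_mean.

(** Equality of laws is expressed by bounded test functions, so that it can be used under the
    iterated expectation; the inner expectation is again such a function of the first coordinate. *)
Lemma expectation_prod_prob_map {R : realType} d (T : measurableType d) n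
    (P Q : 'I_n -> probability T R) (phi : 'I_n -> T -> T) (g : n.-tuple T -> R) :
  (forall i, measurable_fun setT (phi i)) ->
  (forall i (f : T -> R), bounded_mfun f ->
     \int[P i]_x f x = \int[Q i]_x f (phi i x)) ->
  bounded_mfun g ->
  \int[prod_prob P]_t g t =
  \int[prod_prob Q]_t g [tuple phi i (tnth t i) | i < n].
Proof.
move=> mphi PQ bg; have mtup m (ps : 'I_m -> T -> T) : (forall i, measurable_fun setT (ps i)) ->
    measurable_fun setT (fun t : m.-tuple T => [tuple ps i (tnth t i) | i < m]).
  move=> mps; apply/measurable_fun_tnthP => i /=.
  under [X in measurable_fun _ X]funext do rewrite /= tnth_mktuple.
  exact: measurableT_comp (mps i) (measurable_tnth i).
elim: n P Q phi g mphi PQ bg => [|n IH] P Q phi g mphi PQ bg.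
  by apply: eq_Rintegral => t _; congr g; rewrite [RHS]tuple0 [LHS]tuple0.
have bgm : bounded_mfun (fun t : n.+1.-tuple T => g [tuple phi i (tnth t i) | i < n.+1]).
  exact: bounded_mfun_comp (mtup _ _ mphi) bg.
have bgc : bounded_mfun (g \o @cons_pair _ T n).
  by apply: bounded_mfun_comp bg; exact: measurable_cons_pair.
rewrite (expectation_prod_probS P bg) (expectation_prod_probS Q bgm).
have bI : bounded_mfun (fun x =>
    \int[prod_prob (fun i => P (lift ord0 i))]_t g (cons_pair (x, t))).
  exact: (bounded_mfun_integral (P ord0) _ bgc).
rewrite (PQ ord0 _ bI); apply: eq_Rintegral => x _.
have bgx : bounded_mfun (fun t => g (cons_pair (phi ord0 x, t))).
  exact: (bounded_mfun_sectionl _ bgc).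
rewrite (IH _ (fun i => Q (lift ord0 i)) (fun i => phi (lift ord0 i)) _
  (fun i => mphi _) (fun i => PQ _) bgx).
apply: eq_Rintegral => t _; congr g; apply: eq_from_tnth => i.
rewrite tnth_mktuple; case: (unliftP ord0 i) => [j ->|->].
  by rewrite !tnthS tnth_mktuple.
by rewrite !tnth0.
Qed.

(** * Isotropic Gaussians as affine images of the standard one *)

Section gaussian_affine.
Context {R : realType} {m : nat}.
Local Notation gamma := (@std_gaussian R m).
Local Notation tupR := (m.-tuple (measurableTypeR R)).

Lemma expectation_normal_affine (a s : R) (f : measurableTypeR R -> R) : 0 < s ->
  bounded_mfun f ->
  \int[normal_prob a s]_x f x = \int[normal_prob (0 : R) 1]_x f (a + s * x).
Proof.
move=> s0 bf.
have mg : measurable_fun setT (fun x : measurableTypeR R => a + s * x : measurableTypeR R).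
  by apply: measurable_funD => //; exact: measurable_funM.
pose g : {mfun measurableTypeR R >-> measurableTypeR R} :=
  HB.pack (fun x : measurableTypeR R => a + s * x : measurableTypeR R)
    (isMeasurableFun.Build _ _ _ _ _ mg).
pose P01 : probability (measurableTypeR R) R := normal_prob 0 1.
pose Pas : probability (measurableTypeR R) R := normal_prob a s.
have E : (\int[Pas]_x (f x)%:E = \int[distribution P01 g]_x (f x)%:E)%E.
  by apply: eq_measure_integral => A mA _; exact: normal_prob_affine.
have mf : measurable_fun setT (EFin \o f) by apply/measurable_EFinP; exact: bf.1.
have intf : P01.-integrable setT ((EFin \o f) \o g).
  exact: (bounded_mfun_integrable P01 (bounded_mfun_comp mg bf)).
have E2 := @integral_distribution _ _ _ _ _ P01 g (EFin \o f) mf intf.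
exact: (congr1 fine (etrans E E2)).
Qed.

Definition affine_tuple (w : 'rV[R]_m) (s : R) (t : tupR) : tupR :=
  [tuple w 0 i + s * tnth t i | i < m].

Lemma rv_affine_tuple w s t : rv (affine_tuple w s t) = w + s *: rv t.
Proof. by apply/rowP => i; rewrite !mxE tnth_mktuple. Qed.

Lemma measurable_affine_tuple w s : measurable_fun setT (affine_tuple w s).
Proof.
apply/measurable_fun_tnthP => i /=.
under [X in measurable_fun _ X]funext do rewrite /= tnth_mktuple.
apply: measurable_funD => //; apply: measurable_funM => //.
exact: measurable_tnth.
Qed.

HB.instance Definition _ w s :=
  isMeasurableFun.Build _ _ _ _ (affine_tuple w s) (measurable_affine_tuple w s).

Lemma gaussian_affine w s A : 0 < s -> measurable A ->
  gaussian w s A = gamma (affine_tuple w s @^-1` A).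
Proof.
move=> s0 mA.
have b1 : bounded_mfun (\1_A : tupR -> R).
  split; first exact: measurable_indic.
  by exists 1 => x; rewrite indicE; case: (_ \in _); rewrite ?normr1 ?normr0.
have mA' : measurable (affine_tuple w s @^-1` A).
  by rewrite -[X in measurable X]setTI; exact: measurable_affine_tuple.
have H := @expectation_prod_prob_map R _ (measurableTypeR R) m
  (fun i => normal_prob (w 0 i) s) (fun i => normal_prob ((0 : 'rV[R]_m) 0 i) 1)
  (fun i x => w 0 i + s * x) (\1_A) _ _ b1.
have {}H := H _ _.
have E1 := probability_indic (gaussian w s) mA.
have E2 := probability_indic gamma mA'.
refine (etrans E1 (etrans (congr1 EFin (H _ _)) (esym E2))).
  move=> i; apply: measurable_funD => //; exact: measurable_funM.
by move=> i f bf; rewrite mxE; exact: expectation_normal_affine.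
Qed.

(** The equality of measures extends the identity from bounded functions to integrable ones, as
    needed for the loss, which may be unbounded. *)
Lemma expectation_gaussian w s (f : 'rV[R]_m -> R) : 0 < s ->
  measurable_fun setT (fun t : tupR => f (rv t)) ->
  gamma.-integrable setT (fun t => (f (w + s *: rv t))%:E) ->
  \int[gaussian w s]_t f (rv t) = \int[gamma]_t f (w + s *: rv t).
Proof.
move=> s0 mf intf.
have E1 : (\int[gaussian w s]_t (f (rv t))%:E =
           \int[distribution gamma (affine_tuple w s)]_t (f (rv t))%:E)%E.
  by apply: eq_measure_integral => A mA _; exact: gaussian_affine.
have mf' : measurable_fun setT (fun t : tupR => (f (rv t))%:E).
  exact/measurable_EFinP.
have intf' : gamma.-integrable setT
    ((fun t => (f (rv t))%:E) \o (affine_tuple w s : tupR -> tupR)).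
  by apply: eq_integrable intf => // t _ /=; rewrite rv_affine_tuple.
have E2 := @integral_distribution _ _ _ _ _ gamma (affine_tuple w s)
  (fun t => (f (rv t))%:E) mf' intf'.
rewrite /Rintegral; apply: (congr1 fine (etrans E1 (etrans E2 _))).
by apply: eq_integral => t _ /=; rewrite rv_affine_tuple.
Qed.

Lemma std_gaussian_marginal i (A : set (measurableTypeR R)) : measurable A ->
  gamma [set t | A (tnth t i)] = normal_prob 0 1 A.
Proof.
move=> mA.
have -> : [set t : tupR | A (tnth t i)] =
    [set t | forall j, (if j == i then A else setT) (tnth t j)].
  apply/seteqP; split => t /= At; first by move=> j; case: eqP => // ->.
  by have := At i; rewrite eqxx.
pose P j : probability (measurableTypeR R) R := normal_prob ((0 : 'rV[R]_m) 0 j) 1.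
have mB j : measurable (if j == i then A else setT) by case: ifP.
refine (etrans (prod_prob_box P mB) _).
rewrite (bigD1 i)//= eqxx big1 ?mule1; first by rewrite /P mxE.
by move=> j /negbTE ->; exact: probability_setT.
Qed.

Lemma integrable_std_gaussian_coord i :
  gamma.-integrable setT (fun t => (tnth t i)%:E).
Proof.
apply/integrableP; split.
  by apply/measurable_EFinP; exact: measurable_tnth.
have /integrableP[_] := @integrable_normal_prob_id R.
have mt : measurable_fun setT (fun t : tupR => tnth t i) := measurable_tnth i.
pose X : {mfun tupR >-> measurableTypeR R} :=
  HB.pack (fun t : tupR => tnth t i) (isMeasurableFun.Build _ _ _ _ _ mt).
have mabs : measurable_fun setT (fun x : measurableTypeR R => `|x%:E|%E).
  by apply: measurableT_comp => //; exact/measurable_EFinP.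
have E1 := @ge0_integral_distribution _ _ _ _ _ gamma X _ mabs (fun=> abse_ge0 _).
pose P01 : probability (measurableTypeR R) R := normal_prob 0 1.
have E2 : (\int[distribution gamma X]_x `|x%:E| = \int[P01]_x `|x%:E|)%E.
  by apply: eq_measure_integral => A mA _; exact: std_gaussian_marginal.
by move=> fin; rewrite (esym E1 : (\int[gamma]_t `|(tnth t i)%:E|)%E = _) E2.
Qed.

Lemma std_gaussian_coord_mean i : \int[gamma]_t (tnth t i) = 0.
Proof.
have mt : measurable_fun setT (fun t : tupR => tnth t i) := measurable_tnth i.
pose X : {mfun tupR >-> measurableTypeR R} :=
  HB.pack (fun t : tupR => tnth t i) (isMeasurableFun.Build _ _ _ _ _ mt).
have mE : measurable_fun setT (EFin : measurableTypeR R -> \bar R).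
  exact/measurable_EFinP.
have E1 := @integral_distribution _ _ _ _ _ gamma X EFin mE (integrable_std_gaussian_coord i).
pose P01 : probability (measurableTypeR R) R := normal_prob 0 1.
have E2 : (\int[distribution gamma X]_x x%:E = \int[P01]_x x%:E)%E.
  by apply: eq_measure_integral => A mA _; exact: std_gaussian_marginal.
exact: (etrans (congr1 fine (etrans (esym E1) E2)) std_normal_mean).
Qed.

(** Identifies the point at which [jensen_gap] evaluates the function with the centre of the
    Gaussian. *)
Lemma gaussian_mean w s : 0 < s ->
  \row_(i < m) \int[gaussian w s]_u (@rv R m u 0 i) = w.
Proof.
move=> s0; apply/rowP => i; rewrite mxE.
have ii : gamma.-integrable setT (EFin \o (fun t : tupR => s * tnth t i)).
  have := integrableZl measurableT s (integrable_std_gaussian_coord i).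
  by apply: eq_integrable => // t _ /=; rewrite EFinM.
have iw : gamma.-integrable setT (EFin \o (fun t : tupR => w 0 i)).
  by apply: bounded_mfun_integrable; exact: bounded_mfun_cst.
rewrite (@expectation_gaussian w s (fun v => v 0 i))//.
- under eq_Rintegral do rewrite !mxE.
  rewrite RintegralD// RintegralZl//; last exact: integrable_std_gaussian_coord.
  by rewrite std_gaussian_coord_mean expectation_cst mulr0 addr0.
- under [X in measurable_fun _ X]funext do rewrite mxE.
  exact: measurable_tnth.
- have := integrableD measurableT iw ii.
  by apply: eq_integrable => // t _ /=; rewrite !mxE.
Qed.

End gaussian_affine.

(** * Directional derivatives, chain rule and mixed derivatives *)

Section directional_derivatives.
Context {R : realType}.

Lemma is_derive_line (V W : normedModType R) (f : V -> W) (w v : V) (t : R) :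
  derivable f (w + t *: v) v ->
  is_derive t 1 (fun s : R => f (w + s *: v)) ('D_v f (w + t *: v)).
Proof.
have E : (fun h : R => h^-1 *: (f (w + (h *: 1 + t) *: v) - f (w + t *: v))) =
         (fun h : R => h^-1 *: (f (h *: v + (w + t *: v)) - f (w + t *: v))).
  by apply/funext => h; rewrite [h *: 1]mulr1 scalerDl addrCA.
by move=> df; apply: DeriveDef; rewrite /derivable /derive /= E.
Qed.

Lemma is_derive_translate (V W : normedModType R) (f : V -> W) (x z v : V) :
  derivable f (x + z) v -> is_derive x v (fun y => f (y + z)) ('D_v f (x + z)).
Proof.
have E : (fun h : R => h^-1 *: (f (h *: v + x + z) - f (x + z))) =
         (fun h : R => h^-1 *: (f (h *: v + (x + z)) - f (x + z))).
  by apply/funext => h; rewrite addrA.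
by move=> df; apply: DeriveDef; rewrite /derivable /derive /= E.
Qed.

Lemma derive_dot_grad n (f : 'rV[R]_n -> R) (w v : 'rV[R]_n) :
  differentiable f w -> 'D_v f w = dot v (grad f w).
Proof.
move=> df; rewrite deriveE// {1}[v]row_sum_delta linear_sum/=.
by apply: eq_bigr => i _; rewrite linearZ/= mxE deriveE.
Qed.

Lemma derive_scale (V W : normedModType R) (f : V -> W) (w v : V) (c : R) :
  differentiable f w -> 'D_(c *: v) f w = c *: 'D_v f w.
Proof. by move=> df; rewrite !deriveE// linearZ. Qed.

Lemma derive_rv n (V : normedModType R) (f : V -> 'rV[R]_n) (w v : V) k :
  differentiable f w -> ('D_v f w) 0 k = 'D_v (fun x => f x 0 k) w.
Proof. by move=> df; rewrite derive_mx ?mxE//; exact: diff_derivable. Qed.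

Lemma differentiable_rv_coord n (V : normedModType R) (f : V -> 'rV[R]_n) (w : V) k :
  differentiable f w -> differentiable (fun x => f x 0 k) w.
Proof.
move=> df; apply: (@differentiable_comp _ _ _ _ f (fun M : 'rV[R]_n => M 0 k)) => //.
exact: differentiable_coord.
Qed.

Lemma derive_jac n p (f : 'rV[R]_n -> 'rV[R]_p) (w v : 'rV[R]_n) :
  differentiable f w -> 'D_v f w = v *m (jac f w)^T.
Proof. by move=> df; rewrite deriveEjacobian// trmxK. Qed.

Lemma jac_entry n p (f : 'rV[R]_n -> 'rV[R]_p) (w : 'rV[R]_n) k i :
  differentiable f w -> jac f w k i = 'D_(delta_mx 0 i) (fun x => f x 0 k) w.
Proof.
move=> df; rewrite -derive_rv// derive_jac// -rowE !mxE.
by [].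
Qed.

Lemma derive_comp_dot n p (f : 'rV[R]_n -> 'rV[R]_p) (g : 'rV[R]_p -> R)
    (w v : 'rV[R]_n) : differentiable f w -> differentiable g (f w) ->
  'D_v (fun x => g (f x)) w = dot ('D_v f w) (grad g (f w)).
Proof.
move=> df dg; rewrite deriveE; last exact: (differentiable_comp df dg).
by rewrite (diff_comp df dg) /= -!deriveE// derive_dot_grad.
Qed.

(** The bound holds for the difference quotients and passes to the limit. The absolute value keeps
    the right side nonnegative whatever the sign of [l]. *)
Lemma derive_lipschitz_le n (g : 'rV[R]_n -> R) l (z v : 'rV[R]_n) :
  differentiable g z -> l2_lipschitz l g -> `|'D_v g z| <= `|l| * l2norm v.
Proof.
move=> dg gl.
have /cvg_norm cv : (fun h => h^-1 *: (g (h *: v + z) - g z)) @ 0^' --> 'D_v g z.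
  exact: (@diff_derivable _ _ _ g z v dg).
apply: (closed_cvg (fun x : R => x <= `|l| * l2norm v) _ _ _ cv).
  exact: closed_le.
near=> h; have h0 : h != 0 by near: h; exact: nbhs_dnbhs_neq.
rewrite normrZ normfV ler_pdivrMl ?normr_gt0//.
apply: le_trans (gl _ _) _; rewrite addrK l2normZ mulrCA ler_wpM2l//.
by rewrite ler_wpM2r ?l2norm_ge0// ler_norm.
Unshelve. all: by end_near. Qed.

Lemma grad_dot_le n (g : 'rV[R]_n -> R) l (z v : 'rV[R]_n) :
  differentiable g z -> l2_lipschitz l g ->
  `|dot v (grad g z)| <= `|l| * l2norm v.
Proof. by move=> dg gl; rewrite -derive_dot_grad// derive_lipschitz_le. Qed.

Lemma mvt_line (V : normedModType R) (f : V -> R) (w v : V) (a : R) : 0 < a ->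
  (forall x, derivable f x v) ->
  exists2 c, 0 < c < a & f (w + a *: v) - f w = a * 'D_v f (w + c *: v).
Proof.
move=> a0 df.
have [|c] := @MVT R (fun s => f (w + s *: v)) (fun s => 'D_v f (w + s *: v)) 0 a a0
    (fun s _ => is_derive_line (df _)).
  apply: derivable_within_continuous => s _.
  exact: (@ex_derive _ _ _ _ _ _ _ (is_derive_line (df _))).
rewrite in_itv/= => c0a; rewrite scale0r addr0 subr0 mulrC => E.
by exists c.
Qed.

(* The second difference of f over the parallelogram spanned by a u and a v is,
   by two applications of the mean value theorem, a^2 times either mixed
   derivative at some point of the parallelogram. *)
Lemma derive_comm (V : normedModType R) (f : V -> R) (w u v : V) :
  (forall x, derivable f x u) -> (forall x, derivable f x v) ->
  (forall x, derivable (derive f ^~ u) x v) -> (forall x, derivable (derive f ^~ v) x u) ->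
  {for w, continuous (derive (derive f ^~ u) ^~ v)} ->
  {for w, continuous (derive (derive f ^~ v) ^~ u)} ->
  derive (derive f ^~ u) w v = derive (derive f ^~ v) w u.
Proof.
move=> fu fv fuv fvu cuv cvu.
have mixed (p q : V) : (forall x, derivable f x p) -> (forall x, derivable (derive f ^~ p) x q) ->
    forall a : R, 0 < a -> exists c d, [/\ 0 < c < a, 0 < d < a &
      f (w + a *: p + a *: q) - f (w + a *: p) - f (w + a *: q) + f w =
      a ^+ 2 * derive (derive f ^~ p) (w + c *: p + d *: q) q].
  move=> fp fpq a a0.
  have shift x := is_derive_translate (fp (x + a *: q)).
  have dg x : derivable (fun y => f (y + a *: q) - f y) x p.
    exact: (derivableB (@ex_derive _ _ _ _ _ _ _ (shift x)) (fp x)).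
  have Dg x : 'D_p (fun y => f (y + a *: q) - f y) x = 'D_p f (x + a *: q) - 'D_p f x.
    rewrite (deriveB (@ex_derive _ _ _ _ _ _ _ (shift x)) (fp x)).
    by rewrite (@derive_val _ _ _ _ _ _ _ (shift x)).
  have [c ca Ec] := mvt_line w a0 dg; rewrite Dg in Ec.
  have [d da Ed] := mvt_line (w + c *: p) a0 fpq.
  exists c, d; split => //; rewrite expr2 -mulrA -Ed -Ec.
  ring.
apply/eqP; rewrite -subr_eq0 -normr_le0; apply/ler_addgt0Pl => e e0; rewrite addr0.
have e2 : 0 < e / 2 by rewrite divr_gt0.
have /cvgrPdist_lt/(_ _ e2) near1 := cuv.
have /cvgrPdist_lt/(_ _ e2) near2 := cvu.
have [d /= d0 dP] := (nbhs_normP _ _).1 (filterI near1 near2).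
(* Small enough for both parallelograms to stay within distance d of w; the 1 covers the case u = v
   = 0. *)
pose a := d / (2 * (`|u| + `|v| + 1)).
have uv0 : 0 < `|u| + `|v| + 1 by rewrite ltr_wpDl ?addr_ge0.
have a0 : 0 < a by rewrite divr_gt0// mulr_gt0.
have small (p q : V) c b : 0 < c < a -> 0 < b < a -> `|p| + `|q| = `|u| + `|v| ->
    `|w - (w + c *: p + b *: q)| < d.
  move=> /andP[c0 ca] /andP[b0 ba] pq.
  rewrite -addrA opprD addNKr normrN.
  apply: le_lt_trans (ler_normD _ _) _; rewrite !normrZ !gtr0_norm//.
  apply: (@le_lt_trans _ _ (a * (`|u| + `|v|))).
    by rewrite -pq mulrDr lerD// ler_wpM2r// ltW.
  apply: (@le_lt_trans _ _ (d / 2)); last by lra.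
  have -> : d / 2 = a * (`|u| + `|v| + 1) by rewrite /a; field; rewrite gt_eqF.
  by rewrite ler_wpM2l ?(ltW a0)// lerDl.
have [c1 [b1 [c1a b1a E1]]] := mixed u v fu fuv a a0.
have [c2 [b2 [c2a b2a E2]]] := mixed v u fv fvu a a0.
have [h1 _] := dP _ (small u v _ _ c1a b1a erefl).
have [_ h2] := dP _ (small v u _ _ c2a b2a (addrC _ _)).
have E : derive (derive f ^~ u) (w + c1 *: u + b1 *: v) v =
         derive (derive f ^~ v) (w + c2 *: v + b2 *: u) u.
  have a2 : a ^+ 2 != 0 by rewrite expf_neq0// gt_eqF.
  apply: (mulfI a2); refine (etrans (esym E1) (etrans _ E2)).
  have -> : w + a *: v + a *: u = w + a *: u + a *: v by rewrite addrAC.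
  by rewrite (addrAC _ (- f (w + a *: u))).
rewrite E in h1.
clear -h1 h2; move: h1 h2.
move: (derive _ w v) (derive _ w u) (derive _ _ u) => p q z pz qz.
rewrite -(subrKA z); apply: le_trans (ler_normD _ _) _.
by rewrite [leRHS]splitr lerD// ?(distrC z) ltW.
Qed.

End directional_derivatives.

(** * Integration along a segment and second derivatives *)

Section displacement_energy.
Context {R : realType}.
Local Notation mu := (@lebesgue_measure R).

(** A scalar substitute for Jensen's inequality of vector integrals. It is used with k the inner
    product of a fixed d with a curve, c = |d|^2 and e the squared speed, where the pointwise
    hypothesis is |d - speed vector|^2 >= 0. *)
Lemma increment_le_integral (k k' e : R -> R) (c : R) :
  (forall t : R, is_derive t (1 : R) k (k' t)) -> continuous k' -> continuous e ->
  (forall t, 2 * k' t - c <= e t) ->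
  ((2 * (k 1 - k 0) - c)%:E <= \int[mu]_(t in `[0%R, 1%R]) (e t)%:E)%E.
Proof.
move=> dk ck ce ke.
pose K t := 2 * k t - c * t.
have dK (t : R) : is_derive t (1 : R) K (2 * k' t - c).
  have dk2 : is_derive t (1 : R) (fun s => 2 * k s) (2 * k' t).
    exact: (@is_deriveZ _ _ _ k 2 t 1 (k' t)).
  have dc : is_derive t (1 : R) (fun s : R => c * s) c.
    have := @is_deriveZ _ _ _ (@id R) c t 1 1 (is_derive_id _ _).
    by rewrite [c *: 1]mulr1.
  exact: is_deriveB.
have cK' : continuous (fun t => 2 * k' t - c).
  move=> t; apply: cvgB; last exact: cvg_cst.
  by apply: cvgM; [exact: cvg_cst|exact: ck].
have cK : continuous K.
  by move=> t; apply/differentiable_continuous/derivable1_diffP.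
have := @continuous_FTC2 R (fun t => 2 * k' t - c) K 0 1 ltr01.
have -> : ((K 1)%:E - (K 0)%:E = (2 * (k 1 - k 0) - c)%:E)%E.
  by rewrite -EFinB /K; congr EFin; ring.
move=> <-.
- apply: le_integral => //.
  + apply: continuous_compact_integrable; first exact: segment_compact.
    exact: continuous_subspaceT.
  + apply: continuous_compact_integrable; first exact: segment_compact.
    exact: continuous_subspaceT.
  + by move=> t _; rewrite lee_fin.
- exact: continuous_subspaceT.
- split; first by move=> t _; exact: ex_derive.
  + exact: cvg_at_right_filter (cK 0).
  + exact: cvg_at_left_filter (cK 1).
- by move=> t _; rewrite derive1E derive_val.
Qed.

Context {m C : nat} (f : 'rV[R]_m -> 'rV[R]_C).
Hypothesis f2 : twice_continuously_differentiable f.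

Let df w : differentiable f w. Proof. by case: f2. Qed.

Let dfk w k : differentiable (fun x => f x 0 k) w.
Proof. exact: differentiable_rv_coord. Qed.

Let djac w k i : differentiable (fun x => jac f x k i) w.
Proof.
have [_ dj _] := f2.
apply: (@differentiable_comp _ _ _ _ (jac f) (fun M : 'M[R]_(C, m) => M k i)) => //.
exact: differentiable_coord.
Qed.

Let jacE k i : (fun x => jac f x k i) =
  (fun x => 'D_(delta_mx 0 i) (fun y => f y 0 k) x).
Proof. by apply/funext => x; rewrite jac_entry. Qed.

(** Symmetry reconciles the order of differentiation in [hess] with the order in which the
    derivative along [v] is differentiated along [u]. *)
Lemma hess_sym k w : (hess (fun x => f x 0 k) w)^T = hess (fun x => f x 0 k) w.
Proof.
have [_ _ /(_ k) ch] := f2.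
have ent i j : continuous (fun x => hess (fun y => f y 0 k) x i j).
  move=> x; apply: (cvg_comp (hess (fun y => f y 0 k)) (fun M : 'M[R]_m => M i j)).
    exact: ch.
  exact: coord_continuous.
apply/matrixP => i j; rewrite !mxE.
have hE a b : (fun x => hess (fun y => f y 0 k) x a b) =
    (fun x => derive (derive (fun y => f y 0 k) ^~ (delta_mx 0 a)) x (delta_mx 0 b)).
  by apply/funext => x; rewrite mxE.
apply: derive_comm.
- by move=> x; exact: diff_derivable.
- by move=> x; exact: diff_derivable.
- by move=> x; rewrite -jacE; exact: diff_derivable.
- by move=> x; rewrite -jacE; exact: diff_derivable.
- by rewrite -hE; exact: ent.
- by rewrite -hE; exact: ent.
Qed.

Lemma derive_coordE v k : (fun x => ('D_v f x) 0 k) =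
  (fun x => \sum_(i < m) v 0 i * jac f x k i).
Proof.
apply/funext => x; rewrite derive_jac// mxE.
by apply: eq_bigr => i _; rewrite mxE.
Qed.

Let coord_sumE v k : (fun x => ('D_v f x) 0 k) =
  \sum_(i < m) (fun x => v 0 i * jac f x k i).
Proof. by rewrite derive_coordE; apply/funext => x; rewrite fct_sumE. Qed.

Let dvjac (v w : 'rV[R]_m) k i : differentiable (fun x => v 0 i * jac f x k i) w.
Proof. by apply: (differentiableM (differentiable_cst _ _) (djac _ _ _)). Qed.

Lemma differentiable_derive_coord v k w :
  differentiable (fun x => ('D_v f x) 0 k) w.
Proof. by rewrite coord_sumE; apply: differentiable_sum. Qed.

Lemma continuous_derive v : continuous (fun x => 'D_v f x).
Proof.
apply: continuous_mx => i k x; rewrite ord1.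
exact: differentiable_continuous (differentiable_derive_coord v k x).
Qed.

Lemma derive_derive_coord v u k w :
  'D_u (fun x => ('D_v f x) 0 k) w = dot (u *m hess (fun x => f x 0 k) w) v.
Proof.
rewrite coord_sumE derive_sum; last by move=> i; exact: diff_derivable.
apply: eq_bigr => i _.
rewrite (@deriveZ _ _ _ (fun x => jac f x k i) (v 0 i)); last exact: diff_derivable.
rewrite [RHS]mulrC derive_dot_grad//; congr (_ * _).
rewrite mxE; apply: eq_bigr => a _; congr (_ * _).
by rewrite -hess_sym !mxE jacE.
Qed.

End displacement_energy.

(** * Continuity and derivatives of matrix and inner products *)

Section continuity_derivative_of_products.
Context {R : realType}.

Lemma continuous_entry (T : topologicalType) m n (f : T -> 'M[R]_(m, n)) i j :
  continuous f -> continuous (fun t => f t i j).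
Proof.
move=> cf t; apply: (cvg_comp f (fun M : 'M[R]_(m, n) => M i j)); first exact: cf.
exact: coord_continuous.
Qed.

Lemma continuous_sum_mul (T : topologicalType) n (f g : 'I_n -> T -> R) :
  (forall i, continuous (f i)) -> (forall i, continuous (g i)) ->
  continuous (fun t => \sum_(i < n) f i t * g i t).
Proof.
move=> cf cg; elim: (index_enum _) => [|i s IH].
  by under [X in continuous X]funext do rewrite big_nil; move=> t; exact: cvg_cst.
under [X in continuous X]funext do rewrite big_cons.
move=> t; apply: cvgD; last exact: IH.
by apply: cvgM; [exact: cf|exact: cg].
Qed.

Lemma continuous_mulmx (T : topologicalType) m n p (f : T -> 'M[R]_(m, n))
    (g : T -> 'M[R]_(n, p)) :
  continuous f -> continuous g -> continuous (fun t => f t *m g t).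
Proof.
move=> cf cg; apply: continuous_mx => i j.
under [X in continuous X]funext do rewrite mxE.
by apply: continuous_sum_mul => k; exact: continuous_entry.
Qed.

Lemma dot_sqrB n (u v : 'rV[R]_n) :
  dot (u - v) (u - v) = dot u u - 2 * dot u v + dot v v.
Proof. by rewrite dotBl !dotBr (dotC v u); ring. Qed.

Lemma continuous_dot (T : topologicalType) n (f g : T -> 'rV[R]_n) :
  continuous f -> continuous g -> continuous (fun t => dot (f t) (g t)).
Proof. by move=> cf cg; apply: continuous_sum_mul => k; exact: continuous_entry. Qed.

Lemma continuous_line n (w v : 'rV[R]_n) : continuous (fun t : R => w + t *: v).
Proof.
move=> t; apply: cvgD; first exact: cvg_cst.
by apply: cvgZr_tmp; exact: cvg_id.
Qed.

Lemma is_derive_dot (V : normedModType R) n (f : V -> 'rV[R]_n) (d : 'rV[R]_n)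
    (x v : V) : derivable f x v ->
  is_derive x v (fun y => dot d (f y)) (dot d ('D_v f x)).
Proof.
move=> df.
have dfi i : derivable (fun y => d 0 i * f y 0 i) x v.
  have /derivable_mxP/(_ 0 i) h := df.
  by have := @derivableZ R V R (fun y => f y 0 i) (d 0 i) x v h.
have E : (fun y => dot d (f y)) = \sum_(i < n) (fun y => d 0 i * f y 0 i).
  by apply/funext => y; rewrite fct_sumE.
have h : derivable (fun y => dot d (f y)) x v.
  by rewrite E; exact: derivable_sum.
apply: DeriveDef => //; rewrite E derive_sum//; apply: eq_bigr => i _.
have /derivable_mxP/(_ 0 i) hi := df.
have -> := @deriveZ R V R (fun y => f y 0 i) (d 0 i) x v hi.
by rewrite derive_mx// mxE.
Qed.

End continuity_derivative_of_products.

(** * Displacements bounded by energies along the segment *)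

Section displacement.
Context {R : realType} {m C : nat} (f : 'rV[R]_m -> 'rV[R]_C).
Hypothesis f2 : twice_continuously_differentiable f.
Local Notation mu := (@lebesgue_measure R).

Let df w : differentiable f w. Proof. by case: f2. Qed.

(** With d the total displacement, 2 <d, g'> - |d|^2 <= |g'|^2 integrates over the segment to |d|^2
    on the left. *)
Lemma sqr_le_integral_line (g g' : 'rV[R]_m -> 'rV[R]_C) (w v : 'rV[R]_m) :
  (forall x, derivable g x v) -> (forall x, 'D_v g x = g' x) -> continuous g' ->
  ((dot (g (w + v) - g w) (g (w + v) - g w))%:E <=
   \int[mu]_(t in `[0%R, 1%R]) (dot (g' (w + t *: v)) (g' (w + t *: v)))%:E)%E.
Proof.
move=> dg gg' cg'; set d := g (w + v) - g w.
have cl : continuous (fun t : R => g' (w + t *: v)).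
  move=> t; apply: (cvg_comp (fun t : R => w + t *: v) g'); last exact: cg'.
  exact: continuous_line.
have := @increment_le_integral R (fun t => dot d (g (w + t *: v)))
  (fun t => dot d (g' (w + t *: v)))
  (fun t => dot (g' (w + t *: v)) (g' (w + t *: v))) (dot d d).
have -> : 2 * (dot d (g (w + 1 *: v)) - dot d (g (w + 0 *: v))) - dot d d = dot d d.
  by rewrite scale1r scale0r addr0 -dotBr -/d; ring.
apply.
- move=> t; rewrite -gg'.
  have h : derivable (fun s : R => g (w + s *: v)) t 1.
    exact: (@ex_derive _ _ _ _ _ _ _ (is_derive_line (dg _))).
  have := is_derive_dot d h.
  by rewrite (@derive_val _ _ _ _ _ _ _ (is_derive_line (dg _))).
- by apply: continuous_dot => // t; exact: cvg_cst.
- exact: continuous_dot.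
- move=> t; have := dotvv_ge0 (d - g' (w + t *: v)).
  by rewrite dot_sqrB; lra.
Qed.

Lemma displacement_le_jac_energy (w v : 'rV[R]_m) :
  ((dot (f (w + v) - f w) (f (w + v) - f w))%:E <=
   \int[mu]_(t in `[0%R, 1%R])
     (dot ('D_v f (w + (t *: v))) ('D_v f (w + (t *: v))))%:E)%E.
Proof.
apply: (sqr_le_integral_line (g' := fun x => 'D_v f x)) => //.
  by move=> x; exact: diff_derivable.
exact: continuous_derive.
Qed.

(** The same estimate for the map D_u f, whose derivative along [v] has the Hessian forms as
    coordinates. *)
Lemma displacement_le_hess_energy (w v u : 'rV[R]_m) :
  ((dot ('D_u f (w + v) - 'D_u f w) ('D_u f (w + v) - 'D_u f w))%:E <= \int[mu]_(t in `[0%R, 1%R])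
     (\sum_(k < C) dot (v *m hess (fun x => f x 0 k) (w + t *: v)) u ^+ 2)%:E)%E.
Proof.
have := @sqr_le_integral_line (fun x => 'D_u f x)
  (fun x => \row_(k < C) dot (v *m hess (fun y => f y 0 k) x) u) w v.
have E (t : R) : dot (\row_(k < C) dot (v *m hess (fun y => f y 0 k) (w + t *: v)) u)
    (\row_(k < C) dot (v *m hess (fun y => f y 0 k) (w + t *: v)) u) =
    \sum_(k < C) dot (v *m hess (fun x => f x 0 k) (w + t *: v)) u ^+ 2.
  by apply: eq_bigr => k _; rewrite mxE expr2.
under eq_integral do rewrite E.
have dD x : derivable (fun x => 'D_u f x) x v.
  apply/derivable_mxP => i k; rewrite ord1.
  apply: diff_derivable; exact: differentiable_derive_coord.
apply => //.
- move=> x; apply/rowP => k; rewrite derive_mx// !mxE.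
  exact: derive_derive_coord.
- apply: continuous_mx => i k.
  under [X in continuous X]funext do rewrite mxE.
  apply: (@continuous_dot _ _ _ (fun x => v *m hess (fun y => f y 0 k) x) (fun=> u)).
    apply: (@continuous_mulmx _ _ _ _ _ (fun=> v)); first exact: cst_continuous.
    by case: f2.
  exact: cst_continuous.
Qed.

End displacement.

(** * Cauchy-Schwarz and Tonelli for the energies *)

Section energy_bounds.
Context {R : realType}.

(** The infimum over a > 0 of (q/a + a)/2 is sqrt q. It is not attained when q = 0, so a is taken
    slightly above sqrt q. *)
Lemma le_mul_sqrt_of_amgm (x y c q : R) : 0 <= c -> 0 <= q ->
  (forall a, 0 < a -> x <= c * ((q / a + a) / 2) + y) -> x <= c * Num.sqrt q + y.
Proof.
move=> c0 q0 H; apply/ler_addgt0Pr => e e0.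
pose s := Num.sqrt q; have s0 : 0 <= s by exact: sqrtr_ge0.
have c1 : 0 < c + 1 by lra.
pose eta := e / (c + 1); have eta0 : 0 < eta by rewrite divr_gt0.
have a0 : 0 < s + eta by rewrite ltr_wpDl.
apply: (le_trans (H _ a0)); rewrite -/s.
have -> : c * s + y + e = c * s + e + y by ring.
rewrite lerD2r.
have h1 : (q / (s + eta) + (s + eta)) / 2 <= s + eta.
  have : q / (s + eta) <= s + eta.
    rewrite ler_pdivrMr// -expr2 -(sqr_sqrtr q0) -/s ler_pXn2r ?nnegrE ?(ltW a0)//.
    by rewrite lerDl ltW.
  lra.
apply: (le_trans (ler_wpM2l c0 h1)); rewrite mulrDr lerD2l.
rewrite /eta mulrA ler_pdivrMr// mulrC ler_wpM2l ?(ltW e0)//; lra.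
Qed.

(** Cauchy-Schwarz in linearized form: x <= (x^2/a + a)/2 is integrated for fixed a and b, and these
    are optimized at the end. Thus [x1] and [x2] enter only pointwise, and what is integrated are
    their upper bounds [psi1] and [psi2]. *)
Lemma expectation_le_sqrt_energy d (T : measurableType d) (P : probability T R)
    (p x1 x2 : T -> R) (psi1 psi2 : T -> \bar R) (c0 N1 N2 q1 q2 : R) :
  P.-integrable setT (EFin \o p) -> 0 <= N1 -> 0 <= N2 ->
  measurable_fun setT psi1 -> measurable_fun setT psi2 ->
  (forall t, 0 <= psi1 t)%E -> (forall t, 0 <= psi2 t)%E ->
  (forall t, `|c0 - p t| <= N1 * x1 t + N2 * x2 t) ->
  (forall t, ((x1 t ^+ 2)%:E <= psi1 t)%E) ->
  (forall t, ((x2 t ^+ 2)%:E <= psi2 t)%E) ->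
  (\int[P]_t psi1 t <= q1%:E)%E -> (\int[P]_t psi2 t <= q2%:E)%E ->
  `|c0 - \int[P]_t p t| <= N1 * Num.sqrt q1 + N2 * Num.sqrt q2.
Proof.
move=> ip N10 N20 m1 m2 psi10 psi20 cp x1psi x2psi Iq1 Iq2.
have q10 : 0 <= q1 by rewrite -lee_fin; apply: le_trans Iq1; exact: integral_ge0.
have q20 : 0 <= q2 by rewrite -lee_fin; apply: le_trans Iq2; exact: integral_ge0.
apply: le_mul_sqrt_of_amgm => // a a0.
rewrite [leRHS]addrC; apply: le_mul_sqrt_of_amgm => // b b0.
have amgm (x c : R) : 0 < c -> x <= (x ^+ 2 / c + c) / 2.
  move=> c0'; rewrite -subr_ge0.
  rewrite (_ : _ - _ = (x - c) ^+ 2 / (2 * c)); last by field; rewrite gt_eqF.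
  by rewrite divr_ge0 ?sqr_ge0// mulr_ge0// ltW.
have icp : P.-integrable setT (EFin \o (fun t => c0 - p t)).
  have ic : P.-integrable setT (EFin \o (fun _ : T => c0)).
    by apply: bounded_mfun_integrable; exact: bounded_mfun_cst.
  have := integrableB measurableT ic ip.
  by apply: eq_integrable => // t _ /=; rewrite EFinB.
have -> : c0 - \int[P]_t p t = \int[P]_t (c0 - p t).
  rewrite RintegralB ?expectation_cst//.
  by apply: bounded_mfun_integrable; exact: bounded_mfun_cst.
have k1 : 0 <= N1 / (2 * a) by rewrite divr_ge0// mulr_ge0// ltW.
have k2 : 0 <= N2 / (2 * b) by rewrite divr_ge0// mulr_ge0// ltW.
pose K := N1 * a / 2 + N2 * b / 2.
have K0 : 0 <= K by rewrite addr_ge0// divr_ge0// mulr_ge0// ltW.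
rewrite -lee_fin EFin_normr_Rintegral//.
apply: le_trans; first by apply: le_abse_integral => //; exact: measurable_int icp.
apply: (@le_trans _ _ (\int[P]_t (K%:E + ((N1 / (2 * a))%:E * psi1 t +
    (N2 / (2 * b))%:E * psi2 t)))%E).
  apply: ge0_le_integral => //.
  - by apply: measurableT_comp => //; exact: measurable_int icp.
  - apply: emeasurable_funD => //; apply: emeasurable_funD.
      exact: emeasurable_funM.
    exact: emeasurable_funM.
  - move=> t _ /=.
    apply: (@le_trans _ _ (K%:E + ((N1 / (2 * a))%:E * (x1 t ^+ 2)%:E +
        (N2 / (2 * b))%:E * (x2 t ^+ 2)%:E))%E); last first.
      by rewrite leeD2l// leeD// lee_wpmul2l// lee_fin.
    rewrite -!EFinM -!EFinD lee_fin; apply: (le_trans (cp t)).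
    apply: (@le_trans _ _ (N1 * ((x1 t ^+ 2 / a + a) / 2) + N2 * ((x2 t ^+ 2 / b + b) / 2))).
      by rewrite lerD// ler_wpM2l// amgm.
    rewrite le_eqVlt /K; apply/orP; left; apply/eqP; field.
    by rewrite !gt_eqF.
have mz1 : measurable_fun setT (fun t => (N1 / (2 * a))%:E * psi1 t)%E.
  exact: emeasurable_funM.
have mz2 : measurable_fun setT (fun t => (N2 / (2 * b))%:E * psi2 t)%E.
  exact: emeasurable_funM.
have z10 t : (0 <= (N1 / (2 * a))%:E * psi1 t)%E by rewrite mule_ge0// lee_fin.
have z20 t : (0 <= (N2 / (2 * b))%:E * psi2 t)%E by rewrite mule_ge0// lee_fin.
rewrite ge0_integralD//; last 2 first.
  by move=> t _; exact: adde_ge0.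
  exact: emeasurable_funD.
rewrite ge0_integralD// !ge0_integralZl// integral_cst//.
have /= -> := probability_setT P; rewrite mule1.
apply: (@le_trans _ _ (K%:E + ((N1 / (2 * a))%:E * q1%:E + (N2 / (2 * b))%:E * q2%:E))%E).
  by rewrite leeD2l// leeD// lee_wpmul2l// lee_fin.
rewrite -!EFinM -!EFinD lee_fin le_eqVlt /K; apply/orP; left; apply/eqP; field.
by rewrite !gt_eqF.
Qed.

Context {m : nat}.
Local Notation mu := (@lebesgue_measure R).
Local Notation gamma := (@std_gaussian R m).

(** Separate continuity gives joint measurability; the indicator of the unit interval moves the time
    integral to the whole line. *)
Lemma std_gaussian_tonelli (phi : 'rV[R]_m -> R -> R) :
  (forall t, continuous (phi ^~ t)) -> (forall u, continuous (phi u)) ->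
  (forall u t, 0 <= phi u t) ->
  measurable_fun setT (fun u => \int[mu]_(t in `[0%R, 1%R]) (phi (@rv R m u) t)%:E)%E /\
  (\int[gamma]_u \int[mu]_(t in `[0%R, 1%R]) (phi (rv u) t)%:E =
   \int[mu]_(t in `[0%R, 1%R]) \int[gamma]_u (phi (rv u) t)%:E)%E.
Proof.
move=> c1 c2 phi0.
pose psi (p : m.-tuple (measurableTypeR R) * measurableTypeR R) : \bar R :=
  ((phi (rv p.1) p.2)%:E * (\1_(`[0%R, 1%R]%classic : set R) p.2)%:E)%E.
have mpsi : measurable_fun setT psi.
  apply: emeasurable_funM.
    apply/measurable_EFinP; apply: measurable_caratheodory => // u.
    exact: continuous_measurable_fun.
  apply/measurable_EFinP.
  have mi : measurable_fun setT (\1_(`[0%R, 1%R]%classic : set R) : measurableTypeR R -> R).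
    exact: measurable_indic.
  exact: (measurableT_comp mi measurable_snd).
have psi0 p : (0 <= psi p)%E by rewrite mule_ge0// lee_fin// indicE.
have Et u : (\int[mu]_(t in `[0%R, 1%R]) (phi (rv u) t)%:E = \int[mu]_t psi (u, t))%E.
  by rewrite integral_mkcond epatch_indic.
have Eu : (\int[mu]_(t in `[0%R, 1%R]) \int[gamma]_u (phi (rv u) t)%:E =
    \int[mu]_t \int[gamma]_u psi (u, t))%E.
  rewrite integral_mkcond epatch_indic; apply: eq_integral => t _ /=.
  have mt : measurable_fun setT (fun u => (phi (@rv R m u) t)%:E).
    by apply/measurable_EFinP; exact: (measurable_continuous_rv (phi := phi ^~ t)).
  rewrite /psi /= ge0_integralZr// => u _; rewrite lee_fin ?indicE//.
split.
  under [X in measurable_fun _ X]funext do rewrite Et.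
  exact: (measurable_fun_fubini_tonelli_F (m2 := mu) psi mpsi psi0).
rewrite Eu; under eq_integral do rewrite Et.
exact: (fubini_tonelli (m1 := gamma) (m2 := mu) psi mpsi psi0).
Qed.

End energy_bounds.

Lemma integral_linear_combination {R : realType} d (T : measurableType d)
    (mu : {measure set T -> \bar R}) (D : set T) n (c : 'I_n -> R)
    (f : 'I_n -> T -> R) : measurable D ->
  (forall i, mu.-integrable D (EFin \o f i)) ->
  mu.-integrable D (fun x => (\sum_(i < n) c i * f i x)%:E) /\
  (\int[mu]_(x in D) (\sum_(i < n) c i * f i x)%:E =
   (\sum_(i < n) c i * \int[mu]_(x in D) f i x)%:E)%E.
Proof.
move=> mD fi.
have ci i : mu.-integrable D (fun x => (c i)%:E * (f i x)%:E)%E.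
  exact: (integrableZl mD (c i) (fi i)).
have E : (fun x => (\sum_(i < n) c i * f i x)%:E) =
    (fun x => \sum_(i < n) ((c i)%:E * (f i x)%:E))%E.
  by apply/funext => x; rewrite -sumEFin; apply: eq_bigr => i _; rewrite EFinM.
rewrite E; split; first by apply: integrable_sum => // i _; exact: ci.
rewrite (integral_sum mD ci).
rewrite -sumEFin; apply: eq_bigr => i _.
rewrite (integralZl mD (fi i)) EFinM /Rintegral fineK//.
exact: (integrable_fin_num mD (fi i)).
Qed.

Lemma integral_quad_form {R : realType} d (T : measurableType d)
    (mu : {measure set T -> \bar R}) (D : set T) n (M : T -> 'M[R]_n)
    (v : 'rV[R]_n) : measurable D ->
  (forall a b, mu.-integrable D (fun x => (M x a b)%:E)) ->
  (\int[mu]_(x in D) ((v *m M x *m v^T) 0 0)%:E =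
   ((v *m (\matrix_(a < n, b < n) \int[mu]_(x in D) M x a b) *m v^T) 0 0)%:E)%E.
Proof.
move=> mD iM.
have qE (N : 'M[R]_n) : (v *m N *m v^T) 0 0 =
    \sum_(b < n) v 0 b * \sum_(a < n) v 0 a * N a b.
  by rewrite quad_formE; apply: eq_bigr => b _; rewrite mxE mulrC.
under eq_integral do rewrite qE.
have H b := @integral_linear_combination R d T mu D n (v 0) (fun a x => M x a b) mD
  (fun a => iM a b).
have [_ ->] := @integral_linear_combination R d T mu D n (v 0)
  (fun b x => \sum_(a < n) v 0 a * M x a b) mD (fun b => (H b).1).
rewrite qE; congr EFin; apply: eq_bigr => b _; congr (_ * _).
rewrite /Rintegral (H b).2 /=; apply: eq_bigr => a _.
by rewrite mxE.
Qed.

(** * Lipschitz estimate for the Jensen gap in a quadratic form *)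

Section gap_lipschitz.
Context {dX dY : measure_display} {X : measurableType dX} {Y : measurableType dY}.
Context {R : realType} {m C : nat}.
Variables (h : 'rV[R]_m -> X -> 'rV[R]_C) (L : 'rV[R]_C -> Y -> R).
Variables (r sigma l beta : R) (x : X) (y : Y) (G B : 'M[R]_m).
Local Notation mu := (@lebesgue_measure R).
Local Notation gamma := (@std_gaussian R m).
Local Notation hx := (fun w => h w x).
Local Notation F := (fun w => L (h w x) y).

Hypothesis sigma0 : 0 < sigma.
Hypothesis h2 : twice_continuously_differentiable (h ^~ x).
Hypothesis L_lip : l2_lipschitz l (L ^~ y).
Hypothesis L_smooth : l2_smooth beta (L ^~ y).
Hypothesis hess_integrable : forall w t a b, l2_ball r w -> 0 <= t <= 1 ->
  gamma.-integrable setT (fun u => (hess_energy h sigma x w (rv u) t a b)%:E).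
Hypothesis hess_integrable_time : forall w a b, l2_ball r w ->
  mu.-integrable `[0, 1] (fun t => (mean_hess_energy h sigma x w t a b)%:E).
Hypothesis loss_diff : forall w, l2_ball r w ->
  differentiable_under_expectation h L sigma x y w.
Hypothesis jac_le_G : forall w, l2_ball r w ->
  loewner_le ((jac (h ^~ x) w)^T *m jac (h ^~ x) w) G.
Hypothesis A_fin : A_sup h r sigma x \is a fin_num.
Hypothesis hess_le_B : forall w, l2_ball r w ->
  loewner_le (int_hess_energy h sigma x w) B.

Let dh w : differentiable hx w. Proof. by case: h2. Qed.

Let dL z : differentiable (L ^~ y) z. Proof. by case: L_smooth. Qed.

Let dF w : differentiable F w.
Proof. exact: (differentiable_comp (dh w) (dL (h w x))). Qed.

Lemma jac_energyE w u t : jac_energy h sigma x w u t =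
  dot (u *m (jac hx (w + (t * sigma) *: u))^T) (u *m (jac hx (w + (t * sigma) *: u))^T).
Proof. by rewrite /jac_energy dotE trmx_mul trmxK !mulmxA. Qed.

Lemma hess_energy_quad w u t (v : 'rV[R]_m) :
  (v *m hess_energy h sigma x w u t *m v^T) 0 0 =
  \sum_(k < C) dot (u *m hess (fun w' => h w' x 0 k) (w + (t * sigma) *: u)) v ^+ 2.
Proof.
rewrite /hess_energy mulmx_sumr mulmx_suml summxE; apply: eq_bigr => k _ /=.
set H := hess _ _.
have -> : v *m (H^T *m u^T *m u *m H) *m v^T = (u *m H *m v^T)^T *m (u *m H *m v^T).
  by rewrite !trmx_mul trmxK !mulmxA.
by rewrite mxE big_ord1 mxE -dotE expr2.
Qed.

Let jac_continuous : continuous (jac hx).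
Proof. by move=> w; apply: differentiable_continuous; case: h2. Qed.

Let hess_continuous k : continuous (hess (fun w' => h w' x 0 k)).
Proof. by case: h2. Qed.

Let path_continuous_u (w : 'rV[R]_m) (t : R) :
  continuous (fun u : 'rV[R]_m => w + (t * sigma) *: u).
Proof.
have h1 : continuous (fun _ : 'rV[R]_m => w) by exact: cst_continuous.
have h2' : continuous (fun u : 'rV[R]_m => (t * sigma) *: u).
  exact: scaler_continuous.
by move=> u; exact: (cvgD (h1 u) (h2' u)).
Qed.

Let path_continuous_t (w : 'rV[R]_m) (u : 'rV[R]_m) :
  continuous (fun t : R => w + (t * sigma) *: u).
Proof.
under [X in continuous X]funext do rewrite -scalerA.
exact: continuous_line.
Qed.

Let cont_comp (S T U : topologicalType) (f : S -> T) (g : T -> U) :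
  continuous f -> continuous g -> continuous (fun s => g (f s)).
Proof. by move=> cf cg s; apply: (cvg_comp f g); [exact: cf|exact: cg]. Qed.

Let trmx_continuous (S : topologicalType) p q (f : S -> 'M[R]_(p, q)) :
  continuous f -> continuous (fun s => (f s)^T).
Proof.
move=> cf; apply: continuous_mx => i j.
by under [X in continuous X]funext do rewrite mxE; exact: continuous_entry.
Qed.

Let jac_energy_cont (S : topologicalType) (p q : S -> 'rV[R]_m) :
  continuous p -> continuous q -> continuous (fun s =>
    dot (p s *m (jac hx (q s))^T) (p s *m (jac hx (q s))^T)).
Proof.
move=> cp cq.
have H : continuous (fun s => p s *m (jac hx (q s))^T).
  apply: continuous_mulmx => //; apply: trmx_continuous.
  exact: (cont_comp cq jac_continuous).
exact: continuous_dot.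
Qed.

Let hess_energy_cont (S : topologicalType) (p q : S -> 'rV[R]_m) (v : 'rV[R]_m) :
  continuous p -> continuous q -> continuous (fun s =>
    \sum_(k < C) dot (p s *m hess (fun w' => h w' x 0 k) (q s)) v ^+ 2).
Proof.
move=> cp cq.
have H k : continuous (fun s => dot (p s *m hess (fun w' => h w' x 0 k) (q s)) v).
  have H1 : continuous (fun s => p s *m hess (fun w' => h w' x 0 k) (q s)).
    have cH := cont_comp cq (@hess_continuous k).
    exact: (@continuous_mulmx _ _ _ _ _ p _ cp cH).
  have H2 : continuous (fun _ : S => v) by exact: cst_continuous.
  exact: continuous_dot H1 H2.
under [X in continuous X]funext do under eq_bigr do rewrite expr2.
exact: continuous_sum_mul.
Qed.

Let phi1 w (u : 'rV[R]_m) (t : R) := jac_energy h sigma x w u t.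
Let phi2 w (v u : 'rV[R]_m) (t : R) := (v *m hess_energy h sigma x w u t *m v^T) 0 0.

(** [A_sup] integrates over u first, whereas the displacement bound yields a time integral for each
    u; the energy is nonnegative, so the order may be exchanged. *)
Lemma jac_energy_tonelli w : l2_ball r w ->
  measurable_fun setT (fun u => \int[mu]_(t in `[0%R, 1%R]) (phi1 w (@rv R m u) t)%:E)%E /\
  (\int[gamma]_u \int[mu]_(t in `[0%R, 1%R]) (phi1 w (rv u) t)%:E <=
   A_sup h r sigma x)%E.
Proof.
move=> bw; have [||u t|mm E] := @std_gaussian_tonelli R m (phi1 w).
- move=> t; rewrite /phi1; under [X in continuous X]funext do rewrite jac_energyE.
  (* The term [fun A => id] is the continuity of the identity map. *)
  by apply: jac_energy_cont => // u; exact: (fun A => id).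
- move=> u; rewrite /phi1; under [X in continuous X]funext do rewrite jac_energyE.
  by apply: jac_energy_cont => //; exact: cst_continuous.
- by rewrite /phi1 jac_energyE dotvv_ge0.
split=> //; rewrite E; apply: ereal_sup_ubound.
by exists w.
Qed.

(** Testing against [v] makes the matrix energy a sum of squares, to which Tonelli applies; the
    entrywise integrability identifies the result with the form of [int_hess_energy]. *)
Lemma hess_energy_tonelli w v : l2_ball r w ->
  measurable_fun setT (fun u => \int[mu]_(t in `[0%R, 1%R]) (phi2 w v (@rv R m u) t)%:E)%E /\
  (\int[gamma]_u \int[mu]_(t in `[0%R, 1%R]) (phi2 w v (rv u) t)%:E <=
   ((v *m B *m v^T) 0 0)%:E)%E.
Proof.
move=> bw; have [||u t|mm E] := @std_gaussian_tonelli R m (phi2 w v).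
- move=> t; rewrite /phi2; under [X in continuous X]funext do rewrite hess_energy_quad.
  by apply: hess_energy_cont => // u; exact: (fun A => id).
- move=> u; rewrite /phi2; under [X in continuous X]funext do rewrite hess_energy_quad.
  by apply: hess_energy_cont => //; exact: cst_continuous.
- by rewrite /phi2 hess_energy_quad sumr_ge0// => k _; exact: sqr_ge0.
split=> //; rewrite E.
have -> : (\int[mu]_(t in `[0%R, 1%R]) \int[gamma]_u (phi2 w v (rv u) t)%:E =
    \int[mu]_(t in `[0%R, 1%R]) ((v *m mean_hess_energy h sigma x w t *m v^T) 0 0)%:E)%E.
  apply: eq_integral => t; rewrite inE/= in_itv/= => t01.
  exact: (@integral_quad_form R _ _ gamma setT m
    (fun u => hess_energy h sigma x w (rv u) t) v measurableT
    (fun a b => @hess_integrable w t a b bw t01)).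
have m01 : measurable (`[0, 1]%classic : set (measurableTypeR R)).
  exact: measurable_itv.
rewrite (@integral_quad_form R _ (measurableTypeR R) mu _ m
  (mean_hess_energy h sigma x w) v m01 (fun a b => @hess_integrable_time w a b bw)).
have [_ /(_ v)] := hess_le_B bw.
by rewrite mulmxBr mulmxBl mxE [X in _ + X]mxE lee_fin subr_ge0.
Qed.

Let scaled_integral (phi : R -> R) : continuous phi -> (forall t, 0 <= phi t) ->
  (\int[mu]_(t in `[0%R, 1%R]) (sigma ^+ 2 * phi t)%:E =
   (sigma ^+ 2)%:E * \int[mu]_(t in `[0%R, 1%R]) (phi t)%:E)%E.
Proof.
move=> cphi phi0; under eq_integral do rewrite EFinM.
rewrite ge0_integralZl//.
- apply/measurable_EFinP; apply: measurable_funTS.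
  exact: continuous_measurable_fun.
- by move=> t _; rewrite lee_fin.
- by rewrite lee_fin sqr_ge0.
Qed.

Lemma displacement_sqr_le w u :
  ((l2norm (hx (w + sigma *: u) - hx w) ^+ 2)%:E <=
   (sigma ^+ 2)%:E * \int[mu]_(t in `[0%R, 1%R]) (phi1 w u t)%:E)%E.
Proof.
rewrite l2norm_sqr -scaled_integral.
- have := displacement_le_jac_energy h2 w (sigma *: u).
  move/le_trans; apply; rewrite le_eqVlt; apply/orP; left; apply/eqP.
  apply: eq_integral => t _; congr EFin.
  rewrite derive_scale// dotZl dotZr mulrA -expr2 scalerA /phi1 jac_energyE.
  by rewrite derive_jac.
- rewrite /phi1; under [X in continuous X]funext do rewrite jac_energyE.
  by apply: jac_energy_cont => //; exact: cst_continuous.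
- by move=> t; rewrite /phi1 jac_energyE dotvv_ge0.
Qed.

Lemma derive_displacement_sqr_le w v u :
  ((l2norm ('D_v hx (w + sigma *: u) - 'D_v hx w) ^+ 2)%:E <=
   (sigma ^+ 2)%:E * \int[mu]_(t in `[0%R, 1%R]) (phi2 w v u t)%:E)%E.
Proof.
rewrite l2norm_sqr -scaled_integral.
- have := displacement_le_hess_energy h2 w (sigma *: u) v.
  move/le_trans; apply; rewrite le_eqVlt; apply/orP; left; apply/eqP.
  apply: eq_integral => t _; congr EFin.
  rewrite /phi2 hess_energy_quad big_distrr; apply: eq_bigr => k _ /=.
  by rewrite -scalemxAl dotZl exprMn scalerA.
- rewrite /phi2; under [X in continuous X]funext do rewrite hess_energy_quad.
  by apply: hess_energy_cont => //; exact: cst_continuous.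
- by move=> t; rewrite /phi2 hess_energy_quad sumr_ge0// => k _; exact: sqr_ge0.
Qed.

Lemma derive_loss w v : 'D_v F w = dot ('D_v hx w) (grad (L ^~ y) (hx w)).
Proof. exact: (derive_comp_dot v (dh w) (dL (h w x))). Qed.

(** In the split of <p, g> - <p1, g1> the change of the loss gradient is paired with the derivative
    at [w]. This matters: the Jacobian bound by [G] is available at centres in the ball, not at the
    perturbed point. *)
Lemma derive_loss_diff_le w w1 v :
  `|'D_v F w - 'D_v F w1| <=
  `|beta| * l2norm ('D_v hx w) * l2norm (hx w1 - hx w) +
  `|l| * l2norm ('D_v hx w1 - 'D_v hx w).
Proof.
rewrite !derive_loss.
set p := 'D_v hx w; set p1 := 'D_v hx w1.
set g := grad _ (hx w); set g1 := grad _ (hx w1).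
have -> : dot p g - dot p1 g1 = - dot p (g1 - g) - dot (p1 - p) g1.
  by rewrite dotBr dotBl !opprB addrA subrK.
apply: le_trans (ler_normB _ _) _; rewrite normrN lerD//.
  apply: le_trans (cauchy_schwarz _ _) _.
  rewrite [`|beta| * _]mulrC -mulrA ler_wpM2l ?l2norm_ge0//.
  have [_ /(_ (hx w1) (hx w)) /le_trans] := L_smooth; apply.
  by rewrite ler_wpM2r ?l2norm_ge0// ler_norm.
exact: grad_dot_le.
Qed.

(** The point [w] ensures that the supremum is not over an empty set. *)
Lemma A_sup_ge0 (w : 'rV[R]_m) : l2_ball r w -> 0 <= fine (A_sup h r sigma x).
Proof.
move=> bw; rewrite fine_ge0//; have [_] := jac_energy_tonelli bw; apply: le_trans.
apply: integral_ge0 => u _; apply: integral_ge0 => t _.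
by rewrite lee_fin /phi1 jac_energyE dotvv_ge0.
Qed.

Lemma quad_B_ge0 (w v : 'rV[R]_m) : l2_ball r w -> 0 <= (v *m B *m v^T) 0 0.
Proof.
move=> bw; rewrite -lee_fin; have [_] := hess_energy_tonelli v bw; apply: le_trans.
apply: integral_ge0 => u _; apply: integral_ge0 => t _.
by rewrite lee_fin /phi2 hess_energy_quad sumr_ge0// => k _; exact: sqr_ge0.
Qed.

Lemma derive_gap_le (w v : 'rV[R]_m) : l2_ball r w ->
  gamma.-integrable setT (fun u => ('D_v F (w + sigma *: @rv R m u))%:E) ->
  `|'D_v F w - \int[gamma]_u 'D_v F (w + sigma *: rv u)| <=
  `|beta| * l2norm ('D_v hx w) * Num.sqrt (sigma ^+ 2 * fine (A_sup h r sigma x)) +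
  `|l| * Num.sqrt (sigma ^+ 2 * (v *m B *m v^T) 0 0).
Proof.
move=> bw ip.
have [m1 I1] := jac_energy_tonelli bw; have [m2 I2] := hess_energy_tonelli v bw.
have s20 : (0 <= (sigma ^+ 2)%:E)%E by rewrite lee_fin sqr_ge0.
have p10 u : (0 <= \int[mu]_(t in `[0%R, 1%R]) (phi1 w u t)%:E)%E.
  by apply: integral_ge0 => t _; rewrite lee_fin /phi1 jac_energyE dotvv_ge0.
have p20 u : (0 <= \int[mu]_(t in `[0%R, 1%R]) (phi2 w v u t)%:E)%E.
  apply: integral_ge0 => t _; rewrite lee_fin /phi2 hess_energy_quad.
  by rewrite sumr_ge0// => k _; exact: sqr_ge0.
apply: (@expectation_le_sqrt_energy R _ _ gamma
  (fun u => 'D_v F (w + sigma *: rv u))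
  (fun u => l2norm (hx (w + sigma *: rv u) - hx w))
  (fun u => l2norm ('D_v hx (w + sigma *: rv u) - 'D_v hx w))
  (fun u => (sigma ^+ 2)%:E * \int[mu]_(t in `[0%R, 1%R]) (phi1 w (rv u) t)%:E)%E
  (fun u => (sigma ^+ 2)%:E * \int[mu]_(t in `[0%R, 1%R]) (phi2 w v (rv u) t)%:E)%E) => //.
- by rewrite mulr_ge0// l2norm_ge0.
- exact: emeasurable_funM.
- exact: emeasurable_funM.
- by move=> u; exact: mule_ge0.
- by move=> u; exact: mule_ge0.
- by move=> u; exact: derive_loss_diff_le.
- by move=> u; exact: displacement_sqr_le.
- by move=> u; exact: derive_displacement_sqr_le.
- rewrite ge0_integralZl// [leRHS]EFinM fineK//.
  exact: lee_wpmul2l.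
- rewrite ge0_integralZl// [leRHS]EFinM.
  exact: lee_wpmul2l.
Qed.

(** Differentiation under the expectation is given for the partial derivatives; linearity extends it
    to every direction. *)
Lemma derive_smoothed_loss (w v : 'rV[R]_m) : l2_ball r w ->
  gamma.-integrable setT (fun u => ('D_v F (w + sigma *: @rv R m u))%:E) /\
  'D_v (smoothed_loss h L sigma x y) w = \int[gamma]_u 'D_v F (w + sigma *: rv u).
Proof.
move=> bw; have [dS ig gE] := loss_diff bw.
pose g j (u : m.-tuple (measurableTypeR R)) :=
  grad (fun w' => L (h (w' + sigma *: rv u) x) y) w 0 j.
have pE u : 'D_v F (w + sigma *: @rv R m u) = \sum_(j < m) v 0 j * g j u.
  have dt := is_derive_translate (@diff_derivable _ _ _ F _ v (dF (w + sigma *: rv u))).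
  have dFt : differentiable (fun w' => F (w' + sigma *: rv u)) w.
    apply: (@differentiable_comp _ _ _ _ (fun w' : 'rV[R]_m => w' + sigma *: rv u) F).
      by apply: differentiableD => //; exact: differentiable_cst.
    exact: dF.
  by rewrite -(@derive_val _ _ _ _ _ _ _ dt) derive_dot_grad.
have [iS ES] := @integral_linear_combination R _ _ gamma setT m (v 0) g measurableT ig.
split; first by under eq_fun do rewrite pE.
rewrite derive_dot_grad// gE.
have -> : \int[gamma]_u 'D_v F (w + sigma *: rv u) =
    \int[gamma]_u (\sum_(j < m) v 0 j * g j u).
  by apply: eq_Rintegral => u _; exact: pE.
rewrite /Rintegral ES /=; apply: eq_bigr => j _.
by rewrite mxE.
Qed.

Let gap w := F w - smoothed_loss h L sigma x y w.

(** Squaring the sum of the Jacobian and Hessian terms with (p + q)^2 <= 2 p^2 + 2 q^2 makes it a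
    quadratic form in [v], at the price of the factor 2. *)
Lemma gap_derive_sqr_le (w v : 'rV[R]_m) : l2_ball r w ->
  differentiable gap w /\
  ('D_v gap w) ^+ 2 <= (v *m ((2 * sigma ^+ 2) *:
    ((beta ^+ 2 * fine (A_sup h r sigma x)) *: G + l ^+ 2 *: B)) *m v^T) 0 0.
Proof.
move=> bw; have [dS _ _] := loss_diff bw.
have dg : differentiable gap w by exact: (differentiableB (dF w) dS).
split => //.
have [ip Sp] := derive_smoothed_loss v bw.
have -> : 'D_v gap w = 'D_v F w - \int[gamma]_u 'D_v F (w + sigma *: rv u).
  rewrite -Sp; apply: deriveB; exact: diff_derivable.
have := derive_gap_le bw ip; set D := _ - _.
set a := Num.sqrt _; set b := Num.sqrt _ => Dab.
have A0 := A_sup_ge0 bw; have B0 := quad_B_ge0 v bw.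
have a2 : a ^+ 2 = sigma ^+ 2 * fine (A_sup h r sigma x).
  by rewrite sqr_sqrtr// mulr_ge0// sqr_ge0.
have b2 : b ^+ 2 = sigma ^+ 2 * (v *m B *m v^T) 0 0.
  by rewrite sqr_sqrtr// mulr_ge0// sqr_ge0.
have N2 : l2norm ('D_v hx w) ^+ 2 <= (v *m G *m v^T) 0 0.
  have [_ /(_ v)] := jac_le_G bw.
  rewrite mulmxBr mulmxBl mxE [X in _ + X]mxE subr_ge0; apply: le_trans.
  by rewrite l2norm_sqr derive_jac// dotE trmx_mul trmxK !mulmxA.
apply: (@le_trans _ _ (2 * ((`|beta| * l2norm ('D_v hx w) * a) ^+ 2 + (`|l| * b) ^+ 2))).
  rewrite -(real_normK (num_real D)).
  apply: (@le_trans _ _ ((`|beta| * l2norm ('D_v hx w) * a + `|l| * b) ^+ 2)).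
    rewrite ler_pXn2r// nnegrE// addr_ge0// mulr_ge0// ?sqrtr_ge0//.
    by rewrite mulr_ge0// l2norm_ge0.
  rewrite -subr_ge0; set p := `|beta| * _ * a; set q := `|l| * b.
  by rewrite (_ : _ - _ = (p - q) ^+ 2) ?sqr_ge0//; ring.
rewrite !exprMn !real_normK ?num_real// a2 b2.
have -> (c p q : R) : (v *m (c *: (p *: G + q *: B)) *m v^T) 0 0 =
    c * (p * (v *m G *m v^T) 0 0 + q * (v *m B *m v^T) 0 0).
  by rewrite !quad_formE -scalemxAr dotZl mulmxDr dotDl -!scalemxAr !dotZl.
rewrite -[leRHS]mulrA ler_pM2l// [leRHS]mulrDr lerD//; last first.
  by rewrite le_eqVlt; apply/orP; left; apply/eqP; ring.
have -> (z : R) : sigma ^+ 2 * (beta ^+ 2 * fine (A_sup h r sigma x) * z) =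
    beta ^+ 2 * z * (sigma ^+ 2 * fine (A_sup h r sigma x)) by ring.
apply: ler_wpM2r; first by rewrite mulr_ge0// sqr_ge0.
by apply: ler_wpM2l => //; exact: sqr_ge0.
Qed.

(** The mean value theorem on the segment from w' to w, which stays in the ball by convexity, where
    the derivative bound holds. *)
Lemma gap_lipschitz (w w' : 'rV[R]_m) : l2_ball r w -> l2_ball r w' ->
  (gap w - gap w') ^+ 2 <= ((w - w') *m ((2 * sigma ^+ 2) *:
    ((beta ^+ 2 * fine (A_sup h r sigma x)) *: G + l ^+ 2 *: B)) *m (w - w')^T) 0 0.
Proof.
move=> bw bw'; set v := w - w'.
have bs (s : R) : s \in `[0, 1]%R -> l2_ball r (w' + s *: v).
  rewrite in_itv/= => /andP[s0 s1]; rewrite /l2_ball/=.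
  have -> : w' + s *: v = s *: w + (1 - s) *: w'.
    by rewrite /v scalerBr scalerBl scale1r addrCA addrC -addrA addrC.
  apply: le_trans (l2norm_triangle _ _) _; rewrite !l2normZ !ger0_norm ?subr_ge0//.
  have -> : r = s * r + (1 - s) * r by ring.
  by rewrite lerD// ler_wpM2l ?subr_ge0.
have ds (s : R) : s \in `[0, 1] ->
    is_derive s (1 : R) (fun s : R => gap (w' + s *: v)) ('D_v gap (w' + s *: v)).
  move=> /bs /gap_derive_sqr_le-/(_ v)[dg _].
  by apply: is_derive_line; exact: diff_derivable.
have dd (s : R) : s \in `]0, 1[%R ->
    is_derive s (1 : R) (fun s : R => gap (w' + s *: v)) ('D_v gap (w' + s *: v)).
  by move=> s01; apply: ds; exact: (@subset_itv_oo_cc _ _ _ _ s s01).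
have cc : {within `[0, 1], continuous (fun s : R => gap (w' + s *: v))}.
  by apply: derivable_within_continuous => s /ds ?; exact: ex_derive.
have [s s01] := MVT_segment (@ler01 R) dd cc.
rewrite scale1r scale0r addr0 subr0 mulr1 (addrC w') subrK => ->.
by have [_] := gap_derive_sqr_le v (bs s s01).
Qed.

End gap_lipschitz.

(** * A dense sequence in the Euclidean ball *)

Section dense_sequence.
Context {R : realType} {m : nat}.

Lemma continuous_l2norm : continuous (@l2norm R m).
Proof.
have H : continuous (fun v : 'rV[R]_m => dot v v).
  by apply: continuous_dot => v; exact: (fun A => id).
rewrite (_ : @l2norm R m = fun v => Num.sqrt (dot v v)); last first.
  by apply/funext => v; exact: l2normE.
by move=> v; apply: (cvg_comp (fun v : 'rV[R]_m => dot v v) Num.sqrt);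
  [exact: H|exact: sqrt_continuous].
Qed.

(** Grid points approximating a point of the ball may fall outside it; the radial projection brings
    them back. *)
Definition l2_proj (r : R) (v : 'rV[R]_m) : 'rV[R]_m :=
  if l2norm v <= r then v else (r / l2norm v) *: v.

Lemma l2_proj_ball r v : 0 <= r -> l2norm (l2_proj r v) <= r.
Proof.
move=> r0; rewrite /l2_proj; case: ifPn => //; rewrite -ltNge => rv.
have v0 : 0 < l2norm v := le_lt_trans r0 rv.
by rewrite l2normZ ger0_norm ?divr_ge0// ?(ltW v0)// divfK// gt_eqF.
Qed.

(** Projecting moves v by |v| - r <= |v| - |w| <= |v - w|, which at most doubles the distance to
    w. *)
Lemma l2_proj_dist r v w : l2norm w <= r -> l2norm (l2_proj r v - w) <= 2 * l2norm (v - w).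
Proof.
move=> wr; have vw0 := l2norm_ge0 (v - w).
rewrite /l2_proj; case: ifPn => [_|]; first lra.
have r0 : 0 <= r := le_trans (l2norm_ge0 _) wr.
rewrite -ltNge => rv; have v0 : 0 < l2norm v := le_lt_trans r0 rv.
have -> : (r / l2norm v) *: v - w = (v - w) + (r / l2norm v - 1) *: v.
  by rewrite scalerBl scale1r [RHS]addrC addrA subrK.
apply: le_trans (l2norm_triangle _ _) _.
have h1 : l2norm ((r / l2norm v - 1) *: v) = l2norm v - r.
  rewrite l2normZ ler0_norm ?subr_le0 ?ler_pdivrMr// ?mul1r ?(ltW rv)//.
  by field; rewrite gt_eqF.
have h2 : l2norm v <= l2norm (v - w) + l2norm w.
  by have := l2norm_triangle (v - w) w; rewrite subrK.
rewrite h1; lra.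
Qed.

(** Enumerates the grids of all meshes, projected to the ball. Numbers that code no grid point are
    sent to the centre, so that every term lies in the ball. *)
Definition ball_seq (r : R) (n : nat) : 'rV[R]_m :=
  if unpickle n is Some kc then
    l2_proj r (grid (kc : nat * 'rV[int]_m).1 kc.2)
  else 0.

Lemma ball_seq_ball r n : 0 <= r -> l2norm (ball_seq r n) <= r.
Proof.
move=> r0; rewrite /ball_seq; case: unpickle => [kc|]; first exact: l2_proj_ball.
by rewrite l2normE dot0l sqrtr0.
Qed.

Lemma ball_seq_dense r w : l2norm w <= r ->
  exists s : nat -> nat, (fun j => ball_seq r (s j)) @ \oo --> w.
Proof.
move=> wr; exists (fun j => pickle (j, to_grid j w)).
pose q j : 'rV[R]_m := grid j (to_grid j w).
have -> : (fun j => ball_seq r (pickle (j, to_grid j w))) = (fun j => l2_proj r (q j)).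
  by apply/funext => j; rewrite /ball_seq pickleK.
have qw : q @ \oo --> w := @grid_to_grid_cvg _ _ w.
have dq : (fun j => 2 * l2norm (q j - w)) @ \oo --> (0 : R).
  rewrite (_ : 0 = 2 * l2norm (w - w)); last first.
    by rewrite subrr l2normE dot0l sqrtr0 mulr0.
  apply: cvgMl_tmp; apply: (cvg_comp (fun j => q j - w) (@l2norm R m)).
    have cw : (fun _ : nat => w) @ \oo --> w by exact: cvg_cst.
    exact: (cvgB qw cw).
  exact: continuous_l2norm.
apply: cvg_mx => i k; rewrite ord1 {i}.
apply/cvgrPdist_le => e e0.
move/cvgrPdist_le : dq => /(_ _ e0); apply: filterS => j.
rewrite sub0r normrN ger0_norm ?mulr_ge0 ?l2norm_ge0//; apply: le_trans.
apply: le_trans (l2_proj_dist _ wr); rewrite distrC.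
apply: le_trans (normr_coord_le_l2norm _ k).
by rewrite !mxE.
Qed.

End dense_sequence.

(** * The Jensen gap as a function of the centre and of the data *)

Section jensen_gap.
Context {dX dY : measure_display} {X : measurableType dX} {Y : measurableType dY}.
Context {R : realType} {m C : nat}.
Variables (h : 'rV[R]_m -> X -> 'rV[R]_C) (L : 'rV[R]_C -> Y -> R) (sigma : R).
Hypothesis sigma0 : 0 < sigma.
Local Notation gamma := (@std_gaussian R m).

(** Moves the dependence on w from the measure into the integrand, so that the gap can be
    differentiated in w. *)
Lemma jensen_gapE x y w : continuous (fun w => L (h w x) y) ->
  gamma.-integrable setT (fun u => (L (h (w + sigma *: rv u) x) y)%:E) ->
  jensen_gap (gaussian w sigma) (fun w' => L (h w' x) y) =
  L (h w x) y - smoothed_loss h L sigma x y w.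
Proof.
move=> cF iF.
have mF : measurable_fun setT (fun t : m.-tuple (measurableTypeR R) => L (h (rv t) x) y).
  exact: (measurable_continuous_rv (phi := fun w => L (h w x) y)).
have E := @expectation_gaussian R m w sigma (fun w => L (h w x) y) sigma0 mF iF.
have Em := @gaussian_mean R m w sigma sigma0.
exact: (congr2 (fun a b => a - b) (congr1 (fun w => L (h w x) y) Em) E).
Qed.

(** Tonelli is applied to the positive and negative parts separately, which gives measurability
    without joint integrability. *)
Lemma measurable_smoothed_loss w :
  (forall x y, continuous (fun w => L (h w x) y)) ->
  (forall w, measurable_fun setT (fun p : X * Y => L (h w p.1) p.2)) ->
  measurable_fun setT (fun p : X * Y => smoothed_loss h L sigma p.1 p.2 w).
Proof.
move=> cF mF.
pose phi (u : 'rV[R]_m) (p : X * Y) : R := L (h (w + sigma *: u) p.1) p.2.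
have cphi p : continuous (phi ^~ p).
  have c1 : continuous (fun u : 'rV[R]_m => sigma *: u) by exact: scaler_continuous.
  have c2 : continuous (fun _ : 'rV[R]_m => w) by exact: cst_continuous.
  move=> u; apply: (cvg_comp (fun u : 'rV[R]_m => w + sigma *: u)
    (fun w => L (h w p.1) p.2)); last exact: cF.
  exact: (cvgD (c2 u) (c1 u)).
have mphi := measurable_caratheodory cphi (fun u => mF (w + sigma *: u)).
have mE : measurable_fun setT (fun q : m.-tuple (measurableTypeR R) * (X * Y) =>
    (phi (rv q.1) q.2)%:E) by exact/measurable_EFinP.
have mI : measurable_fun setT (fun p : X * Y =>
    \int[gamma]_u (phi (rv u) p)%:E)%E.
  pose g (q : m.-tuple (measurableTypeR R) * (X * Y)) := (phi (rv q.1) q.2)%:E.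
  have Hp := measurable_fun_fubini_tonelli_G (m1 := gamma) (g^\+)%E
    (measurable_funepos mE) (fun q => funepos_ge0 _ q).
  have Hn := measurable_fun_fubini_tonelli_G (m1 := gamma) (g^\-)%E
    (measurable_funeneg mE) (fun q => funeneg_ge0 _ q).
  have -> : (fun p : X * Y => \int[gamma]_u (phi (rv u) p)%:E)%E =
      (fubini_G gamma (g^\+) \- fubini_G gamma (g^\-))%E.
    apply/funext => p; rewrite integralE /fubini_G /=.
    congr (_ - _)%E; [by apply: eq_integral => u _; rewrite !funeposE|
      by apply: eq_integral => u _; rewrite !funenegE].
  exact: (emeasurable_funB Hp Hn).
exact: (measurableT_comp (fine_measurable measurableT) mI).
Qed.

End jensen_gap.

(** * Empirical Rademacher average and limits in the class size *)

Section empirical_complexity.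
Context {R : realType}.

(** Contraction trades each [f i] for the linear functionals of a decomposition of [M i]. Of the
    factor 4, one 2 is already in the doubled vectors and the other comes from the contraction. *)
Lemma sign_avg_vmax_psd_le N n m (W : 'M[R]_(N.+1, m)) (r : R)
    (f : 'I_n -> 'rV[R]_N.+1) (M : 'I_n -> 'M[R]_m) :
  (forall k, l2norm (row k W) <= r) -> (forall i, psd (M i)) ->
  (forall i k l, (f i 0 k - f i 0 l) ^+ 2 <=
     ((row k W - row l W) *m M i *m (row k W - row l W)^T) 0 0) ->
  sign_avg (@vmax R N) [seq 2 *: f i | i <- enum 'I_n] 0 <=
  4 * r * Num.sqrt (\sum_(i < n) \tr (M i)).
Proof.
move=> Wr pM fM.
have /choice[Q QM] := fun i => psd_sum_sqr (pM i).
pose S i := [seq 2 *: q *m W^T | q <- Q i].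
have entry (q : 'rV[R]_m) k : (q *m W^T) 0 k = dot q (row k W).
  by rewrite mxE; apply: eq_bigr => j _; rewrite !mxE.
have H i k l : ((2 *: f i) 0 k - (2 *: f i) 0 l) ^+ 2 <=
    \sum_(q <- S i) (q 0 k - q 0 l) ^+ 2.
  have -> : (2 *: f i) 0 k - (2 *: f i) 0 l = 2 * (f i 0 k - f i 0 l).
    by rewrite !mxE mulrBr.
  rewrite exprMn big_map; apply: le_trans (ler_wpM2l (sqr_ge0 2) (fM i k l)) _.
  rewrite (QM i).1 big_distrr; apply: ler_sum => q _.
  by rewrite !entry -dotBr dotZl exprMn.
apply: (le_trans (vmax_contraction (enum 'I_n) 0 H)).
have -> : [seq 2 *: q | q <- flatten [seq S i | i <- enum 'I_n]] =
    [seq q *m W^T | q <- [seq 4 *: q | q <- flatten [seq Q i | i <- enum 'I_n]]].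
  rewrite !map_flatten -!map_comp; congr flatten; apply: eq_map => i /=.
  rewrite /S -!map_comp; apply: eq_map => q /=.
  by rewrite -!scalemxAl scalerA -natrM.
apply: le_trans (sign_avg_vmax_linear _ Wr) _.
rewrite [4 * r]mulrC -mulrA ler_wpM2l//; first exact: le_trans (l2norm_ge0 _) (Wr ord0).
rewrite big_map (eq_bigr (fun q : 'rV[R]_m => 4 ^+ 2 * dot q q)); last first.
  by move=> q _; rewrite dotZl dotZr mulrA expr2.
rewrite -big_distrr/= sqrtrM ?sqr_ge0// sqrtr_sqr ger0_norm// ler_wpM2l//.
rewrite le_eqVlt; apply/orP; left; apply/eqP; congr Num.sqrt.
rewrite big_flatten big_map big_enum/=; apply: eq_bigr => i _.
by rewrite (QM i).2.
Qed.

(** The tail unions decrease to the lim sup, and each contains an event of probability at least c.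
    The events themselves need not be nested. *)
Lemma probability_lim_sup_ge d (T : measurableType d) (P : probability T R)
    (E : nat -> set T) (c : \bar R) : (forall n, measurable (E n)) ->
  (forall n, (c <= P (E n))%E) ->
  measurable (lim_sup_set E) /\ (c <= P (lim_sup_set E))%E.
Proof.
move=> mE cE; split.
  by apply: bigcapT_measurable => n; apply: bigcup_measurable.
have H := @lim_sup_set_cvg _ _ _ P E mE.
have {}H : P (\bigcup_(k in [set k | (n <= k)%N]) E k) @[n --> \oo] --> P (lim_sup_set E).
  apply: H; rewrite (le_lt_trans (probability_le1 _ _)) ?ltry//.
  exact: bigcup_measurable.
rewrite -(cvg_lim _ H)//; apply: lime_ge; first by apply/cvg_ex; eexists; exact: H.
apply: nearW => n; apply: le_trans (cE n) _; apply: le_measure; rewrite ?inE//.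
  exact: bigcup_measurable.
by move=> t Et; exists n => /=.
Qed.

Lemma cvg_sum_seq I (s : seq I) (F : I -> nat -> R) (a : I -> R) :
  (forall i, F i @ \oo --> a i) ->
  (fun n => \sum_(i <- s) F i n) @ \oo --> \sum_(i <- s) a i.
Proof. by move=> Fa; apply: cvg_big => //; exact: add_continuous. Qed.

Lemma expectation_cvg d (T : measurableType d) (P : probability T R)
    (f : nat -> T -> R) (g : T -> R) (M : R) :
  (forall n, measurable_fun setT (f n)) -> (forall n t, `|f n t| <= M) ->
  measurable_fun setT g -> (forall t, (fun n => f n t) @ \oo --> g t) ->
  (fun n => \int[P]_t f n t) @ \oo --> \int[P]_t g t.
Proof.
move=> mf fM mg fg.
have gM t : `|g t| <= M.
  apply: (closed_cvg (fun x : R => x <= M) _ _ _ (cvg_norm (fg t))).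
    exact: closed_le.
  by apply: nearW => n; exact: fM.
have bf n : bounded_mfun (f n) by split => //; exists M.
have bg : bounded_mfun g by split => //; exists M.
have H := @dominated_cvg _ _ _ P setT measurableT (fun n t => (f n t)%:E)
  (fun t => (g t)%:E) (fun=> M%:E).
have {}H : (fun n => \int[P]_t (f n t)%:E)%E @ \oo --> (\int[P]_t (g t)%:E)%E.
  apply: H => //.
  - by move=> n; apply/measurable_EFinP.
  - by move=> t _; apply: cvg_EFin => //; [exact: nearW|exact: fg].
  - by apply: (bounded_mfun_integrable P (f := fun=> M)); exact: bounded_mfun_cst.
  - by move=> n t _; rewrite lee_fin.
rewrite -(EFin_Rintegral P bg) in H.
exact: (fine_cvg H).
Qed.

End empirical_complexity.

(** * The uniform bound over the ball *)

Theorem proposition7p9 (R : realType) :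
  exists c : R, 0 < c /\
  forall (dX dY : measure_display) (X : measurableType dX)
    (Y : measurableType dY) (m C n : nat)
    (D : probability (X * Y)%type R)
    (h : 'rV[R]_m -> X -> 'rV[R]_C) (L : 'rV[R]_C -> Y -> R)
    (r sigma l beta B : R)
    (G Bm : n.-tuple (X * Y) -> 'I_n -> 'M[R]_m),
  let Theta := @l2_ball R m r in
  let Q w := gaussian w sigma in
  let Jen w (x : X) (y : Y) := jensen_gap (Q w) (fun w' => L (h w' x) y) in
  (0 < n)%N -> 0 < sigma ->
  (forall w, measurable_fun setT (fun p : X * Y => L (h w p.1) p.2)) ->
  (forall y, l2_lipschitz l (L ^~ y)) ->
  (forall y, l2_smooth beta (L ^~ y)) ->
  Reg h L r sigma G Bm ->
  0 < B ->
  (forall x y w, Theta w -> `|Jen w x y| <= sigma ^+ 2 * B) ->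
  forall delta : R, 0 < delta < 1 ->
  exists E : set (n.-tuple (X * Y)),
    [/\ measurable E,
        ((1 - delta)%:E <= prod_prob (fun _ : 'I_n => D) E)%E &
        forall S, E S -> forall w, Theta w ->
          \int[D]_p Jen w p.1 p.2 <=
            n%:R^-1 * \sum_(i < n) Jen w (tnth S i).1 (tnth S i).2
            + 2 * c * (r * sigma / Num.sqrt n%:R)
              * Num.sqrt (beta ^+ 2 * J_S h r sigma G S
                          + l ^+ 2 * H_S Bm S)
            + 8 * sigma ^+ 2 * B * Num.sqrt (2 * ln (4 / delta) / n%:R)].
Proof.
exists (2 * Num.sqrt 2); split; first by rewrite mulr_gt0// sqrtr_gt0.
move=> dX dY X Y m C n D h L r sigma l beta B G Bm Theta Q Jen.
move=> n0 sigma0 mF Llip Lsm HReg B0 JenB delta d01.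
(* For negative radius the ball is empty and the whole sample space serves as event. *)
have [r_lt0|r0] := ltP r 0.
  exists setT; split => //.
    rewrite probability_setT lee_fin; have /andP[d0 _] := d01; lra.
  move=> S _ w; rewrite /Theta /l2_ball/= => wr.
  by have := le_lt_trans (le_trans (l2norm_ge0 _) wr) r_lt0; rewrite ltxx.
have nR : (0 : R) < n%:R by rewrite ltr0n.
(* The regularity hypotheses speak of entries of samples; constant samples, available since n > 0,
   give them at every pair (x, y). *)
have point x y : exists S : n.-tuple (X * Y), exists i, tnth S i = (x, y).
  exists (nseq_tuple n (x, y)), (Ordinal n0).
  by rewrite (tnth_nth (x, y)) /= nth_nseq n0.
have hC2 x (y : Y) : twice_continuously_differentiable (h ^~ x).
  by have [S [i Si]] := point x y; have := Reg_C2 HReg S i; rewrite Si.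
have iF x y w : Theta w -> (@std_gaussian R m).-integrable setT
    (fun u => (L (h (w + sigma *: rv u) x) y)%:E).
  move=> wr; have [S [i Si]] := point x y.
  by have := Reg_loss_integrable HReg S i wr; rewrite Si.
have dS x y w : Theta w -> differentiable_under_expectation h L sigma x y w.
  move=> wr; have [S [i Si]] := point x y.
  by have := Reg_diff HReg S i wr; rewrite Si.
have dF x y w : differentiable (fun w => L (h w x) y) w.
  apply: (@differentiable_comp _ _ _ _ (h ^~ x) (L ^~ y)).
    by have [+ _ _] := hC2 x y; apply.
  by have [+ _] := Lsm y; apply.
have cF x y : continuous (fun w => L (h w x) y).
  by move=> w; apply: differentiable_continuous.
have JenE x y w : Theta w ->
    Jen w x y = L (h w x) y - smoothed_loss h L sigma x y w.
  by move=> wr; apply: jensen_gapE => //; exact: iF.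
have mJen w : Theta w -> measurable_fun setT (fun p : X * Y => Jen w p.1 p.2).
  move=> wr; rewrite (_ : (fun p => _) =
      (fun p : X * Y => L (h w p.1) p.2 - smoothed_loss h L sigma p.1 p.2 w)).
    by apply: measurable_funB => //; exact: measurable_smoothed_loss.
  by apply/funext => p; exact: JenE.
have cJen x y w (W : nat -> 'rV[R]_m) : Theta w -> (forall j, Theta (W j)) ->
    W @ \oo --> w -> (fun j => Jen (W j) x y) @ \oo --> Jen w x y.
  move=> wr Wr Ww; rewrite JenE//.
  rewrite (_ : (fun j => Jen (W j) x y) =
      (fun w => L (h w x) y - smoothed_loss h L sigma x y w) \o W); last first.
    by apply/funext => j; exact: JenE.
  apply: (cvg_comp W _ Ww).
  have [dSw _ _] := dS x y w wr.
  exact: differentiable_continuous (differentiableB (dF x y w) dSw).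
pose W k : 'rV[R]_m := ball_seq r k.
have Wr k : Theta (W k) by exact: ball_seq_ball.
set M := sigma ^+ 2 * B in JenB.
have M0 : 0 < M by rewrite mulr_gt0// exprn_gt0.
pose f N (p : X * Y) : 'rV[R]_N.+1 := \row_(k < N.+1) Jen (W k) p.1 p.2.
have mf N k : measurable_fun setT (fun p => f N p 0 k).
  rewrite (_ : (fun p => _) = fun p : X * Y => Jen (W k) p.1 p.2); first exact: mJen.
  by apply/funext => p; rewrite mxE.
have fM N p k : `|f N p 0 k| <= M by rewrite mxE; exact: JenB.
(* W is dense in the ball; the classes W_0, ..., W_N increase with N, so on
   the lim sup of the events E_N the bound holds at every W_k. *)
have /choice[E_ HE] := fun N => rademacher_deviation D n0 M0 d01 (mf N) (fM N).
have [mE PE] := @probability_lim_sup_ge R _ _ (prod_prob (fun _ : 'I_n => D)) E_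
  (1 - delta)%:E (fun N => let: And3 mE _ _ := HE N in mE)
  (fun N => let: And3 _ PE _ := HE N in PE).
exists (lim_sup_set E_); split => // S ES w wr.
pose Lg := ln (4 / delta); pose Z := beta ^+ 2 * J_S h r sigma G S + l ^+ 2 * H_S Bm S.
pose K := 2 * (2 * Num.sqrt 2) * (r * sigma / Num.sqrt n%:R) * Num.sqrt Z +
  8 * sigma ^+ 2 * B * Num.sqrt (2 * Lg / n%:R).
pose Mi i := (2 * sigma ^+ 2) *:
  ((beta ^+ 2 * fine (A_sup h r sigma (tnth S i).1)) *: G S i + l ^+ 2 *: Bm S i).
have lip i w1 w2 : Theta w1 -> Theta w2 ->
    (Jen w1 (tnth S i).1 (tnth S i).2 - Jen w2 (tnth S i).1 (tnth S i).2) ^+ 2 <=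
    ((w1 - w2) *m Mi i *m (w1 - w2)^T) 0 0.
  move=> wr1 wr2; rewrite !JenE//.
  apply: gap_lipschitz => //.
  - exact: Reg_C2 HReg S i.
  - by move=> w' t a b wr' t01; exact: Reg_hess_integrable HReg S i w' t a b wr' t01.
  - by move=> w' a b wr'; exact: Reg_hess_integrable_time HReg S i w' a b wr'.
  - by move=> w' wr'; exact: Reg_diff HReg S i w' wr'.
  - by move=> w' wr'; exact: Reg_G HReg S i w' wr'.
  - exact: Reg_A HReg S i.
  - by move=> w' wr'; exact: Reg_B HReg S i w' wr'.
have pMi i : psd (Mi i).
  apply: psdZ; first by rewrite mulr_ge0// sqr_ge0.
  apply: psdD; apply: psdZ; [|exact: Reg_G_psd HReg S i|exact: sqr_ge0|
    exact: Reg_B_psd HReg S i].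
  by rewrite mulr_ge0 ?sqr_ge0//; exact: (A_sup_ge0 sigma (Reg_C2 HReg S i) (Wr 0%N)).
have trMi : \sum_(i < n) \tr (Mi i) = 2 * sigma ^+ 2 * (n%:R * Z).
  rewrite /Mi; under eq_bigr do rewrite mxtraceZ mxtraceD !mxtraceZ.
  rewrite -big_distrr big_split/=; congr (_ * _).
  rewrite /Z /J_S /H_S mulrDr; congr (_ + _).
    rewrite mulrCA [n%:R * _]mulVKf ?gt_eqF// mulr_sumr; apply: eq_bigr => i _.
    by rewrite mulrA.
  rewrite mulrCA [n%:R * _]mulVKf ?gt_eqF// mulr_sumr.
  by apply: eq_bigr.
pose gap v := \int[D]_p Jen v p.1 p.2 -
  n%:R^-1 * \sum_(i < n) Jen v (tnth S i).1 (tnth S i).2.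
have gapW k : gap (W k) <= K.
  (* The lim sup provides j >= k with S in the j-th event, and W_k is then one of the parameters
     W_0, ..., W_j. *)
  have [j kj Ej] := ES k I.
  have [_ _ /(_ S Ej (inord k))] := HE j.
  have kE : (inord k : 'I_j.+1) = k :> nat by rewrite inordK.
  have fE p : f j p 0 (inord k) = Jen (W k) p.1 p.2 by rewrite mxE kE.
  under eq_Rintegral do rewrite fE.
  under eq_bigr do rewrite fE.
  have -> : [seq 2 *: f j x | x <- S] = [seq 2 *: f j (tnth S i) | i <- enum 'I_n].
    by rewrite -{1}(map_tnth_enum S) -map_comp.
  have rad : sign_avg (@vmax R j) [seq 2 *: f j (tnth S i) | i <- enum 'I_n] 0 <=
      4 * r * Num.sqrt (\sum_(i < n) \tr (Mi i)).
    apply: (@sign_avg_vmax_psd_le _ _ _ _ (\matrix_(a < j.+1) W a)) => //.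
      by move=> a; rewrite rowK; exact: Wr.
    move=> i a b; rewrite !rowK [f j _ 0 a]mxE [f j _ 0 b]mxE.
    by apply: lip; exact: Wr.
  move/le_trans => /(_ _ (lerD rad (lexx _))); rewrite trMi => H.
  have s0 : 0 < Num.sqrt (n%:R : R) by rewrite sqrtr_gt0.
  have sn : Num.sqrt (n%:R : R) ^+ 2 = n%:R by rewrite sqr_sqrtr// ltW.
  have e1 : Num.sqrt (2 * sigma ^+ 2 * (n%:R * Z)) =
      Num.sqrt 2 * sigma * (Num.sqrt n%:R * Num.sqrt Z).
    rewrite (sqrtrM (n%:R * Z)) ?(mulr_ge0 _ (sqr_ge0 _))//.
    by rewrite (sqrtrM (sigma ^+ 2))// sqrtr_sqr gtr0_norm// (sqrtrM Z)// ltW.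
  have e2 : Num.sqrt (2 * n%:R * Lg) = Num.sqrt n%:R * Num.sqrt (2 * Lg).
    by rewrite mulrAC mulrC (sqrtrM (2 * Lg))// ltW.
  have e3 : Num.sqrt (2 * Lg / n%:R) = Num.sqrt (2 * Lg) / Num.sqrt n%:R.
    by rewrite mulrC (sqrtrM (2 * Lg)) ?invr_ge0 ?ltW// sqrtrV ?ltW// mulrC.
  rewrite -(ler_pM2l nR) /gap mulrBr mulVKf ?gt_eqF//; apply: le_trans H _.
  rewrite e1 e2 /K e3 /M -[X in _ <= X * _]sn le_eqVlt; apply/orP; left; apply/eqP.
  by field; rewrite gt_eqF.
have [s sw] := ball_seq_dense wr.
(* The empirical part is a finite sum of continuous functions; the expectation converges by
   domination by the constant M. *)
have gap_cvg : (fun j => gap (W (s j))) @ \oo --> gap w.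
  have cJ p : (fun j => Jen (W (s j)) p.1 p.2) @ \oo --> Jen w p.1 p.2.
    by apply: cJen => // j; exact: Wr.
  apply: cvgB.
    apply: (@expectation_cvg _ _ _ D _ _ M) => //.
    - by move=> j; exact: mJen.
    - by move=> j p; exact: JenB.
    - exact: mJen.
  apply: cvgMl_tmp.
  have cJS i := cJ (tnth S i).
  exact: (@cvg_sum_seq _ _ _ (fun i j => Jen (W (s j)) (tnth S i).1 (tnth S i).2)
    (fun i => Jen w (tnth S i).1 (tnth S i).2) cJS).
have : gap w <= K.
  apply: (closed_cvg (fun x : R => x <= K) _ _ _ gap_cvg); first exact: closed_le.
  by apply: nearW => j; exact: gapW.
by rewrite /gap lerBlDl addrA.
Qed.
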